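(* For each $N\ge3$, there exists a Cantor set $X$ in $\mathbb{C}^N$ such that $h_r^{N-2}(X)\setminus X\neq\emptyset$ and $P(X)$ has dense invertibles.
   Context: An analytic subvariety of $\mathbb{C}^N$ of pure codimension $m$ means a pure-dimensional analytic subvariety of $\mathbb{C}^N$ of dimension $N-m$. For compact $X\subset\mathbb{C}^N$ and $1\le k\le N$, the $k$-rational hull $h_r^k(X)$ is the set of $z\in\mathbb{C}^N$ such that every analytic subvariety of $\mathbb{C}^N$ of pure codimension $\le k$ that passes through $z$ intersects $X$. $P(X)$ is the uniform closure on $X$ of the polynomials in the coordinate functions. A uniform algebra has dense invertibles if its invertible elements are dense in it. *)

(* Defs.v *)
(* C   := (R[i])^o, the complex numbers over an arbitrary model R : realType of
          the reals (complex from mathcomp-real-closed; ^o gives it its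
          canonical normed-module structure over itself);
   C^N := 'rV[C]_N, with its canonical normed C-module structure, so that
          [differentiable f z] below is complex Frechet differentiability. *)
From HB Require Import structures.
From mathcomp Require Import all_boot all_order all_algebra.
From mathcomp Require Import all_classical all_reals all_analysis.
From mathcomp Require Import complex.
From mathcomp Require mpoly.
Set Implicit Arguments. Unset Strict Implicit. Unset Printing Implicit Defensive.
Import Order.TTheory GRing.Theory Num.Theory.
Import numFieldTopology.Exports numFieldNormedType.Exports.
Local Open Scope classical_set_scope.
Local Open Scope ring_scope.

Notation CC R := ((R[i])^o).
Notation CN R N := ('rV[CC R]_N).

Definition holomorphic_on (R : realType) (N : nat)
  (U : set (CN R N)) (f : CN R N -> CC R) : Prop :=
  forall z, U z -> differentiable f z.

Definition analytic_subvariety (R : realType) (N : nat) (V : set (CN R N)) : Prop :=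
  closed V /\
  forall p : CN R N, exists (U : set (CN R N)) (r : nat) (g : 'I_r -> CN R N -> CC R),
    [/\ open U, U p, (forall i, holomorphic_on U (g i)) &
        V `&` U = [set z | U z /\ forall i, g i z = 0]].

(* p is a regular point of V of codimension m: near p, V is a complex
   submanifold of C^N of codimension m (dimension N - m), i.e. V is cut out
   in a neighbourhood U of p by m holomorphic functions whose differentials
   are C-linearly independent at every point of V inside U. *)
Definition regular_point_codim (R : realType) (N : nat) (V : set (CN R N))
  (m : nat) (p : CN R N) : Prop :=
  V p /\
  exists (U : set (CN R N)) (g : 'I_m -> CN R N -> CC R),
    [/\ open U, U p, (forall i, holomorphic_on U (g i)),
        V `&` U = [set z | U z /\ forall i, g i z = 0] &
        forall z, V z -> U z ->
          forall c : 'I_m -> CC R,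
            (forall h : CN R N, \sum_(i < m) c i * ('d (g i) z) h = 0) ->
            forall i, c i = 0].

(* V is an analytic subvariety of C^N of pure codimension m, i.e. of pure
   dimension N - m: every regular point of V has dimension N - m (the regular
   points of an analytic set are dense in it). *)
Definition pure_codim_subvariety (R : realType) (N : nat) (m : nat)
  (V : set (CN R N)) : Prop :=
  analytic_subvariety V /\
  forall p m', regular_point_codim V m' p -> m' = m.

Definition rational_hull (R : realType) (N : nat) (k : nat)
  (X : set (CN R N)) : set (CN R N) :=
  [set z | forall (m : nat) (V : set (CN R N)),
      (m <= k)%N -> pure_codim_subvariety m V -> V z -> V `&` X !=set0].

Definition cantor_set (R : realType) (N : nat) (X : set (CN R N)) : Prop :=
  exists (f : cantor_space -> CN R N) (g : CN R N -> cantor_space),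
    [/\ continuous f, range f = X, (forall t, g (f t) = t) &
        {within X, continuous g}].

Definition poly_eval (R : realType) (N : nat)
  (p : mpoly.mpoly N (CC R)) (z : CN R N) : CC R :=
  mpoly.meval (fun i => z ord0 i) p.

Definition in_PX (R : realType) (N : nat) (X : set (CN R N))
  (f : CN R N -> CC R) : Prop :=
  forall eps : R, 0 < eps ->
    exists p : mpoly.mpoly N (CC R), forall z, X z -> `|f z - poly_eval p z| < (eps%:C)%C.

Definition invertible_PX (R : realType) (N : nat) (X : set (CN R N))
  (f : CN R N -> CC R) : Prop :=
  in_PX X f /\ exists g, in_PX X g /\ forall z, X z -> f z * g z = 1.

Definition PX_dense_invertibles (R : realType) (N : nat) (X : set (CN R N)) : Prop :=
  forall f, in_PX X f -> forall eps : R, 0 < eps ->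
    exists g, invertible_PX X g /\ forall z, X z -> `|f z - g z| < (eps%:C)%C.

(* Main.v *)
Require Import Defs.
From HB Require Import structures.
From mathcomp Require Import all_boot all_order all_algebra.
From mathcomp Require Import all_classical all_reals all_analysis.
From mathcomp Require Import complex.
From mathcomp Require mpoly.
From mathcomp Require Import ring lra zify.
Import Order.TTheory GRing.Theory Num.Theory.
Import numFieldTopology.Exports numFieldNormedType.Exports.
Local Open Scope classical_set_scope.
Local Open Scope ring_scope.

(* The hull point is the origin. The set X is carved out of the unit ball so that
   (i) for a dense sequence of polynomials p_n, with auxiliary polynomials h_n,
   |p_n| is bounded below and |p_n h_n - 1| <= 1/2 on X, whence 1/p_n lies in P(X)
   by a Neumann series; (ii) X meets the spheres about 0 only in thin shells, and
   each shell only away from the walls of finer and finer grids, so that X is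
   compact and totally disconnected.

   Every variety V of pure codimension <= N - 2 through 0 meets X. On the zero set
   of p_n h_n - 1 in V, a set of positive dimension, the maximum modulus principle
   (max_principle) lets one walk from 0 outwards from shell to shell without
   decreasing the modulus of a prescribed holomorphic function. Applied to a
   product of powers of the p_j and of a function peaking at the current position,
   it keeps the p_j bounded below and the steps short. A binary choice is free at
   each shell, so that V meets X in an uncountable set, hence meets the perfect
   kernel of X, which is a Cantor set.

   The maximum principle rests on finding, near any point of V, regular points of V
   at which a given function is almost maximal: functions vanishing on V near a
   maximum point, with independent differentials and as many as possible, must cut
   out V there. *)

Set Implicit Arguments. Unset Strict Implicit. Unset Printing Implicit Defensive.

(** The hypothesis of pure codimension speaks of regular points only, so the maximum principle has
    to produce its own regular point close to a possibly singular maximum. There two dimensions are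
    needed: a disc must be tangent to V and to first order also to a level set of F. Only one
    equation can be imposed on V, whereas infinitely many p_n must be controlled; therefore the h_n
    are nested, and the last equation together with lower bounds for the p_j yields the earlier
    estimates. The lower bounds come from a budget. Since |p_n(0)| >= exp(-a_n 2^(-n-1)), the
    logarithms weighted by 1/a_n start with a total of at most 1. Step k of the walk spends at most
    2^(-k-1), so the total stays below 2, which gives |p_n| >= exp(-2 a_n) on X. The same step has
    length at most 2^(-k)/32, small against the k-th grid of mesh 2^(-k); the price is a spacing of
    (2^(-k)/16)^4 between the squared radii of the shells. *)

Definition cabs (R : realType) (z : CC R) : R := Normc.normc z.
Arguments cabs {R} z : simpl never.
Notation cre := (@complex.Re _).
Notation cim := (@complex.Im _).

(** * The complex modulus with real values *)

Section ComplexModulus.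
Variable R : realType.
Implicit Types (z w : CC R) (a : R).

Lemma norm_cabs z : `|z| = (cabs z)%:C%C :> R[i].
Proof. by case: z => a b; rewrite normc_def. Qed.

Lemma lt_normE z a : (`|z| < a%:C%C :> R[i]) = (cabs z < a).
Proof. by rewrite norm_cabs ltcR. Qed.

Lemma cabs_ge0 z : 0 <= cabs z :> R.
Proof. by case: z => a b; rewrite /cabs /= sqrtr_ge0. Qed.

Lemma cabs0 : cabs (0 : CC R) = 0.
Proof. exact: Normc.normc0. Qed.

Lemma cabs_eq0 z : (cabs z == 0) = (z == 0).
Proof.
apply/eqP/eqP => [|->]; first exact: Normc.eq0_normc.
exact: Normc.normc0.
Qed.

Lemma cabs_gt0 z : (0 < cabs z) = (z != 0).
Proof. by rewrite lt_neqAle cabs_ge0 andbT eq_sym cabs_eq0. Qed.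

Lemma cabsM z w : cabs (z * w) = cabs z * cabs w.
Proof. exact: Normc.normcM. Qed.

Lemma cabsV z : cabs z^-1 = (cabs z)^-1.
Proof. exact: Normc.normcV. Qed.

Lemma cabsN z : cabs (- z) = cabs z.
Proof. by case: z => a b; rewrite /cabs /= !sqrrN. Qed.

Lemma cabsD z w : cabs (z + w) <= cabs z + cabs w.
Proof.
by rewrite -lecR rmorphD /= -!norm_cabs; exact: ler_normD.
Qed.

Lemma cabsB z w : cabs (z - w) = cabs (w - z).
Proof. by rewrite -cabsN opprB. Qed.

Lemma cabs_triangle z w u : cabs (z - w) <= cabs (z - u) + cabs (u - w).
Proof. by rewrite (_ : z - w = (z - u) + (u - w)) ?cabsD//; ring. Qed.

Lemma cabsBr z w : cabs z - cabs w <= cabs (z - w).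
Proof. by rewrite lerBlDr; rewrite -{1}(subrK w z); exact: cabsD. Qed.

Lemma cabs1 : cabs (1 : CC R) = 1.
Proof. exact: Normc.normc1. Qed.

Lemma cabsX z n : cabs (z ^+ n) = cabs z ^+ n.
Proof. by elim: n => [|n ih]; rewrite ?expr0 ?cabs1// !exprS cabsM ih. Qed.

Lemma cabsR a : cabs (a%:C%C : CC R) = `|a|.
Proof. by rewrite /cabs /= expr0n/= addr0 sqrtr_sqr. Qed.

Lemma cabs_sqr z : cabs z ^+ 2 = cre z ^+ 2 + cim z ^+ 2.
Proof. by case: z => a b; rewrite /cabs /= sqr_sqrtr// addr_ge0// sqr_ge0. Qed.

Lemma cre_le z : `|cre z| <= cabs z.
Proof.
rewrite -(@ler_pXn2r _ 2)// ?nnegrE ?cabs_ge0//.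
by rewrite cabs_sqr real_normK ?num_real// lerDl sqr_ge0.
Qed.

Lemma cim_le z : `|cim z| <= cabs z.
Proof.
rewrite -(@ler_pXn2r _ 2)// ?nnegrE ?cabs_ge0//.
by rewrite cabs_sqr real_normK ?num_real// lerDr sqr_ge0.
Qed.

Lemma cabs_le z : cabs z <= `|cre z| + `|cim z|.
Proof.
rewrite -(@ler_pXn2r _ 2)// ?nnegrE ?cabs_ge0 ?addr_ge0//.
rewrite cabs_sqr sqrrD !real_normK ?num_real//.
have := mulr_ge0 (normr_ge0 (cre z)) (normr_ge0 (cim z)); lra.
Qed.

Lemma creD z w : cre (z + w) = cre z + cre w. Proof. by case: z; case: w. Qed.
Lemma cimD z w : cim (z + w) = cim z + cim w. Proof. by case: z; case: w. Qed.
Lemma creN z : cre (- z) = - cre z. Proof. by case: z. Qed.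
Lemma cimN z : cim (- z) = - cim z. Proof. by case: z. Qed.
Lemma creM z w : cre (z * w) = cre z * cre w - cim z * cim w.
Proof. by case: z; case: w. Qed.
Lemma cimM z w : cim (z * w) = cre z * cim w + cim z * cre w.
Proof. by case: z => a b; case: w => c d /=; rewrite addrC; congr (_ + _); rewrite mulrC. Qed.

Lemma cabs_sum (I : Type) (r : seq I) (P : pred I) (F : I -> CC R) :
  cabs (\sum_(i <- r | P i) F i) <= \sum_(i <- r | P i) cabs (F i).
Proof.
elim/big_ind2 : _ => [|a b c d h1 h2|//]; first by rewrite cabs0.
by apply: (le_trans (cabsD _ _)); exact: lerD.
Qed.

Lemma nbhs_cabs z (U : set (CC R)) :
  nbhs z U <-> exists2 d : R, 0 < d & forall w, cabs (w - z) < d -> U w.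
Proof.
split.
  move/nbhs_ballP => [e /= e0 eU].
  (* The radius [e] is an element of [R[i]]; being positive it is real, so its real part can replace
     it. *)
  have e0' : 0 < cre e by move: e0; rewrite ltcE => /andP[].
  have eE : e = (cre e)%:C%C by rewrite RRe_real// gtr0_real.
  exists (cre e) => // w wz; apply: eU; rewrite -ball_normE /=.
  by rewrite eE lt_normE cabsB.
case=> d d0 dU; apply/nbhs_ballP; exists (d%:C%C); first by rewrite /= ltcR.
move=> w; rewrite -ball_normE /= lt_normE cabsB; exact: dU.
Qed.

Lemma continuous_cabsP (T : topologicalType) (f : T -> CC R) (x : T) :
  {for x, continuous f} <->
  forall e : R, 0 < e -> \forall y \near x, cabs (f y - f x) < e.
Proof.
split=> [h e e0|h U /nbhs_cabs[d d0 dU]].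
  have : nbhs (f x) [set w | cabs (w - f x) < e] by apply/nbhs_cabs; exists e.
  by move/h.
by move/h : d0; apply: filterS => y /dU.
Qed.

End ComplexModulus.

(** * The l1 norm and complex differentiability on C^N *)

Section VectorNorm.
Variables (R : realType) (N : nat).
Implicit Types (z w h : CN R N).

(** The l1 norm: estimates split coordinate by coordinate, and its values in [R] are open to linear
    arithmetic. *)
Definition vn z : R := \sum_i cabs (z ord0 i).

Lemma vn_ge0 z : 0 <= vn z.
Proof. by apply: sumr_ge0 => i _; exact: cabs_ge0. Qed.

Lemma cabs_le_vn z i : cabs (z ord0 i) <= vn z.
Proof.
rewrite /vn (bigD1 i)//= lerDl; apply: sumr_ge0 => j _; exact: cabs_ge0.
Qed.

Lemma vnD z w : vn (z + w) <= vn z + vn w.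
Proof.
rewrite /vn -big_split/=; apply: ler_sum => i _.
by rewrite mxE; exact: cabsD.
Qed.

Lemma vnN z : vn (- z) = vn z.
Proof. by rewrite /vn; apply: eq_bigr => i _; rewrite mxE cabsN. Qed.

Lemma vnB z w : vn (z - w) = vn (w - z).
Proof. by rewrite -vnN opprB. Qed.

Lemma vn_triangle z w u : vn (z - w) <= vn (z - u) + vn (u - w).
Proof. by rewrite (_ : z - w = (z - u) + (u - w)) ?vnD// addrA subrK. Qed.

Lemma vnZ (a : CC R) z : vn (a *: z) = cabs a * vn z.
Proof. by rewrite /vn mulr_sumr; apply: eq_bigr => i _; rewrite mxE cabsM. Qed.

Lemma vn0 : vn 0 = 0.
Proof. by rewrite /vn big1// => i _; rewrite mxE cabs0. Qed.

Lemma vn_eq0 z : vn z = 0 -> z = 0.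
Proof.
move=> z0; apply/rowP => i; rewrite mxE; apply/eqP; rewrite -cabs_eq0.
by rewrite eq_le cabs_ge0 andbT -z0 cabs_le_vn.
Qed.

Lemma nbhs_vn z (U : set (CN R N)) :
  nbhs z U <-> exists2 d : R, 0 < d & forall w, vn (w - z) < d -> U w.
Proof.
split.
  move/nbhs_ballP => [e /= e0 eU].
  have e0' : 0 < cre e by move: e0; rewrite ltcE => /andP[].
  have eE : e = (cre e)%:C%C by rewrite RRe_real// gtr0_real.
  exists (cre e) => // w wz; apply: eU; split => // i j.
  rewrite (ord1 i) -ball_normE /= eE lt_normE cabsB.
  by have := cabs_le_vn (w - z) j; rewrite !mxE => /le_lt_trans; apply.
case=> d d0 dU; apply/nbhs_ballP; exists ((d / N.+1%:R)%:C%C).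
  by rewrite /= ltcR divr_gt0.
move=> w [_ wz]; apply: dU; rewrite /vn.
apply: (@le_lt_trans _ _ (\sum_(i < N) (d / N.+1%:R))).
  apply: ler_sum => i _; have := wz ord0 i.
  by rewrite -ball_normE /= lt_normE cabsB !mxE => /ltW.
rewrite sumr_const card_ord -[_ *+ N]mulr_natr -mulrA gtr_pMr//.
by rewrite mulrC ltr_pdivrMr// mul1r ltr_nat.
Qed.

Lemma open_vn (U : set (CN R N)) z : open U -> U z ->
  exists2 d : R, 0 < d & forall w, vn (w - z) < d -> U w.
Proof. by move=> oU Uz; apply/nbhs_vn; exact: open_nbhs_nbhs. Qed.

Lemma vn_open (U : set (CN R N)) :
  (forall z, U z -> exists2 d : R, 0 < d & forall w, vn (w - z) < d -> U w) ->
  open U.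
Proof. by rewrite openE => h z /h /nbhs_vn. Qed.

(** Frechet differentiability with the differential given by its coefficients, the form in which
    derivatives are estimated below; [differentiable_grad] and [grad_differentiable] translate in
    both directions. *)
Definition grad (f : CN R N -> CC R) z (w : 'I_N -> CC R) :=
  forall e : R, 0 < e -> exists2 d : R, 0 < d &
    forall h, vn h < d ->
      cabs (f (z + h) - f z - \sum_i w i * h ord0 i) <= e * vn h.

Definition pd (i : 'I_N) (f : CN R N -> CC R) z : CC R := 'd f z (delta_mx ord0 i).

Lemma pdE (i : 'I_N) (f : CN R N -> CC R) z : pd i f z = 'd f z (delta_mx ord0 i).
Proof. by []. Qed.

Lemma norm_le_vn h : `|h| <= (vn h)%:C%C.
Proof.
have [h0|h0] := eqVneq `|h| 0.
  by rewrite h0 lecR vn_ge0.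
have [[i j] /= hE] := mx_norm_neq0 h0; rewrite [leLHS]hE.
by rewrite (ord1 i) norm_cabs lecR cabs_le_vn.
Qed.

Lemma linear_row (f : {linear CN R N -> CC R}) h :
  f h = \sum_i f (delta_mx ord0 i) * h ord0 i.
Proof.
rewrite {1}(row_sum_delta h) linear_sum; apply: eq_bigr => i _.
by rewrite linearZ /= mulrC.
Qed.

Lemma differentiable_grad (f : CN R N -> CC R) z :
  differentiable f z -> grad f z (fun i => pd i f z).
Proof.
move=> df e e0.
have /diff_locallyP[_ /eqaddoP] := df.
have eC : 0 < e%:C%C :> R[i] by rewrite ltcR.
move=> /(_ _ eC)/nbhs_vn[d d0 dh]; exists d => // h hd.
have := dh h; rewrite subr0 => /(_ hd).
rewrite !fctE /= [h + z]addrC -linear_row.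
rewrite (_ : cst (f z) h + 'd f z h = f z + 'd f z h)// opprD addrA.
rewrite norm_cabs => hle; rewrite -lecR; apply: (le_trans hle).
rewrite rmorphM /=; apply: ler_wpM2l; first by rewrite lecR ltW.
exact: norm_le_vn.
Qed.

Definition gradlin (w : 'I_N -> CC R) (h : CN R N) : CC R :=
  \sum_i w i * h ord0 i.

Fact gradlin_linear (w : 'I_N -> CC R) : linear (gradlin w).
Proof.
move=> a u v; rewrite /gradlin scaler_sumr -big_split/=; apply: eq_bigr => i _.
by rewrite !mxE /GRing.scale /=; ring.
Qed.

HB.instance Definition _ (w : 'I_N -> CC R) := GRing.isLinear.Build _ _ _ _ (gradlin w) (gradlin_linear w).

Lemma vn_le_norm h : (vn h)%:C%C <= N%:R * `|h|.
Proof.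
rewrite /vn rmorph_sum /= mulr_natl.
rewrite (_ : `|h| *+ _ = \sum_(i < N) `|h|); last by rewrite sumr_const card_ord.
apply: ler_sum => i _; rewrite -norm_cabs.
have : mx_norm h = `|h| by [].
rewrite mx_normE => <-.
rewrite -[leLHS]nngE num_le.
exact: (le_bigmax _ (fun ij : 'I_1 * 'I_N => `|h ij.1 ij.2|%:nng) (ord0, i)).
Qed.

Lemma grad_bound (w : 'I_N -> CC R) h : cabs (\sum_i w i * h ord0 i) <= (\sum_i cabs (w i)) * vn h.
Proof.
apply: (le_trans (cabs_sum _ _ _)); rewrite mulr_suml; apply: ler_sum => i _.
by rewrite cabsM ler_wpM2l ?cabs_ge0// cabs_le_vn.
Qed.

Lemma grad_differentiable (f : CN R N -> CC R) z (w : 'I_N -> CC R) : grad f z w ->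
  differentiable f z /\ forall i, pd i f z = w i.
Proof.
move=> gf.
have cw : continuous (gradlin w).
  move=> x; apply/continuous_cabsP => e e0; apply/nbhs_vn.
  have S0 : 0 <= \sum_i cabs (w i) by apply: sumr_ge0 => i _; exact: cabs_ge0.
  exists (e / (1 + \sum_i cabs (w i))); first by rewrite divr_gt0// ltr_pwDl.
  move=> y; rewrite ltr_pdivlMr ?ltr_pwDl// => yx.
  rewrite -linearB /gradlin; apply: (le_lt_trans (grad_bound _ _)).
  by apply: le_lt_trans yx; rewrite mulrC ler_wpM2l ?vn_ge0// lerDr.
have lo (e : R[i]) : 0 < e ->
    \forall h \near (0 : CN R N),
      `|f (h + z) - (f z + gradlin w h) : CC R| <= e * `|h|.
  move=> e0.
  have e0' : 0 < cre e by move: e0; rewrite ltcE => /andP[].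
  have eE : e = (cre e)%:C%C by rewrite RRe_real// gtr0_real.
  (* By [vn_le_norm], passing from the maximum norm to [vn] costs a factor [N]; dividing by [N.+1]
     also covers [N = 0]. *)
  have [|d d0 dh] := gf (cre e / N.+1%:R); first by rewrite divr_gt0.
  apply/nbhs_vn; exists d => // h; rewrite subr0 => /dh hd.
  rewrite /= [h + z]addrC opprD addrA norm_cabs eE.
  apply: (@le_trans _ _ ((cre e / N.+1%:R * vn h)%:C%C)); first by rewrite lecR.
  rewrite rmorphM /= rmorphM /= -mulrA; apply: ler_wpM2l.
    by rewrite lecR ltW.
  apply: le_trans (_ : (N.+1%:R^-1)%:C%C * (N%:R * `|h|) <= _).
    by apply: ler_wpM2l; [rewrite lecR invr_ge0|exact: vn_le_norm].
  rewrite mulrA -[leRHS]mul1r; apply: ler_wpM2r => //.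
  rewrite -[N%:R](rmorph_nat (real_complex R)) -rmorphM /= -(rmorph1 (real_complex R)) lecR.
  by rewrite mulrC ler_pdivrMr// mul1r ler_nat.
have dE : 'd f z = gradlin w :> (CN R N -> CC R) by apply: diff_unique => //; apply/eqaddoP => e /lo.
split.
  by apply/diff_locallyP; rewrite dE; split => //; apply/eqaddoP => e /lo.
move=> i; rewrite /pd dE /gradlin (bigD1 i)//= mxE !eqxx mulr1 big1 ?addr0//.
by move=> j ji; rewrite mxE eqxx (negbTE ji) mulr0.
Qed.

End VectorNorm.

(** * Integrals of real and complex functions over segments *)

Section RealIntegral.
Variable R : realType.

Definition rint (g : R -> R) (a b : R) : R :=
  \int[lebesgue_measure]_(x in `[a, b]) g x.

Definition itvcont (g : R -> R) (a b : R) := {within `[a, b], continuous g}.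

Lemma itvcont_integrable g a b : itvcont g a b ->
  lebesgue_measure.-integrable `[a, b] (EFin \o g).
Proof. by move=> h; apply: continuous_compact_integrable => //; exact: segment_compact. Qed.

Lemma itvcont_sub g a b c d : a <= c -> d <= b -> itvcont g a b -> itvcont g c d.
Proof.
move=> ac db; apply: continuous_subspaceW => x /=; rewrite !in_itv /=.
by move=> /andP[cx xd]; rewrite (le_trans ac cx) (le_trans xd db).
Qed.

Lemma rintD f g a b : itvcont f a b -> itvcont g a b ->
  rint (fun x => f x + g x) a b = rint f a b + rint g a b.
Proof. by move=> hf hg; rewrite /rint RintegralD//; exact: itvcont_integrable. Qed.

Lemma rintZ f c a b : itvcont f a b -> rint (fun x => c * f x) a b = c * rint f a b.
Proof. by move=> hf; rewrite /rint RintegralZl//; exact: itvcont_integrable. Qed.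

Lemma rint_cat f a b c : a <= b -> b <= c -> itvcont f a c ->
  rint f a c = rint f a b + rint f b c.
Proof.
move=> ab bc hf; rewrite /rint.
have := @Rintegral_itvB _ f (BLeft a) (BRight c) b (itvcont_integrable hf).
rewrite bnd_simp => /(_ ab); rewrite bnd_simp => /(_ bc) => E.
rewrite -(@Rintegral_itv_obnd_cbnd _ b); last first.
  apply: (@integrableS _ _ _ lebesgue_measure `[b, c]%classic) => //.
    exact: subset_itv_oc_cc.
  by apply: itvcont_integrable; exact: itvcont_sub hf.
by rewrite -E addrC subrK.
Qed.

Lemma rint_cst (c a b : R) : a <= b -> rint (fun=> c) a b = c * (b - a).
Proof.
move=> ab; rewrite /rint Rintegral_cst//= lebesgue_measure_itv/= lte_fin.
by move: ab; rewrite le_eqVlt => /orP[/eqP->|->]; rewrite ?ltxx /= ?subrr.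
Qed.

Lemma rint_bound f (M a b : R) : a <= b -> itvcont f a b ->
  (forall x, a <= x <= b -> `|f x| <= M) -> `|rint f a b| <= M * (b - a).
Proof.
move=> ab hf hM.
have := @le_normr_Rintegral _ _ _ lebesgue_measure `[a, b]%classic f.
move=> /(_ (measurable_itv _) (itvcont_integrable hf)) /le_trans; apply.
rewrite -rint_cst//; apply: le_Rintegral => //.
- have := @itvcont_integrable (fun x => `|f x|) a b; apply.
  by move=> x; apply: cvg_norm; exact: hf.
- by apply: itvcont_integrable; move=> x; exact: cst_continuous.
Qed.

End RealIntegral.

Section ComplexIntegral.
Variable R : realType.
Implicit Types (f g : CC R -> CC R) (z w : CC R).

Definition cts f z := forall e : R, 0 < e ->
  exists2 d : R, 0 < d & forall w, cabs (w - z) < d -> cabs (f w - f z) < e.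

(** Written without a quotient, so that [h = 0] needs no exception. *)
Definition cdif f z (l : CC R) := forall e : R, 0 < e ->
  exists2 d : R, 0 < d & forall h, cabs h < d ->
    cabs (f (z + h) - f z - l * h) <= e * cabs h.

Definition pt (x y : R) : CC R := (x +i* y)%C.

Definition scont (g : R -> CC R) (a b : R) :=
  itvcont (fun x => cre (g x)) a b /\ itvcont (fun x => cim (g x)) a b.

Definition cint (g : R -> CC R) (a b : R) : CC R :=
  pt (rint (fun x => cre (g x)) a b) (rint (fun x => cim (g x)) a b).

Lemma pt_eta z : pt (cre z) (cim z) = z. Proof. by case: z. Qed.

Lemma itvcontP (g : R -> R) a b :
  (forall x, a <= x <= b -> forall e : R, 0 < e -> exists2 d : R, 0 < d &
     forall y, a <= y <= b -> `|y - x| < d -> `|g y - g x| < e) ->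
  itvcont g a b.
Proof.
move=> h; apply/subspace_continuousP => x /=; rewrite in_itv /= => xab.
apply/cvgrPdist_lt => e /(h _ xab)[d d0 hd].
rewrite near_withinE; apply/nbhs_ballP; exists d => //= y.
rewrite /ball /= => yx; rewrite in_itv /= => yab.
by rewrite distrC; apply: hd => //; rewrite distrC.
Qed.

Lemma scont_comp f (p : R -> CC R) a b :
  (forall x y, cabs (p x - p y) <= `|x - y|) ->
  (forall x, a <= x <= b -> cts f (p x)) -> scont (fun x => f (p x)) a b.
Proof.
move=> hp hf; split; apply: itvcontP => x xab e /(hf _ xab)[d d0 hd];
  exists d => // y yab yx; apply: le_lt_trans (hd (p y) _).
- by rewrite -creN -creD; exact: cre_le.
- exact: le_lt_trans yx.
- by rewrite -cimN -cimD; exact: cim_le.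
- exact: le_lt_trans yx.
Qed.

Lemma cintD (f g : R -> CC R) a b : scont f a b -> scont g a b ->
  cint (fun x => f x + g x) a b = cint f a b + cint g a b.
Proof.
move=> [f1 f2] [g1 g2]; rewrite /cint.
rewrite (_ : (fun x => cre _) = (fun x => cre (f x) + cre (g x))); last by apply/funext => x; rewrite creD.
rewrite (_ : (fun x => cim _) = (fun x => cim (f x) + cim (g x))); last by apply/funext => x; rewrite cimD.
by rewrite !rintD.
Qed.

Lemma itvcontZ (g : R -> R) c a b : itvcont g a b -> itvcont (fun x => c * g x) a b.
Proof. by move=> h x; apply: cvgM; [exact: cvg_cst|exact: h]. Qed.

Lemma cintZ (c : CC R) (f : R -> CC R) a b : scont f a b ->
  cint (fun x => c * f x) a b = c * cint f a b.
Proof.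
move=> [f1 f2]; rewrite /cint.
rewrite (_ : (fun x => cre _) = (fun x => cre c * cre (f x) + (- cim c) * cim (f x))); last first.
  by apply/funext => x; rewrite creM mulNr.
rewrite (_ : (fun x => cim _) = (fun x => cre c * cim (f x) + cim c * cre (f x))); last first.
  by apply/funext => x; rewrite cimM.
rewrite !rintD; try exact: itvcontZ.
rewrite !rintZ//; case: c => c d /=; rewrite /pt /=.
by apply/eqP; rewrite eq_complex /= mulNr addrC; apply/andP; split => //=; apply/eqP; ring.
Qed.

Lemma cint_cat (f : R -> CC R) a b c : a <= b -> b <= c -> scont f a c ->
  cint f a c = cint f a b + cint f b c.
Proof. by move=> ab bc [f1 f2]; rewrite /cint (rint_cat ab bc f1) (rint_cat ab bc f2). Qed.

Lemma cint_cst (c : CC R) a b : a <= b -> cint (fun=> c) a b = c * (b - a)%:C%C.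
Proof.
by move=> ab; rewrite /cint !rint_cst//; case: c => c d /=; rewrite /pt;
  apply/eqP; rewrite eq_complex /= !mulr0 subr0 add0r !eqxx.
Qed.

(** Real and imaginary part are bounded separately, whence the factor 2; sharp constants are not
    aimed at. *)
Lemma cint_bound (f : R -> CC R) (M a b : R) : a <= b -> scont f a b ->
  (forall x, a <= x <= b -> cabs (f x) <= M) -> cabs (cint f a b) <= 2 * M * (b - a).
Proof.
move=> ab [f1 f2] hM; apply: (le_trans (cabs_le _)) => /=.
rewrite -mulrA mulrDl !mul1r lerD// rint_bound// => x /hM; apply: le_trans.
  exact: cre_le.
exact: cim_le.
Qed.

End ComplexIntegral.

(** * Rules for the complex derivative *)

Section ComplexDerivative.
Variable R : realType.
Implicit Types (f g : CC R -> CC R) (z w l m : CC R).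

Lemma ctsP f z : cts f z <-> {for z, continuous f}.
Proof.
split=> [h|/continuous_cabsP h e /h/nbhs_cabs//].
by apply/continuous_cabsP => e /h ?; apply/nbhs_cabs.
Qed.

Lemma cts_cst (c : CC R) z : cts (fun=> c) z.
Proof. by apply/ctsP; exact: cst_continuous. Qed.

Lemma cts_id z : cts id z.
Proof. by move=> e e0; exists e. Qed.

Lemma ctsD f g z : cts f z -> cts g z -> cts (fun w => f w + g w) z.
Proof. by move=> /ctsP hf /ctsP hg; apply/ctsP; exact: (continuousD hf hg). Qed.

Lemma ctsM f g z : cts f z -> cts g z -> cts (fun w => f w * g w) z.
Proof. by move=> /ctsP hf /ctsP hg; apply/ctsP; exact: (continuousM hf hg). Qed.

Lemma ctsN f z : cts f z -> cts (fun w => - f w) z.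
Proof. by move=> /ctsP hf; apply/ctsP; exact: (continuousN hf). Qed.

Lemma ctsV f z : f z != 0 -> cts f z -> cts (fun w => (f w)^-1) z.
Proof. by move=> fz0 /ctsP hf; apply/ctsP; exact: (continuousV fz0 hf). Qed.

(** Caratheodory's criterion: the difference quotient, completed by [l] at [z], is continuous. The
    rules for products and inverses become algebra with the factors [phi]. *)
Lemma cdif_car f z l : cdif f z l <->
  exists2 phi, cts phi z /\ phi z = l & forall w, f w - f z = phi w * (w - z).
Proof.
split.
- move=> h; exists (fun w => if w == z then l else (f w - f z) / (w - z)); last first.
    by move=> w; case: eqVneq => [->|wz]; rewrite ?subrr ?mulr0// divfK// subr_eq0.
  rewrite eqxx; split => // e e0.
  have [|d d0 hd] := h (e / 2); first by rewrite divr_gt0.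
  exists d => // w wd; rewrite eqxx; case: eqVneq => [_|wz]; first by rewrite subrr cabs0.
  have wz0 : w - z != 0 by rewrite subr_eq0.
  rewrite (_ : _ - l = (f w - f z - l * (w - z)) / (w - z)); last by rewrite [RHS]mulrBl mulfK.
  have := hd _ wd; rewrite [z + _]addrC subrK => hw.
  rewrite cabsM cabsV ltr_pdivrMr ?cabs_gt0//; apply: (le_lt_trans hw).
  by rewrite ltr_pM2r ?cabs_gt0//; lra.
- case=> phi [cphi <-] fE e /cphi[d d0 hd]; exists d => // h hh.
  rewrite fE [z + h - z]addrC addKr -mulrBl cabsM ler_wpM2r ?cabs_ge0// ltW// hd//.
  by rewrite [z + h - z]addrC addKr.
Qed.

Lemma cdif_cts f z l : cdif f z l -> cts f z.
Proof.
case/cdif_car => phi [cphi _] fE.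
rewrite (_ : f = fun w => f z + phi w * (w + - z)); last by apply/funext => w; rewrite -fE addrC subrK.
apply: ctsD; first exact: cts_cst.
by apply: ctsM => //; apply: ctsD; [exact: cts_id|exact: cts_cst].
Qed.

Lemma cdif_near f g z l (d : R) : 0 < d -> (forall w, cabs (w - z) < d -> f w = g w) ->
  cdif f z l -> cdif g z l.
Proof.
move=> d0 fg hf e /hf[d' d'0 h]; exists (Num.min d d'); first by rewrite lt_min d0.
move=> w; rewrite lt_min => /andP[wd wd']; rewrite -fg -?fg ?h//.
  by rewrite subrr cabs0.
by rewrite [_ + w]addrC addrK.
Qed.

Lemma cdif_cst (c z : CC R) : cdif (fun=> c) z 0.
Proof.
apply/cdif_car; exists (fun=> 0); first by split => //; exact: cts_cst.
by move=> w; rewrite mul0r subrr.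
Qed.

Lemma cdif_id z : cdif id z 1.
Proof.
apply/cdif_car; exists (fun=> 1); first by split => //; exact: cts_cst.
by move=> w; rewrite mul1r.
Qed.

Lemma cdifD f g z l m : cdif f z l -> cdif g z m -> cdif (fun w => f w + g w) z (l + m).
Proof.
move=> /cdif_car[p [cp <-] fE] /cdif_car[q [cq <-] gE]; apply/cdif_car.
exists (fun w => p w + q w); first by split => //; exact: ctsD.
by move=> w; rewrite mulrDl -fE -gE; ring.
Qed.

Lemma cdifM f g z l m : cdif f z l -> cdif g z m ->
  cdif (fun w => f w * g w) z (l * g z + f z * m).
Proof.
move=> df dg; have cg := cdif_cts dg.
move: df dg => /cdif_car[p [cp <-] fE] /cdif_car[q [cq <-] gE]; apply/cdif_car.
exists (fun w => p w * g w + f z * q w).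
  by split => //; apply: ctsD; apply: ctsM => //; exact: cts_cst.
move=> w; rewrite mulrDl mulrAC -fE -mulrA -gE; ring.
Qed.

Lemma cdifV f z l : f z != 0 -> cdif f z l -> cdif (fun w => (f w)^-1) z (- l / f z ^+ 2).
Proof.
move=> fz0 df; have cf := cdif_cts df.
have [|d d0 hd] := cf (cabs (f z)); first by rewrite cabs_gt0.
have fw0 w : cabs (w - z) < d -> f w != 0.
  move=> /hd; apply: contraTneq => ->; by rewrite sub0r cabsN ltxx.
move: df => /cdif_car[p [cp <-] fE].
pose g w := (f z)^-1 + (- p w / (f w * f z)) * (w - z).
apply: (@cdif_near g _ _ _ d) => //.
  move=> w /fw0 w0; rewrite /g mulrAC mulNr -fE; field; exact/andP.
apply/cdif_car; exists (fun w => - p w * ((f w) ^-1 * (f z)^-1)).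
  split; last by rewrite -invfM expr2.
  apply: ctsM; first exact: ctsN.
  by apply: ctsM; [exact: ctsV|exact: cts_cst].
move=> w; rewrite /g subrr mulr0 addr0 [_^-1 + _]addrC addrK.
by rewrite invfM.
Qed.

End ComplexDerivative.

(** * Contour integrals over rectangles and Goursat's theorem *)

Section Rectangles.
Variable R : realType.
Implicit Types (f g : CC R -> CC R) (z w l m p : CC R) (x y : R).

Definition ii : CC R := pt 0 1.

Definition hseg f y x0 x1 := cint (fun x => f (pt x y)) x0 x1.
Definition vseg f x y0 y1 := cint (fun y => f (pt x y)) y0 y1.

(** The contour integral along the boundary, counterclockwise. *)
Definition rect f x0 x1 y0 y1 : CC R :=
  hseg f y0 x0 x1 - hseg f y1 x0 x1 + ii * (vseg f x1 y0 y1 - vseg f x0 y0 y1).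

Definition inrect x0 x1 y0 y1 z := (x0 <= cre z <= x1) && (y0 <= cim z <= y1).
Definition bdry x0 x1 y0 y1 z := inrect x0 x1 y0 y1 z &&
  [|| cre z == x0, cre z == x1, cim z == y0 | cim z == y1].

Definition bcont f x0 x1 y0 y1 := forall z, bdry x0 x1 y0 y1 z -> cts f z.

Lemma ptBx x x' y : cabs (pt x y - pt x' y) = `|x - x'|.
Proof.
rewrite (_ : pt x y - pt x' y = (x - x')%:C%C) ?cabsR//.
by apply/eqP; rewrite eq_complex /= subrr !eqxx.
Qed.

Lemma ptBy x y y' : cabs (pt x y - pt x y') = `|y - y'|.
Proof.
rewrite (_ : pt x y - pt x y' = ii * (y - y')%:C%C).
  by rewrite cabsM cabsR /cabs /= expr0n expr1n /= add0r sqrtr1 mul1r.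
by apply/eqP; rewrite eq_complex /=; apply/andP; split; apply/eqP; ring.
Qed.

Lemma hseg_scont f x0 x1 y : (forall x, x0 <= x <= x1 -> cts f (pt x y)) ->
  scont (fun x => f (pt x y)) x0 x1.
Proof. by move=> h; apply: scont_comp => // x x'; rewrite ptBx. Qed.

Lemma vseg_scont f x y0 y1 : (forall y, y0 <= y <= y1 -> cts f (pt x y)) ->
  scont (fun y => f (pt x y)) y0 y1.
Proof. by move=> h; apply: (@scont_comp _ f (pt x)) => // y y'; rewrite ptBy. Qed.

Section Bdry.
Variables (x0 x1 y0 y1 : R).
Hypotheses (hx : x0 <= x1) (hy : y0 <= y1).

Lemma bdry_side x y : x0 <= x <= x1 -> y0 <= y <= y1 ->
  [/\ bdry x0 x1 y0 y1 (pt x y0), bdry x0 x1 y0 y1 (pt x y1),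
      bdry x0 x1 y0 y1 (pt x0 y) & bdry x0 x1 y0 y1 (pt x1 y)].
Proof. by move=> h1 h2; rewrite /bdry /inrect /= h1 h2 !lexx hx hy !eqxx ?orbT. Qed.

Lemma bcont_sides f : bcont f x0 x1 y0 y1 ->
  [/\ scont (fun x => f (pt x y0)) x0 x1, scont (fun x => f (pt x y1)) x0 x1,
      scont (fun y => f (pt x0 y)) y0 y1 & scont (fun y => f (pt x1 y)) y0 y1].
Proof.
have hx0 : x0 <= x0 <= x1 by rewrite lexx.
have hy0 : y0 <= y0 <= y1 by rewrite lexx.
move=> h; split.
- by apply: hseg_scont => x xx; apply: h; case: (bdry_side xx hy0).
- by apply: hseg_scont => x xx; apply: h; case: (bdry_side xx hy0).
- by apply: vseg_scont => y yy; apply: h; case: (bdry_side hx0 yy).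
- by apply: vseg_scont => y yy; apply: h; case: (bdry_side hx0 yy).
Qed.

Lemma rectD f g : bcont f x0 x1 y0 y1 -> bcont g x0 x1 y0 y1 ->
  rect (fun z => f z + g z) x0 x1 y0 y1 = rect f x0 x1 y0 y1 + rect g x0 x1 y0 y1.
Proof.
move=> /bcont_sides[f1 f2 f3 f4] /bcont_sides[g1 g2 g3 g4].
by rewrite /rect /hseg /vseg !cintD//; ring.
Qed.

Lemma rectZ c f : bcont f x0 x1 y0 y1 ->
  rect (fun z => c * f z) x0 x1 y0 y1 = c * rect f x0 x1 y0 y1.
Proof.
by move=> /bcont_sides[f1 f2 f3 f4]; rewrite /rect /hseg /vseg !cintZ//; ring.
Qed.

Lemma rect_bound f (M : R) : bcont f x0 x1 y0 y1 ->
  (forall z, bdry x0 x1 y0 y1 z -> cabs (f z) <= M) ->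
  cabs (rect f x0 x1 y0 y1) <= 4 * M * ((x1 - x0) + (y1 - y0)).
Proof.
have hx0 : x0 <= x0 <= x1 by rewrite lexx.
have hy0 : y0 <= y0 <= y1 by rewrite lexx.
move=> /bcont_sides[f1 f2 f3 f4] hM; rewrite /rect.
have b1 : cabs (hseg f y0 x0 x1) <= 2 * M * (x1 - x0).
  by apply: cint_bound => // x xx; apply: hM; case: (bdry_side xx hy0).
have b2 : cabs (hseg f y1 x0 x1) <= 2 * M * (x1 - x0).
  by apply: cint_bound => // x xx; apply: hM; case: (bdry_side xx hy0).
have b3 : cabs (vseg f x0 y0 y1) <= 2 * M * (y1 - y0).
  by apply: cint_bound => // y yy; apply: hM; case: (bdry_side hx0 yy).
have b4 : cabs (vseg f x1 y0 y1) <= 2 * M * (y1 - y0).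
  by apply: cint_bound => // y yy; apply: hM; case: (bdry_side hx0 yy).
apply: (le_trans (cabsD _ _)); rewrite cabsM.
rewrite (_ : cabs ii = 1); last by rewrite /cabs /= expr0n expr1n /= add0r sqrtr1.
rewrite mul1r.
have := cabsD (hseg f y0 x0 x1) (- hseg f y1 x0 x1).
have := cabsD (vseg f x1 y0 y1) (- vseg f x0 y0 y1).
by rewrite !cabsN; lra.
Qed.

(** Stands in for the existence of a primitive: opposite sides differ only by a constant times their
    length, and the two differences cancel because [ii * ii = -1]. *)
Lemma rect_affine (a b : CC R) : rect (fun z => a + b * z) x0 x1 y0 y1 = 0.
Proof.
have cA (a' b' : CC R) z : cts (fun z => a' + b' * z) z.
  apply: ctsD; first exact: cts_cst.
  by apply: ctsM; [exact: cts_cst|exact: cts_id].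
have sh (a' : CC R) : scont (fun x => a' + b * pt x 0) x0 x1.
  by apply: (@hseg_scont (fun z => a' + b * z)) => x _; exact: cA.
have sv (a' : CC R) : scont (fun y => a' + b * pt 0 y) y0 y1.
  by apply: (@vseg_scont (fun z => a' + b * z)) => x _; exact: cA.
have sc (c : CC R) u v : scont (fun=> c) u v.
  by split => x; exact: cst_continuous.
have hE y : hseg (fun z => a + b * z) y x0 x1 =
    cint (fun x => a + b * pt x 0) x0 x1 + b * pt 0 y * (x1 - x0)%:C%C.
  rewrite -cint_cst// -cintD//; congr cint; apply/funext => x.
  by rewrite (_ : pt x y = pt x 0 + pt 0 y); [ring|apply/eqP; rewrite eq_complex /= addr0 add0r !eqxx].
have vE x : vseg (fun z => a + b * z) x y0 y1 =
    cint (fun y => a + b * pt 0 y) y0 y1 + b * pt x 0 * (y1 - y0)%:C%C.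
  rewrite -cint_cst// -cintD//; congr cint; apply/funext => y.
  by rewrite (_ : pt x y = pt 0 y + pt x 0); [ring|apply/eqP; rewrite eq_complex /= addr0 add0r !eqxx].
rewrite /rect !hE !vE.
rewrite (_ : _ + _ = b * ((pt 0 y0 - pt 0 y1) * (x1 - x0)%:C%C + ii * ((pt x1 0 - pt x0 0) * (y1 - y0)%:C%C))); last by ring.
rewrite (_ : _ + ii * _ = 0) ?mulr0//.
by apply/eqP; rewrite eq_complex /=; apply/andP; split; apply/eqP; ring.
Qed.

End Bdry.

Lemma rect_splitx f x0 xm x1 y0 y1 : x0 <= xm -> xm <= x1 -> y0 <= y1 ->
  bcont f x0 xm y0 y1 -> bcont f xm x1 y0 y1 ->
  rect f x0 x1 y0 y1 = rect f x0 xm y0 y1 + rect f xm x1 y0 y1.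
Proof.
move=> h0 h1 hy c1 c2.
have yy0 : y0 <= y0 <= y1 by rewrite lexx.
have hs y : (y == y0) || (y == y1) -> hseg f y x0 x1 = hseg f y x0 xm + hseg f y xm x1.
  move=> yE; apply: cint_cat => //; apply: hseg_scont => x /andP[xa xb].
  have [xm'|xm'] := leP x xm.
    have := @bdry_side x0 xm y0 y1 h0 hy x y0; rewrite xa xm' lexx hy => -[]// b1 b2 _ _.
    by apply: c1; move: yE => /orP[/eqP->|/eqP->].
  have := @bdry_side xm x1 y0 y1 h1 hy x y0; rewrite (ltW xm') xb lexx hy => -[]// b1 b2 _ _.
  by apply: c2; move: yE => /orP[/eqP->|/eqP->].
by rewrite /rect !hs ?eqxx ?orbT//; ring.
Qed.

Lemma rect_splity f x0 x1 y0 ym y1 : y0 <= ym -> ym <= y1 -> x0 <= x1 ->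
  bcont f x0 x1 y0 ym -> bcont f x0 x1 ym y1 ->
  rect f x0 x1 y0 y1 = rect f x0 x1 y0 ym + rect f x0 x1 ym y1.
Proof.
move=> h0 h1 hx c1 c2.
have hs x : (x == x0) || (x == x1) -> vseg f x y0 y1 = vseg f x y0 ym + vseg f x ym y1.
  move=> xE; apply: cint_cat => //; apply: vseg_scont => y /andP[ya yb].
  have [xm'|xm'] := leP y ym.
    have := @bdry_side x0 x1 y0 ym hx h0 x0 y; rewrite ya xm' lexx hx => -[]// _ _ b1 b2.
    by apply: c1; move: xE => /orP[/eqP->|/eqP->].
  have := @bdry_side x0 x1 ym y1 hx h1 x0 y; rewrite (ltW xm') yb lexx hx => -[]// _ _ b1 b2.
  by apply: c2; move: xE => /orP[/eqP->|/eqP->].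
by rewrite /rect !hs ?eqxx ?orbT//; ring.
Qed.

Lemma inrect_cabs x0 x1 y0 y1 z w : inrect x0 x1 y0 y1 z -> inrect x0 x1 y0 y1 w ->
  cabs (z - w) <= (x1 - x0) + (y1 - y0).
Proof.
move=> /andP[/andP[a b] /andP[c d]] /andP[/andP[a' b'] /andP[c' d']].
apply: (le_trans (cabs_le _)); rewrite creD cimD creN cimN.
by apply: lerD; rewrite ler_norml; apply/andP; split; lra.
Qed.

Lemma nested_point (a b : nat -> R) : (forall n, a n <= b n) ->
  (forall n, a n <= a n.+1) -> (forall n, b n.+1 <= b n) ->
  exists c, forall n, a n <= c <= b n.
Proof.
move=> ab ai bi.
have amono (m n : nat) : (m <= n)%N -> a m <= a n.
  by move=> /subnK <-; elim: (n - m)%N => // k /le_trans; apply.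
have bmono (m n : nat) : (m <= n)%N -> b n <= b m.
  by move=> /subnK <-; elim: (n - m)%N => // k; exact: le_trans (bi _).
have abmn (m n : nat) : a m <= b n.
  have [mn|nm] := leqP m n; first exact: le_trans (amono _ _ mn) (ab n).
  exact: le_trans (ab m) (bmono _ _ (ltnW nm)).
have hs : has_sup (range a).
  by split; [exists (a 0%N); exists 0%N|exists (b 0%N) => _ [m _ <-]].
exists (sup (range a)) => n; apply/andP; split.
  by apply: ub_le_sup; [case: hs|exists n].
by apply: ge_sup => [|_ [m _ <-]//]; case: hs.
Qed.

Section Goursat.
Variables (f : CC R -> CC R) (X0 X1 Y0 Y1 : R).
Hypotheses (hX : X0 <= X1) (hY : Y0 <= Y1).
Hypothesis fd : forall z, inrect X0 X1 Y0 Y1 z -> exists l, cdif f z l.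

Lemma four_parts (x1 x2 x3 x4 x12 x34 x : R) : 4 * x1 < x -> 4 * x2 < x -> 4 * x3 < x -> 4 * x4 < x ->
  x34 <= x3 + x4 -> x12 <= x1 + x2 -> x <= x12 + x34 -> False.
Proof. by lra. Qed.

Record quad := Quad { qx0 : R; qx1 : R; qy0 : R; qy1 : R }.
Let qrect q := rect f (qx0 q) (qx1 q) (qy0 q) (qy1 q).
Let sub q := [/\ X0 <= qx0 q, qx0 q <= qx1 q, qx1 q <= X1 &
  [/\ Y0 <= qy0 q, qy0 q <= qy1 q & qy1 q <= Y1]].

Let quarter q q' := [/\ sub q',
  [/\ qx0 q <= qx0 q', qx1 q' <= qx1 q & qx1 q' - qx0 q' = (qx1 q - qx0 q) / 2],
  [/\ qy0 q <= qy0 q', qy1 q' <= qy1 q & qy1 q' - qy0 q' = (qy1 q - qy0 q) / 2] &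
  cabs (qrect q) <= 4 * cabs (qrect q')].

Let sub_bcont q : sub q -> bcont f (qx0 q) (qx1 q) (qy0 q) (qy1 q).
Proof.
case=> a b c [d e g] z /andP[/andP[/andP[h1 h2] /andP[h3 h4]] _].
have [|l] := fd (z := z); last by move/cdif_cts.
by apply/andP; split; apply/andP; split; lra.
Qed.

(** If each of the four quarters carried less than a quarter of the integral, they could not add up
    to it. *)
Let bisect q : sub q -> exists q', quarter q q'.
Proof.
case: q => a b c d [/= h1 h2 h3 [h4 h5 h6]].
pose u := (a + b) / 2; pose v := (c + d) / 2.
have au : a <= u by rewrite /u; lra.
have ub : u <= b by rewrite /u; lra.
have cv : c <= v by rewrite /v; lra.
have vd : v <= d by rewrite /v; lra.
have ua2 : u - a = (b - a) / 2 by rewrite /u; lra.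
have bu2 : b - u = (b - a) / 2 by rewrite /u; lra.
have vc2 : v - c = (d - c) / 2 by rewrite /v; lra.
have dv2 : d - v = (d - c) / 2 by rewrite /v; lra.
have s1 : sub (Quad a u c v) by rewrite /sub /u /v /=; split; [| | |split]; lra.
have s2 : sub (Quad u b c v) by rewrite /sub /u /v /=; split; [| | |split]; lra.
have s3 : sub (Quad a u v d) by rewrite /sub /u /v /=; split; [| | |split]; lra.
have s4 : sub (Quad u b v d) by rewrite /sub /u /v /=; split; [| | |split]; lra.
have s12 : sub (Quad a b c v) by rewrite /sub /u /v /=; split; [| | |split]; lra.
have s34 : sub (Quad a b v d) by rewrite /sub /u /v /=; split; [| | |split]; lra.
have E : rect f a b c d = qrect (Quad a u c v) + qrect (Quad u b c v) +
    (qrect (Quad a u v d) + qrect (Quad u b v d)).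
  rewrite (@rect_splity f a b c v d cv vd h2 (sub_bcont s12) (sub_bcont s34)).
  rewrite (rect_splitx au ub cv (sub_bcont s1) (sub_bcont s2)).
  by rewrite (rect_splitx au ub vd (sub_bcont s3) (sub_bcont s4)).
apply: contrapT => /forallNP H.
have qq q' : sub q' ->
  [/\ a <= qx0 q', qx1 q' <= b & qx1 q' - qx0 q' = (b - a) / 2] ->
  [/\ c <= qy0 q', qy1 q' <= d & qy1 q' - qy0 q' = (d - c) / 2] ->
  4 * cabs (qrect q') < cabs (rect f a b c d).
  move=> sq e1 e2; rewrite ltNge; apply/negP => le; exact: (H q').
have l1 : 4 * cabs (qrect (Quad a u c v)) < cabs (rect f a b c d).
  by apply: qq.
have l2 : 4 * cabs (qrect (Quad u b c v)) < cabs (rect f a b c d).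
  by apply: qq.
have l3 : 4 * cabs (qrect (Quad a u v d)) < cabs (rect f a b c d).
  by apply: qq.
have l4 : 4 * cabs (qrect (Quad u b v d)) < cabs (rect f a b c d).
  by apply: qq.
have := cabsD (qrect (Quad a u c v) + qrect (Quad u b c v))
  (qrect (Quad a u v d) + qrect (Quad u b v d)).
rewrite -E.
have := cabsD (qrect (Quad a u c v)) (qrect (Quad u b c v)).
have := cabsD (qrect (Quad a u v d)) (qrect (Quad u b v d)).
exact: four_parts l1 l2 l3 l4.
Qed.

Lemma goursat : rect f X0 X1 Y0 Y1 = 0.
Proof.
apply/eqP; rewrite -cabs_eq0; apply/negP => /negP K0.
set K := cabs _ in K0; have {}K0 : 0 < K by rewrite lt_neqAle eq_sym K0 cabs_ge0.
have /choice[nx nxP] q : exists q', sub q -> quarter q q'.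
  have [/bisect[q' ?]|?] := pselect (sub q); first by exists q'.
  by exists q.
pose r n := iter n nx (Quad X0 X1 Y0 Y1).
have s0 : sub (r 0%N) by split => //=; split.
have rs n : sub (r n) by elim: n => // n ih; have [] := nxP _ ih.
have rq n : quarter (r n) (r n.+1) by exact: nxP.
have w1 n : qx1 (r n) - qx0 (r n) = (X1 - X0) / 2 ^+ n.
  elim: n => [|n ih]; first by rewrite expr0 divr1.
  by have [_ [_ _ ->] _ _] := rq n; rewrite ih exprS invfM; ring.
have w2 n : qy1 (r n) - qy0 (r n) = (Y1 - Y0) / 2 ^+ n.
  elim: n => [|n ih]; first by rewrite expr0 divr1.
  by have [_ _ [_ _ ->] _] := rq n; rewrite ih exprS invfM; ring.
have wK n : K <= 4 ^+ n * cabs (qrect (r n)).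
  elim: n => [|n ih]; first by rewrite expr0 mul1r.
  have [_ _ _ q4] := rq n; apply: (le_trans ih); rewrite exprSr -mulrA.
  by rewrite ler_wpM2l// exprn_ge0.
have [cx cxP] : exists c, forall n, qx0 (r n) <= c <= qx1 (r n).
  apply: nested_point => n; first by have [] := rs n.
    by have [_ [] ] := rq n.
  by have [_ [] ] := rq n.
have [cy cyP] : exists c, forall n, qy0 (r n) <= c <= qy1 (r n).
  apply: nested_point => n; first by have [_ _ _ []] := rs n.
    by have [_ _ [] ] := rq n.
  by have [_ _ [] ] := rq n.
pose z := pt cx cy.
have zin : inrect X0 X1 Y0 Y1 z by rewrite /inrect /= (cxP 0%N) (cyP 0%N).
have [l dl] := fd zin.
pose D := (X1 - X0) + (Y1 - Y0).
have D0 : 0 <= D by rewrite addr_ge0// subr_ge0.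
have Dp : 0 < D ^+ 2 + 1 by rewrite ltr_wpDl// sqr_ge0.
(* With this tolerance the remainder over the [n]-th rectangle, scaled by [4 ^+ n], is at most
   [K * D ^+ 2 / (2 * (D ^+ 2 + 1))], which is less than [K]; the [+ 1] covers [D = 0]. *)
have [|d d0 hd] := dl (K / (8 * (D ^+ 2 + 1))).
  by rewrite divr_gt0// mulr_gt0.
have [n nP] : exists n : nat, D < d * 2 ^+ n.
  have [n nP] : exists n : nat, D / d < n%:R.
    by exists (Num.Def.archi_bound (D / d)); apply: archi_boundP; rewrite divr_ge0// ltW.
  exists n; rewrite mulrC -ltr_pdivrMr//; apply: (lt_le_trans nP).
  by rewrite -natrX ler_nat ltnW// ltn_expl.
have [e1 e2 e3 [e4 e5 e6]] := rs n.
have bd w : inrect (qx0 (r n)) (qx1 (r n)) (qy0 (r n)) (qy1 (r n)) w ->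
    cabs (f w - f z - l * (w - z)) <= K / (8 * (D ^+ 2 + 1)) * (D / 2 ^+ n).
  move=> wr; have zr : inrect (qx0 (r n)) (qx1 (r n)) (qy0 (r n)) (qy1 (r n)) z.
    by rewrite /inrect /= cxP cyP.
  have wz := inrect_cabs wr zr; rewrite w1 w2 -mulrDl -/D in wz.
  have := hd (w - z); rewrite [z + _]addrC subrK => /(_ _)/le_trans; apply.
    by apply: (le_lt_trans wz); rewrite ltr_pdivrMr ?exprn_gt0.
  by rewrite ler_wpM2l// divr_ge0 ?(ltW K0)// mulr_ge0// ltW.
(* The affine part integrates to 0, so only the remainder of the expansion at [z] counts. *)
have fE : f = fun w => (f z - l * z + l * w) + (f w - f z - l * (w - z)).
  by apply/funext => w; ring.
have cA w : cts (fun w => f z - l * z + l * w) w.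
  apply: ctsD; first exact: cts_cst.
  by apply: ctsM; [exact: cts_cst|exact: cts_id].
have cf := sub_bcont (rs n).
have cB : bcont (fun w => f w - f z - l * (w - z)) (qx0 (r n)) (qx1 (r n)) (qy0 (r n)) (qy1 (r n)).
  move=> w /cf cw.
  rewrite (_ : (fun w => _) = (fun w => f w + - (f z - l * z + l * w))); last by apply/funext => u; ring.
  by apply: ctsD => //; apply: ctsN.
have : cabs (qrect (r n)) <= 4 * (K / (8 * (D ^+ 2 + 1)) * (D / 2 ^+ n)) * (D / 2 ^+ n).
  rewrite /qrect {1}fE rectD// ?rect_affine// ?add0r; last first.
  have := rect_bound e2 e5 cB; rewrite w1 w2 -mulrDl -/D; apply.
  by move=> w /andP[/bd].
move=> le1; have le2 := wK n.
have p2 : 0 < 2 ^+ n :> R by rewrite exprn_gt0.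
have : K <= 4 ^+ n * (4 * (K / (8 * (D ^+ 2 + 1)) * (D / 2 ^+ n)) * (D / 2 ^+ n)).
  by apply: (le_trans le2); rewrite ler_wpM2l// exprn_ge0.
rewrite (_ : _ * (_ * _) = K * (D ^+ 2 / (2 * (D ^+ 2 + 1)))); last first.
  rewrite (_ : 4 = 2 * 2 :> R); last by lra.
  rewrite exprMn; field; rewrite (gt_eqF p2) /= ; apply/andP; split => //.
  by rewrite gt_eqF.
rewrite -{1}[K]mulr1 ler_pM2l// leNgt => /negP; apply.
by rewrite ltr_pdivrMr ?mulr_gt0// mul1r; move: Dp; lra.
Qed.

End Goursat.

End Rectangles.

(** * Removable singularities, the Cauchy estimate and Cauchy's formula for the derivative *)

Section Cauchy.
Variable R : realType.
Implicit Types (f g : CC R -> CC R) (z w l m p : CC R) (x y : R).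

Definition csquare p (r : R) z := inrect (cre p - r) (cre p + r) (cim p - r) (cim p + r) z.
Definition cbd p (r : R) z := bdry (cre p - r) (cre p + r) (cim p - r) (cim p + r) z.
Definition srect f p (r : R) := rect f (cre p - r) (cre p + r) (cim p - r) (cim p + r).

Lemma inrect_sub a b c d x0 x1 y0 y1 z : x0 <= a -> b <= x1 -> y0 <= c -> d <= y1 ->
  inrect a b c d z -> inrect x0 x1 y0 y1 z.
Proof.
move=> h1 h2 h3 h4 /andP[/andP[q1 q2] /andP[q3 q4]].
by apply/andP; split; apply/andP; split; lra.
Qed.

Section Annulus.
Variables (f : CC R -> CC R) (x0 x1 y0 y1 : R) (p : CC R).
Hypotheses (hx : x0 < cre p < x1) (hy : y0 < cim p < y1).
Hypothesis fd : forall z, inrect x0 x1 y0 y1 z -> z != p -> exists l, cdif f z l.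

(** The frame around the square is cut into a left and a right strip and the pieces below and above;
    none of them contains [p], so Goursat's theorem makes all four integrals vanish. *)
Lemma rect_annulus (e : R) : 0 < e ->
  x0 <= cre p - e -> cre p + e <= x1 -> y0 <= cim p - e -> cim p + e <= y1 ->
  rect f x0 x1 y0 y1 = srect f p e.
Proof.
move=> e0 h1 h2 h3 h4; rewrite /srect.
set u := cre p - e; set v := cre p + e; set s := cim p - e; set t := cim p + e.
have up : u < cre p by rewrite /u; lra.
have pv : cre p < v by rewrite /v; lra.
have sp : s < cim p by rewrite /s; lra.
have tp : cim p < t by rewrite /t; lra.
have uv : u < v by lra.
have st : s < t by lra.
have gz a b c d : x0 <= a -> a <= b -> b <= x1 -> y0 <= c -> c <= d -> d <= y1 ->
   [|| b < cre p, cre p < a, d < cim p | cim p < c] -> rect f a b c d = 0.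
  move=> a0 ab b1 c0 cd d1 np; apply: goursat => // z zin.
  apply: fd; first exact: inrect_sub zin.
  move: zin => /andP[/andP[q1 q2] /andP[q3 q4]].
  by apply/eqP => zp; subst z; move: np; rewrite ltNge q2 ltNge q1 ltNge q4 ltNge q3.
have bc a b c d : x0 <= a -> a <= b -> b <= x1 -> y0 <= c -> c <= d -> d <= y1 ->
   a != cre p -> b != cre p -> c != cim p -> d != cim p ->
   bcont f a b c d.
  move=> a0 ab b1 c0 cd d1 n1 n2 n3 n4 z /andP[zin qq].
  have [||l] := @fd z; last by move/cdif_cts.
    exact: inrect_sub zin.
  apply/eqP => zp; subst z; move: qq.
  by rewrite !(eq_sym (cre p)) !(eq_sym (cim p)) (negbTE n1) (negbTE n2) (negbTE n3) (negbTE n4).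
have ne1 : x0 != cre p by rewrite lt_eqF//; case/andP: hx.
have ne2 : x1 != cre p by rewrite gt_eqF//; case/andP: hx.
have ne3 : y0 != cim p by rewrite lt_eqF//; case/andP: hy.
have ne4 : y1 != cim p by rewrite gt_eqF//; case/andP: hy.
have nu : u != cre p by rewrite lt_eqF.
have nv : v != cre p by rewrite gt_eqF.
have ns : s != cim p by rewrite lt_eqF.
have nt : t != cim p by rewrite gt_eqF.
have xu : x0 <= u by []. have vx : v <= x1 by [].
have ys : y0 <= s by []. have ty : t <= y1 by [].
have hxx : x0 <= x1 by case/andP: hx => /lt_trans h /h /ltW.
have hyy : y0 <= y1 by case/andP: hy => /lt_trans h /h /ltW.
have vx0 : x0 <= v := le_trans xu (ltW uv). have ux1 : u <= x1 := le_trans (ltW uv) vx.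
have ty0 : y0 <= t := le_trans ys (ltW st). have sy1 : s <= y1 := le_trans (ltW st) ty.
have uv' := ltW uv. have st' := ltW st.
clear fd hx hy h1 h2 h3 h4 e0.
rewrite (@rect_splitx _ f x0 u x1 y0 y1) //.
rewrite (@rect_splitx _ f u v x1 y0 y1) //.
rewrite (@rect_splity _ f u v y0 s y1) //.
rewrite (@rect_splity _ f u v s t y1) //.
rewrite (gz x0 u y0 y1) ?(gz v x1 y0 y1) ?(gz u v y0 s) ?(gz u v t y1) ?add0r ?addr0//;
  rewrite ?up ?pv ?sp ?tp ?orbT//.
all: exact: bc.
Qed.

End Annulus.

Lemma cbd_ge p (e : R) z : 0 < e -> cbd p e z -> e <= cabs (z - p).
Proof.
move=> e0 /andP[_ /or4P[]/eqP E].
- apply: le_trans (cre_le _); rewrite creD creN E (_ : _ - _ = - e); last by ring.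
  by rewrite normrN ger0_norm// ltW.
- apply: le_trans (cre_le _); rewrite creD creN E (_ : _ - _ = e); last by ring.
  by rewrite ger0_norm// ltW.
- apply: le_trans (cim_le _); rewrite cimD cimN E (_ : _ - _ = - e); last by ring.
  by rewrite normrN ger0_norm// ltW.
- apply: le_trans (cim_le _); rewrite cimD cimN E (_ : _ - _ = e); last by ring.
  by rewrite ger0_norm// ltW.
Qed.

Lemma csquare_le p (e : R) z : csquare p e z -> cabs (z - p) <= 2 * e.
Proof.
move=> /andP[/andP[a b] /andP[c d]]; apply: (le_trans (cabs_le _)).
rewrite creD cimD creN cimN mulr_natl mulr2n.
by apply: lerD; rewrite ler_norml; apply/andP; split; lra.
Qed.

Lemma le_csquare p (e : R) z : cabs (z - p) <= e -> csquare p e z.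
Proof.
move=> h; have := cre_le (z - p); have := cim_le (z - p).
rewrite creD cimD creN cimN => /le_trans/(_ h); rewrite ler_norml => /andP[a b].
move=> /le_trans/(_ h); rewrite ler_norml => /andP[c d].
by rewrite /csquare /inrect; apply/andP; split; apply/andP; split; lra.
Qed.

(** The contour is shrunk to a square of half-side [c] about [p]: its length is of order [c], while
    the integrand there is [o(1/c)]. *)
Lemma rect_removable (G : CC R -> CC R) x0 x1 y0 y1 p :
  x0 < cre p < x1 -> y0 < cim p < y1 ->
  (forall z, inrect x0 x1 y0 y1 z -> z != p -> exists l, cdif G z l) ->
  (forall e : R, 0 < e -> exists2 d : R, 0 < d & forall z, z != p -> cabs (z - p) < d ->
     cabs (G z) * cabs (z - p) <= e) ->
  rect G x0 x1 y0 y1 = 0.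
Proof.
move=> hx hy Gd Gs; apply/eqP; rewrite -cabs_eq0 eq_le cabs_ge0 andbT.
apply/ler_addgt0Pr => e e0; rewrite add0r.
have [|d d0 hd] := Gs (e / 16); first by rewrite divr_gt0.
pose c := \big[Num.min/d / 4]_(t <- [:: cre p - x0; x1 - cre p; cim p - y0; y1 - cim p]) t.
have [c0 cd c1 c2 [c3 c4]] : [/\ 0 < c, c <= d / 4, c <= cre p - x0, c <= x1 - cre p & c <= cim p - y0 /\ c <= y1 - cim p].
  rewrite /c !big_cons big_nil !lt_min !ge_min !lexx ?orbT.
  by move/andP: hx => [? ?]; move/andP: hy => [? ?]; rewrite !subr_gt0 divr_gt0// andbT; split => //; apply/and4P.
rewrite (@rect_annulus G x0 x1 y0 y1 p hx hy Gd c c0); try lra.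
have sub z : csquare p c z -> inrect x0 x1 y0 y1 z.
  by apply: inrect_sub; lra.
have nep z : cbd p c z -> z != p.
  by move=> /(cbd_ge c0) h; apply: contraTneq h => ->; rewrite subrr cabs0 -ltNge.
have := @rect_bound _ (cre p - c) (cre p + c) (cim p - c) (cim p + c) _ _ G (e / 16 / c).
move=> /(_ _ _ _ _)/le_trans; apply; try lra.
- move=> z zb; have [||l /cdif_cts//] := Gd z; last exact: nep.
  by apply: sub; case/andP: zb.
- move=> z zb; rewrite ler_pdivlMr//.
  have zc := cbd_ge c0 zb.
  have zc2 := csquare_le (proj1 (andP zb)).
  apply: le_trans (hd z _ _); [by rewrite ler_wpM2l ?cabs_ge0|exact: nep|].
  lra.
- rewrite le_eqVlt; apply/orP; left; apply/eqP; field; exact: lt0r_neq0.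
Qed.

Lemma rint_ge (g : R -> R) (m a b : R) : a <= b -> itvcont g a b ->
  (forall x, a <= x <= b -> m <= g x) -> m * (b - a) <= rint g a b.
Proof.
move=> ab hg hm; rewrite -rint_cst//; apply: le_Rintegral => //.
- by apply: itvcont_integrable; move=> x; exact: cst_continuous.
- exact: itvcont_integrable.
Qed.

Lemma creV z : cre z^-1 = cre z / (cre z ^+ 2 + cim z ^+ 2).
Proof. by case: z => a b. Qed.
Lemma cimV z : cim z^-1 = - cim z / (cre z ^+ 2 + cim z ^+ 2).
Proof. by case: z => a b /=; rewrite mulNr. Qed.

(** A bound instead of the value 2 pi, which spares the arctangent: on each side the relevant part
    of the integrand is [e / (e ^+ 2 + t ^+ 2)] with [|t| <= e], hence at least [1 / (2 * e)] over a
    length [2 * e]. Every side thus contributes at least 1. *)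
Lemma winding_ge p (e : R) : 0 < e -> 4 <= cim (srect (fun z => (z - p)^-1) p e).
Proof.
move=> e0; set f := fun z => _.
have bc : bcont f (cre p - e) (cre p + e) (cim p - e) (cim p + e).
  move=> z zb; rewrite /f; apply: ctsV.
    by have := cbd_ge e0 zb; apply: contraTneq => ->; rewrite cabs0 -ltNge.
  by apply: ctsD; [exact: cts_id|exact: cts_cst].
have [|| [a1 a2] [b1 b2] [c1 c2] [d1 d2]] := bcont_sides _ _ bc; try lra.
rewrite /srect /rect /hseg /vseg /cint.
rewrite cimD cimM /= mul0r mul1r add0r.
have bnd (A B : R) : 0 < A -> B ^+ 2 <= A ^+ 2 -> (2 * A)^-1 <= A / (A ^+ 2 + B ^+ 2).
  move=> A0 h; rewrite ler_pdivlMr; last by rewrite ltr_pwDl ?exprn_gt0// sqr_ge0.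
  rewrite mulrC ler_pdivrMr ?mulr_gt0//; lra.
have sq (u v : R) : u - e <= v <= u + e -> (v - u) ^+ 2 <= e ^+ 2.
  move=> /andP[h1 h2]; rewrite -subr_ge0 subr_sqr mulr_ge0//; lra.
have two (u : R) : u + e - (u - e) = 2 * e by ring.
have inv : (2 * e)^-1 * (2 * e) = 1 by rewrite mulVf// gt_eqF// mulr_gt0.
have r1 : 1 <= rint (fun x => cim (f (pt x (cim p - e)))) (cre p - e) (cre p + e).
  rewrite -[leLHS]inv -{2}(two (cre p)); apply: rint_ge => //; first by lra.
  move=> x xx; rewrite /f cimV !creD !cimD !creN !cimN /=.
  rewrite (_ : cim p - e - cim p = - e); last by ring.
  by rewrite opprK sqrrN [_ ^+ 2 + e ^+ 2]addrC; apply: bnd => //; exact: sq.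
have r2 : 1 <= - rint (fun x => cim (f (pt x (cim p + e)))) (cre p - e) (cre p + e).
  rewrite -mulN1r -rintZ//.
  rewrite -[leLHS]inv -{2}(two (cre p)); apply: rint_ge => //; [by lra|exact: itvcontZ|].
  move=> x xx; rewrite /f cimV !creD !cimD !creN !cimN /=.
  rewrite (_ : cim p + e - cim p = e); last by ring.
  by rewrite mulN1r mulNr opprK [_ ^+ 2 + e ^+ 2]addrC; apply: bnd => //; exact: sq.
have r3 : 1 <= rint (fun y => cre (f (pt (cre p + e) y))) (cim p - e) (cim p + e).
  rewrite -[leLHS]inv -{2}(two (cim p)); apply: rint_ge => //; first by lra.
  move=> x xx; rewrite /f creV !creD !cimD !creN !cimN /=.
  rewrite (_ : cre p + e - cre p = e); last by ring.
  by apply: bnd => //; exact: sq.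
have r4 : 1 <= - rint (fun y => cre (f (pt (cre p - e) y))) (cim p - e) (cim p + e).
  rewrite -mulN1r -rintZ//.
  rewrite -[leLHS]inv -{2}(two (cim p)); apply: rint_ge => //; [by lra|exact: itvcontZ|].
  move=> x xx; rewrite /f creV !creD !cimD !creN !cimN /=.
  rewrite (_ : cre p - e - cre p = - e); last by ring.
  by rewrite mulN1r mulNr opprK sqrrN; apply: bnd => //; exact: sq.
lra.
Qed.

Lemma cdif_inv_sub p z : z != p -> exists l, cdif (fun w => (w - p)^-1) z l.
Proof.
move=> zp; eexists; apply: cdifV; first by rewrite subr_eq0.
by apply: cdifD; [exact: cdif_id|exact: cdif_cst].
Qed.

(* Only a lower bound 4 for the winding integral is used instead of 2 pi, whence the
   constant 8. *)
Lemma cauchy_estimate f c (r M : R) p : 0 < r -> cabs (p - c) <= r / 2 ->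
  (forall z, csquare c r z -> exists l, cdif f z l) ->
  (forall z, cbd c r z -> cabs (f z) <= M) -> cabs (f p) <= 8 * M.
Proof.
move=> r0 pc fd fM.
have /andP[/andP[q1 q2] /andP[q3 q4]] : csquare c (r / 2) p by exact: le_csquare.
have hx : cre c - r < cre p < cre c + r by apply/andP; split; lra.
have hy : cim c - r < cim p < cim c + r by apply/andP; split; lra.
have pin : csquare c r p by apply/andP; split; apply/andP; split; lra.
have far z : cbd c r z -> r / 2 <= cabs (z - p).
  move=> /(cbd_ge r0) h; have := cabs_triangle z c p; move: h pc; lra.
have nep z : cbd c r z -> z != p.
  by move=> /far; apply: contraTneq => ->; rewrite subrr cabs0 -ltNge divr_gt0.
have ck : bcont (fun z => (z - p)^-1) (cre c - r) (cre c + r) (cim c - r) (cim c + r).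
  by move=> z /nep /cdif_inv_sub[l /cdif_cts].
have cf : bcont f (cre c - r) (cre c + r) (cim c - r) (cim c + r).
  by move=> z /andP[/fd[l /cdif_cts]].
have cfk : bcont (fun z => f z * (z - p)^-1) (cre c - r) (cre c + r) (cim c - r) (cim c + r).
  by move=> z zb; apply: ctsM; [exact: cf|exact: ck].
(* Subtracting [f p] times the Cauchy kernel leaves a singularity at [p] that [rect_removable]
   tolerates. *)
have E : srect (fun z => f z * (z - p)^-1 + (- f p) * (z - p)^-1) c r = 0.
  apply: (@rect_removable _ _ _ _ _ p) => //.
    move=> z /fd[l fl] /cdif_inv_sub[l' fl']; eexists.
    by apply: cdifD; apply: cdifM; [exact: fl|exact: fl'|exact: cdif_cst|exact: fl'].
  have [l /cdif_cts cp] := fd _ pin => e /cp[d d0 hd]; exists d => // z zp /hd h.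
  rewrite -mulrDl cabsM cabsV -mulrA mulVf ?mulr1 ?ltW//.
  by rewrite cabs_eq0 subr_eq0.
have W : 4 <= cabs (srect (fun z => (z - p)^-1) c r).
  rewrite /srect (@rect_annulus _ _ _ _ _ p _ _ _ (r / 4)); try lra.
  - apply: le_trans (cim_le _); apply: le_trans (ler_norm _).
    by apply: winding_ge; rewrite divr_gt0.
  - by move=> z _; exact: cdif_inv_sub.
rewrite /srect rectD// ?rectZ// in E; try lra; last first.
  by move=> z zb; apply: ctsM; [exact: cts_cst|exact: ck].
move/eqP: E; rewrite mulNr subr_eq0 => /eqP E.
have : cabs (f p) * 4 <= cabs (f p * srect (fun z => (z - p)^-1) c r).
  by rewrite cabsM ler_wpM2l ?cabs_ge0.
move=> /le_trans; rewrite /srect -E => H.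
have M0 : 0 <= M.
  have [||||h _ _ _] := @bdry_side _ (cre c - r) (cre c + r) (cim c - r) (cim c + r) _ _ (cre c) (cim c); try lra.
  exact: le_trans (cabs_ge0 _) (fM _ h).
have : cabs (f p) * 4 <= 4 * (M / (r / 2)) * (cre c + r - (cre c - r) + (cim c + r - (cim c - r))).
  apply: H; apply: rect_bound => //; try lra.
  move=> z zb; rewrite cabsM cabsV ler_pdivrMr; last by rewrite cabs_gt0 subr_eq0 nep.
  apply: (le_trans (fM _ zb)); rewrite -mulrA ler_peMr// mulrC ler_pdivlMr ?divr_gt0// mul1r.
  exact: far.
rewrite (_ : 4 * _ * _ = 32 * M); first by lra.
by field; exact: lt0r_neq0.
Qed.

(** The constant 2 pi i, whose value is never computed: formulas carry it as a factor, and [wind_ge]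
    permits dividing by it. *)
Definition wind (r : R) : CC R := srect (fun z => z^-1) 0 r.

Lemma wind_ge (r : R) : 0 < r -> 4 <= cabs (wind r).
Proof.
move=> r0; apply: le_trans (cim_le _); apply: le_trans (ler_norm _).
rewrite /wind (_ : (fun z => z^-1) = fun z => (z - 0)^-1); first exact: winding_ge.
by apply/funext => z; rewrite subr0.
Qed.

(** Near 0 the integrand differs from [l / z] by [o(1/|z|)], which is removable. *)
Lemma cauchy_derivative f (r : R) l : 0 < r ->
  (forall z, csquare 0 r z -> exists l, cdif f z l) -> cdif f 0 l ->
  srect (fun z => (f z - f 0) * (z ^+ 2)^-1) 0 r = l * wind r.
Proof.
move=> r0 fd fl.
have nez z : cbd (0 : CC R) r z -> z != 0.
  by move=> /(cbd_ge r0); rewrite subr0; apply: contraTneq => ->; rewrite cabs0 -ltNge.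
have dV z : z != 0 -> exists l, cdif (fun z : CC R => z^-1) z l.
  by move=> z0; eexists; apply: cdifV => //; exact: cdif_id.
have dV2 z : z != 0 -> exists l, cdif (fun z : CC R => (z ^+ 2)^-1) z l.
  move=> z0; eexists; apply: cdifV; first by rewrite expf_neq0.
  rewrite (_ : (fun z => z ^+ 2) = (fun z : CC R => z * z)); last by apply/funext => ?; rewrite expr2.
  by apply: cdifM; exact: cdif_id.
have dG z : csquare 0 r z -> z != 0 ->
    exists l', cdif (fun z => (f z - f 0) * (z ^+ 2)^-1) z l'.
  move=> /fd[l1 h1] /dV2[l2 h2]; eexists; apply: cdifM; last exact: h2.
  by apply: cdifD; [exact: h1|exact: cdif_cst].
have c1 : bcont (fun z => (f z - f 0) * (z ^+ 2)^-1) (cre (0 : CC R) - r) (cre (0 : CC R) + r) (cim (0 : CC R) - r) (cim (0 : CC R) + r).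
  by move=> z zb; have [|//|l' /cdif_cts//] := dG z; [case/andP: zb|exact: nez].
have c2 : bcont (fun z : CC R => z^-1) (cre (0 : CC R) - r) (cre (0 : CC R) + r) (cim (0 : CC R) - r) (cim (0 : CC R) + r).
  by move=> z /nez/dV[l' /cdif_cts].
have E : srect (fun z => (f z - f 0) * (z ^+ 2)^-1 + (- l) * z^-1) 0 r = 0.
  apply: (@rect_removable _ _ _ _ _ 0); rewrite /= ?sub0r ?add0r ?r0 ?oppr_lt0 ?r0//.
    move=> z zin z0; have [|//|l1 h1] := dG z; first by rewrite /csquare /= sub0r add0r.
    have [l2 h2] := dV z z0; eexists; apply: cdifD; first exact: h1.
    by apply: cdifM; [exact: cdif_cst|exact: h2].
  move=> e /fl[d d0 hd]; exists d => // z z0; rewrite subr0 => /hd; rewrite add0r => h.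
  rewrite -cabsM (_ : _ * z = (f z - f 0 - l * z) / z); last by field.
  by rewrite cabsM cabsV ler_pdivrMr ?cabs_gt0.
have hxx : cre (0 : CC R) - r <= cre (0 : CC R) + r by rewrite lerD2l; move: r0; lra.
have hyy : cim (0 : CC R) - r <= cim (0 : CC R) + r by rewrite lerD2l; move: r0; lra.
rewrite /srect rectD// ?rectZ// in E; last first.
  by move=> z zb; apply: ctsM; [exact: cts_cst|exact: c2].
by move/eqP: E; rewrite mulNr subr_eq0 => /eqP.
Qed.

End Cauchy.

(** * The mean value inequality along a segment *)

Section MeanValue.
Variable R : realType.

Lemma is_derive_eps (f : R -> R) (t l : R) :
  (forall e : R, 0 < e -> exists2 d : R, 0 < d & forall h, `|h| < d ->
     `|f (t + h) - f t - l * h| <= e * `|h|) -> is_derive t 1 f l.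
Proof.
move=> H.
have C : h^-1 *: (f (h *: 1 + t) - f t) @[h --> (0:R)^'] --> l.
  apply/cvgrPdist_le => e e0; have [d d0 hd] := H e e0.
  near=> h.
  have h0 : h != 0 by near: h; exact: nbhs_dnbhs_neq.
  have hlt : `|h| < d.
    near: h; apply/nbhs_ballP; exists d => //= y /=.
    by rewrite /ball /= sub0r normrN.
  have := hd _ hlt; rewrite /GRing.scale /= mulr1 [h + t]addrC.
  rewrite -ler_pdivrMr ?normr_gt0// => H1.
  rewrite distrC (_ : _ - l = (f (t + h) - f t - l * h) / h).
    by rewrite normrM normrV ?unitfE.
  by field.
by apply: DeriveDef; [apply/cvg_ex; exists l|exact/cvg_lim].
Unshelve. all: by end_near. Qed.

(** The real mean value theorem is applied to the real and to the imaginary part, with different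
    intermediate points; hence the factor 2. *)
Lemma mean_value_cabs (g : CC R -> CC R) (D : R -> CC R) (K : R) :
  (forall t : R, 0 <= t <= 1 -> cdif g t%:C%C (D t)) ->
  (forall t : R, 0 <= t <= 1 -> cabs (D t) <= K) -> cabs (g 1 - g 0) <= 2 * K.
Proof.
move=> gd DK.
have aux (p : CC R -> R) : (forall a b : CC R, p (a + b) = p a + p b) ->
  (forall a : CC R, p (- a) = - p a) -> (forall a, `|p a| <= cabs a) ->
  (forall (a : CC R) (t : R), p (a * t%:C%C) = p a * t) -> `|p (g 1 - g 0)| <= K.
  move=> pD pN pa pZ.
  have dp (t : R) : 0 <= t <= 1 -> is_derive t 1 (fun t : R => p (g t%:C%C)) (p (D t)).
    move=> t01; apply: is_derive_eps => e /(gd _ t01)[d d0 hd]; exists d => // h hd'.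
    have := hd h%:C%C; rewrite !cabsR => /(_ hd'); apply: le_trans.
    by rewrite rmorphD /= -pN -pD -pZ -pN -pD; exact: pa.
  have dc (t : R) : 0 <= t <= 1 -> {for t, continuous (fun t : R => p (g t%:C%C))}.
    move=> /dp [dt _]; apply: differentiable_continuous; exact/derivable1_diffP.
  have [|||c c01 E] := @MVT R (fun t => p (g t%:C%C)) (fun t => p (D t)) 0 1.
  - exact: ltr01.
  - by move=> x /[!in_itv]/= /andP[a b]; apply: dp; rewrite !ltW.
  - apply: continuous_in_subspaceT => x; rewrite inE /= in_itv /=; exact: dc.
  rewrite pD pN -(rmorph1 (real_complex R)) -(rmorph0 (real_complex R)).
  rewrite E subr0 mulr1; apply: (le_trans (pa _)); apply: DK.
  by move: c01; rewrite in_itv /= => /andP[a b]; rewrite !ltW.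
apply: (le_trans (cabs_le _)); rewrite mulr_natl mulr2n; apply: lerD; apply: aux.
- exact: creD. - exact: creN. - exact: cre_le. 
- by move=> [a b] t /=; rewrite !mulr0 subr0.
- exact: cimD. - exact: cimN. - exact: cim_le.
- by move=> [a b] t /=; rewrite mulr0 add0r.
Qed.

End MeanValue.

(** * The Cauchy kernel for the derivative as a linear functional *)

Section Kernel.
Variable R : realType.
Implicit Types (g : CC R -> CC R) (r A : R).

(** For holomorphic [g] with [g 0 = 0] this is the derivative at 0 times [wind r]. Since it is
    linear and bounded by the supremum of [g], it turns estimates of functions into estimates of
    derivatives. *)
Definition ker g r := srect (fun x => g x * (x ^+ 2)^-1) 0 r.
Definition ctsd g r := forall x, cabs x <= 2 * r -> cts g x.

Lemma cbd0 r x : 0 < r -> cbd (0 : CC R) r x -> [/\ x != 0, r <= cabs x & cabs x <= 2 * r].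
Proof.
move=> r0 xb; have := cbd_ge r0 xb; have := csquare_le (proj1 (andP xb)).
rewrite subr0 => h1 h2; split => //; rewrite -cabs_gt0; exact: lt_le_trans r0 h2.
Qed.

Lemma ker_bcont g r : 0 < r -> ctsd g r ->
  bcont (fun x => g x * (x ^+ 2)^-1) (cre (0 : CC R) - r) (cre (0 : CC R) + r)
    (cim (0 : CC R) - r) (cim (0 : CC R) + r).
Proof.
move=> r0 cg x /(cbd0 r0)[x0 h1 h2]; apply: ctsM; first exact: cg.
apply: ctsV; first by rewrite expf_neq0.
rewrite (_ : (fun _ => _) = (fun x : CC R => x * x)); last by apply/funext => ?; rewrite expr2.
by apply: ctsM; exact: cts_id.
Qed.

Lemma zero_pm r (a : R) : 0 < r -> a - r <= a + r.
Proof. by move=> r0; rewrite lerD2l; lra. Qed.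

Lemma kerD g g' r : 0 < r -> ctsd g r -> ctsd g' r ->
  ker (fun x => g x + g' x) r = ker g r + ker g' r.
Proof.
move=> r0 c1 c2; rewrite /ker /srect.
have -> : (fun x => (g x + g' x) * (x ^+ 2)^-1) =
  (fun x => g x * (x ^+ 2)^-1 + g' x * (x ^+ 2)^-1) by apply/funext => x; rewrite mulrDl.
by apply: rectD; rewrite ?zero_pm//; exact: ker_bcont.
Qed.

Lemma kerZ c g r : 0 < r -> ctsd g r -> ker (fun x => g x * c) r = ker g r * c.
Proof.
move=> r0 c1; rewrite [RHS]mulrC /ker /srect.
have -> : (fun x => (g x * c) * (x ^+ 2)^-1) =
  (fun x => c * (g x * (x ^+ 2)^-1)) by apply/funext => x; rewrite [g x * c]mulrC mulrA.
by apply: rectZ; rewrite ?zero_pm//; exact: ker_bcont.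
Qed.

Lemma kerB g g' r : 0 < r -> ctsd g r -> ctsd g' r ->
  ker (fun x => g x - g' x) r = ker g r - ker g' r.
Proof.
move=> r0 c1 c2.
have -> : (fun x => g x - g' x) = (fun x => g x + g' x * (-1)).
  by apply/funext => x; rewrite mulrN1.
rewrite kerD//; first by rewrite kerZ// mulrN1.
by move=> x /c2 cx; apply: ctsM => //; exact: cts_cst.
Qed.

Lemma cts_sum (I : Type) (s : seq I) (P : pred I) (F : I -> CC R -> CC R) x :
  (forall i, cts (F i) x) -> cts (fun x => \sum_(i <- s | P i) F i x) x.
Proof.
move=> h; elim: s => [|i s ih].
  rewrite (_ : (fun x => _) = fun=> 0); first exact: cts_cst.
  by apply/funext => y; rewrite big_nil.
rewrite (_ : (fun x => _) = fun x => (if P i then F i x else 0) + \sum_(i <- s | P i) F i x).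
  by apply: ctsD => //; case: (P i) => //; exact: cts_cst.
by apply/funext => y; rewrite big_cons; case: ifP; rewrite ?add0r.
Qed.

Lemma ker_sum (I : Type) (s : seq I) (F : I -> CC R -> CC R) r : 0 < r ->
  (forall i, ctsd (F i) r) -> ker (fun x => \sum_(i <- s) F i x) r = \sum_(i <- s) ker (F i) r.
Proof.
move=> r0 h; elim: s => [|i s ih].
  rewrite big_nil (_ : (fun x => _) = fun x => 0 * 0); first by rewrite (@kerZ 0 (fun=> 0))// ?mulr0// => x _; exact: cts_cst.
  by apply/funext => y; rewrite big_nil mul0r.
rewrite big_cons -ih -kerD//; last by move=> x xr; apply: cts_sum => j; exact: h.
rewrite (_ : (fun x => \sum_(j <- i :: s) F j x) = (fun x => F i x + \sum_(j <- s) F j x))//.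
by apply/funext => y; rewrite big_cons.
Qed.

Lemma ker_bound g r A : 0 < r -> ctsd g r ->
  (forall x, cabs x <= 2 * r -> cabs (g x) <= A) -> cabs (ker g r) <= 16 * (A / r).
Proof.
move=> r0 cg gA; rewrite /ker /srect.
have A0 : 0 <= A by apply: le_trans (gA 0 _); rewrite ?cabs_ge0// cabs0 mulr_ge0// ltW.
have := @rect_bound _ (cre (0 : CC R) - r) (cre (0 : CC R) + r) (cim (0 : CC R) - r) (cim (0 : CC R) + r) (zero_pm _ r0) (zero_pm _ r0) _ (A / r ^+ 2) (ker_bcont r0 cg).
move=> /(_ _)/le_trans; apply.
  move=> x /(cbd0 r0)[x0 h1 h2]; rewrite cabsM cabsV cabsX.
  apply: ler_pM; rewrite ?cabs_ge0 ?gA ?invr_ge0 ?exprn_ge0 ?cabs_ge0//.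
  rewrite lef_pV2 ?posrE ?exprn_gt0 ?cabs_gt0//.
  by rewrite ler_pXn2r// nnegrE ?cabs_ge0// ltW.
rewrite le_eqVlt; apply/orP; left; apply/eqP; field; exact: lt0r_neq0.
Qed.

End Kernel.

Opaque pd.

(** * Partial derivatives of holomorphic functions are holomorphic *)

Section PartialDerivatives.
Variables (R : realType) (N : nat).
Implicit Types (f : CN R N -> CC R) (z w h : CN R N).

Lemma alg6 (A B C D a b : CC R) :
  A - B - (C - D) - (a - b) = A - C - a - (B - D - b).
Proof. by ring. Qed.

Definition e_ (i : 'I_N) : CN R N := delta_mx ord0 i.

Lemma vn_e (c : CC R) i : vn (c *: e_ i) = cabs c.
Proof.
rewrite vnZ /vn (bigD1 i)//= mxE !eqxx big1 ?addr0 /= ?cabs1 ?mulr1//.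
by move=> j ji; rewrite mxE (negbTE ji) andbF cabs0.
Qed.

Lemma grad_line f z h (G : 'I_N -> CC R) (t : CC R) : grad f (z + t *: h) G ->
  cdif (fun s => f (z + s *: h)) t (\sum_i G i * h ord0 i).
Proof.
move=> gf e e0.
have [d d0 hd] := gf (e / (1 + vn h)) ltac:(by rewrite divr_gt0// ltr_pwDl// vn_ge0).
exists (d / (1 + vn h)); first by rewrite divr_gt0// ltr_pwDl// vn_ge0.
have v0 : 0 < 1 + vn h by rewrite ltr_pwDl// vn_ge0.
move=> s; rewrite ltr_pdivlMr// => sd.
have := hd (s *: h); rewrite vnZ => /(_ _).
rewrite -[z + t *: h + _]addrA -scalerDl (_ : \sum_i G i * (s *: h) ord0 i = (\sum_i G i * h ord0 i) * s); last first.
  by rewrite mulr_suml; apply: eq_bigr => i _; rewrite mxE; ring.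
move=> /(_ _)/le_trans; apply.
  by apply: le_lt_trans sd; rewrite ler_wpM2l ?cabs_ge0// lerDr.
rewrite [cabs s * _]mulrC mulrA ler_wpM2r ?cabs_ge0//.
by rewrite mulrAC ler_pdivrMr// ler_pM2l// lerDr.
Qed.

Lemma sum_e (G : 'I_N -> CC R) i : \sum_j G j * e_ i ord0 j = G i.
Proof.
rewrite (bigD1 i)//= mxE !eqxx mulr1 big1 ?addr0// => j ji.
by rewrite mxE (negbTE ji) andbF mulr0.
Qed.

Section Ball.
Variables (f : CN R N -> CC R) (z : CN R N) (rho M : R).
Hypothesis rho0 : 0 < rho.
Hypothesis fgrad : forall w, vn (w - z) < rho -> grad f w (fun i => pd i f w).
Hypothesis fM : forall w, vn (w - z) < rho -> cabs (f w) <= M.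

Lemma shift_in w (x : CC R) i (s t : R) : vn (w - z) < s -> cabs x <= t ->
  vn (w + x *: e_ i - z) < s + t.
Proof.
move=> h1 h2; rewrite (_ : _ - z = (w - z) + x *: e_ i); last by rewrite addrAC.
by apply: (le_lt_trans (vnD _ _)); rewrite vn_e; apply: ltr_leD.
Qed.

Lemma line_cts w i (x : CC R) : vn (w + x *: e_ i - z) < rho ->
  cts (fun x => f (w + x *: e_ i)) x.
Proof. by move=> h; apply: cdif_cts; apply: grad_line; exact: fgrad. Qed.

Lemma cauchy_pd w (r : R) i : 0 < r -> vn (w - z) + 2 * r < rho ->
  ker (fun x => f (w + x *: e_ i) - f w) r = pd i f w * wind r.
Proof.
move=> r0 hr.
have hin x : cabs x <= 2 * r -> vn (w + x *: e_ i - z) < rho.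
  move=> xr; have := @shift_in w x i (vn (w - z) + (rho - (vn (w - z) + 2 * r))) (2 * r).
  by move=> /(_ _ xr)/lt_le_trans; apply; move: hr; lra.
have cd x : cabs x <= 2 * r -> cdif (fun x => f (w + x *: e_ i)) x (pd i f (w + x *: e_ i)).
  move=> /hin/fgrad/grad_line; by rewrite (sum_e (fun j => pd j f _)).
rewrite -(cauchy_derivative r0 (f := fun x => f (w + x *: e_ i))).
- by rewrite scale0r addr0.
- by move=> x /csquare_le; rewrite subr0 => /cd ?; eexists; eassumption.
- have := cd 0; rewrite scale0r addr0; apply.
  by rewrite cabs0 mulr_ge0// ltW.
Qed.

(** Squares of half-side [r] lie in discs of radius [rho / 4]. This leaves room to shrink the region
    from [rho], where [f] is bounded, to [rho / 2] for bounds and to [rho / 4] for Lipschitz bounds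
    of the derivatives. *)
Let r := rho / 8.
Let r0 : 0 < r. Proof. by rewrite divr_gt0. Qed.
Let K := 8 * M / r.

Let M0 : 0 <= M.
Proof. by apply: le_trans (cabs_ge0 _) (fM (w := z) _); rewrite subrr vn0. Qed.

Let K0 : 0 <= K. Proof. by rewrite /K divr_ge0 ?mulr_ge0// ltW. Qed.

Lemma wind_div (a X : CC R) (s A : R) : 0 < s -> X = a * wind s -> cabs X <= A ->
  cabs a <= A / 4.
Proof.
move=> s0 ->; rewrite cabsM => h; rewrite ler_pdivlMr//; apply: le_trans h.
by rewrite ler_wpM2l ?cabs_ge0 ?wind_ge.
Qed.

Lemma line_ctsd w i (s : R) (c : CC R) : vn (w - z) + 2 * s < rho ->
  ctsd (fun x => f (w + x *: e_ i) - c) s.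
Proof.
move=> hs x xs; apply: ctsD; last exact: cts_cst.
apply: line_cts; have := @shift_in w x i (rho - 2 * s) (2 * s).
by rewrite subrK; apply => //; move: hs; lra.
Qed.

Lemma pd_bound w i : vn (w - z) < rho / 2 -> cabs (pd i f w) <= K.
Proof.
move=> hw; have hr : vn (w - z) + 2 * r < rho by move: hw rho0; rewrite /r; lra.
have : cabs (ker (fun x => f (w + x *: e_ i) - f w) r) <= 16 * (2 * M / r).
  apply: ker_bound => //; first exact: line_ctsd.
  move=> x xr; apply: (le_trans (cabsD _ _)); rewrite cabsN mulr_natl mulr2n.
  apply: lerD; apply: fM; last by move: hw rho0; lra.
  have := @shift_in w x i (rho - 2 * r) (2 * r).
  by rewrite subrK; apply => //; move: hr; lra.
move=> /(wind_div r0 (cauchy_pd i r0 hr))/le_trans; apply; rewrite /K; lra.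
Qed.

Lemma seg_in (w h : CN R N) (s t : R) : 0 <= t <= 1 -> vn (w - z) < s -> vn (w + h - z) < s ->
  vn (w + t%:C%C *: h - z) < s.
Proof.
move=> /andP[t0 t1] a b.
rewrite (_ : _ - z = (1 - t)%:C%C *: (w - z) + t%:C%C *: (w + h - z)); last first.
  by rewrite rmorphB rmorph1; apply/rowP => i; rewrite !mxE; ring.
apply: (le_lt_trans (vnD _ _)); rewrite !vnZ !cabsR !ger0_norm ?subr_ge0//.
have [tE|tn] := eqVneq t 0; first by rewrite tE subr0 mul1r mul0r addr0.
have tp : 0 < t by rewrite lt_neqAle eq_sym tn.
have -> : s = (1 - t) * s + t * s by ring.
apply: ler_ltD; first by rewrite ler_wpM2l ?subr_ge0// ltW.
by rewrite ltr_pM2l.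
Qed.

Lemma f_lip w h : vn (w - z) < rho / 2 -> vn (w + h - z) < rho / 2 ->
  cabs (f (w + h) - f w) <= 2 * (K * vn h).
Proof.
move=> a b.
have := @mean_value_cabs R (fun t => f (w + t *: h)) (fun t => \sum_i pd i f (w + t%:C%C *: h) * h ord0 i) (K * vn h).
rewrite scale1r scale0r addr0; apply.
  move=> t t01; apply: grad_line; apply: fgrad.
  by apply: lt_trans (seg_in t01 a b) _; move: rho0; lra.
move=> t t01; apply: (le_trans (cabs_sum _ _ _)); rewrite /vn mulr_sumr.
apply: ler_sum => i _; rewrite cabsM ler_wpM2r ?cabs_ge0// pd_bound//.
exact: seg_in.
Qed.

Let K2 := 16 * K / r.

Let K20 : 0 <= K2. Proof. by apply: divr_ge0; [exact: mulr_ge0|exact: ltW]. Qed.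

(** [ker] is applied to the difference of two translates of [f], which [f_lip] bounds by a multiple
    of [vn h]. *)
Lemma pd_lip w h i : vn (w - z) < rho / 4 -> vn (w + h - z) < rho / 4 ->
  cabs (pd i f (w + h) - pd i f w) <= K2 * vn h.
Proof.
move=> a b.
have hr : vn (w - z) + 2 * r < rho by move: a rho0; rewrite /r; lra.
have hr' : vn (w + h - z) + 2 * r < rho by move: b rho0; rewrite /r; lra.
have c1 := @line_ctsd (w + h) i r (f (w + h)) hr'.
have c2 := @line_ctsd w i r (f w) hr.
have E : ker (fun x => f (w + h + x *: e_ i) - f (w + h) - (f (w + x *: e_ i) - f w)) r =
    (pd i f (w + h) - pd i f w) * wind r.
  apply: (etrans (kerB r0 c1 c2)); apply: etrans (esym (mulrBl _ _ _)).
  exact: (congr2 (fun a b => a - b) (cauchy_pd i r0 hr') (cauchy_pd i r0 hr)).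
have : cabs (ker (fun x => f (w + h + x *: e_ i) - f (w + h) - (f (w + x *: e_ i) - f w)) r) <= 16 * (2 * (2 * (K * vn h)) / r).
  apply: ker_bound => //.
    by move=> x xr; apply: ctsD; [exact: c1|apply: ctsN; exact: c2].
  move=> x xr.
  rewrite (_ : _ - _ = (f (w + x *: e_ i + h) - f (w + x *: e_ i)) - (f (w + h) - f w)); last first.
    rewrite (_ : w + h + x *: e_ i = w + x *: e_ i + h); last by rewrite addrAC.
    by ring.
  apply: (le_trans (cabsD _ _)); rewrite cabsN [leRHS]mulr_natl mulr2n.
  have E' : rho / 4 + 2 * r = rho / 2 by rewrite /r; field.
  apply: lerD; apply: f_lip; try (move: a b rho0; lra).
  - by rewrite -E'; apply: shift_in.
  - rewrite (_ : w + x *: e_ i + h = w + h + x *: e_ i); last by rewrite addrAC.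
    by rewrite -E'; apply: shift_in.
move=> /(wind_div r0 E)/le_trans; apply; rewrite /K2.
rewrite (_ : 16 * (2 * (2 * (K * vn h)) / r) / 4 = 16 * K / r * vn h)//.
by field; exact: lt0r_neq0.
Qed.

Lemma taylor1 w h : vn (w - z) < rho / 4 -> vn (w + h - z) < rho / 4 ->
  cabs (f (w + h) - f w - \sum_i pd i f w * h ord0 i) <= 2 * (K2 * vn h ^+ 2).
Proof.
move=> a b.
pose g := fun t : CC R => f (w + t *: h) + (- \sum_i pd i f w * h ord0 i) * t.
have := @mean_value_cabs R g (fun t => \sum_i (pd i f (w + t%:C%C *: h) - pd i f w) * h ord0 i) (K2 * vn h ^+ 2).
rewrite /g scale1r scale0r addr0 mulr1 mulr0 addr0 addrAC; apply.
  move=> t t01.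
  rewrite (_ : \sum_i (pd i f (w + t%:C%C *: h) - pd i f w) * h ord0 i = \sum_i pd i f (w + t%:C%C *: h) * h ord0 i + (- \sum_i pd i f w * h ord0 i)); last first.
    by rewrite -sumrB; apply: eq_bigr => i _; rewrite mulrBl.
  apply: cdifD.
    apply: grad_line; apply: fgrad.
    by apply: lt_trans (seg_in t01 a b) _; move: rho0; lra.
  have := cdifM (cdif_cst (- \sum_i pd i f w * h ord0 i) (t%:C%C)) (cdif_id (t%:C%C)).
  by rewrite mul0r add0r mulr1.
move=> t t01; apply: (le_trans (cabs_sum _ _ _)); rewrite expr2 mulrA {2}/vn mulr_sumr.
apply: ler_sum => i _; rewrite cabsM ler_wpM2r ?cabs_ge0//.
apply: (le_trans (pd_lip _ a (seg_in t01 a b))).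
rewrite vnZ cabsR ler_wpM2l// ger0_norm; last by case/andP: t01.
by rewrite ler_piMl ?vn_ge0//; case/andP: t01.
Qed.

(** Applying [ker] along the [j]-th axis to the expansion [taylor1] differentiates it, remainder
    included. The coefficients become kernels of the functions [pd i f], for which continuity
    suffices; no second derivative is presupposed. *)
Lemma pd_grad j : exists G, grad (pd j f) z G.
Proof.
pose s := rho / 32.
have s0 : 0 < s by rewrite divr_gt0.
have zz : vn (z - z) = 0 by rewrite subrr vn0.
have ci i : ctsd (fun x => pd i f (z + x *: e_ j) - pd i f z) s.
  move=> x xs e e0.
  have xin : vn (z + x *: e_ j - z) < rho / 8.
    rewrite [z + _]addrC addrK vn_e; apply: (le_lt_trans xs); rewrite /s; move: rho0; lra.
  exists (Num.min (rho / 8) (e / (K2 + 1))).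
    by rewrite lt_min !divr_gt0// ltr_wpDl.
  move=> y; rewrite lt_min => /andP[y1 y2].
  have yE : z + y *: e_ j = (z + x *: e_ j) + (y - x) *: e_ j.
    by rewrite -addrA -scalerDl [x + _]addrC subrK.
  rewrite (_ : _ - _ = pd i f (z + x *: e_ j + (y - x) *: e_ j) - pd i f (z + x *: e_ j)); last first.
    by rewrite yE opprB addrA subrK.
  have bb : vn (z + x *: e_ j + (y - x) *: e_ j - z) < rho / 4.
    have -> : rho / 4 = rho / 8 + rho / 8 by field.
    by apply: shift_in => //; exact: ltW.
  apply: (le_lt_trans (pd_lip _ _ bb)); first by move: xin rho0; lra.
  rewrite vn_e; move: y2; rewrite ltr_pdivlMr ?ltr_wpDl//; apply: le_lt_trans.
  by rewrite mulrC ler_wpM2l ?cabs_ge0// lerDl.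
exists (fun i => ker (fun x => pd i f (z + x *: e_ j) - pd i f z) s / wind s).
have W0 : wind s != 0.
  by rewrite -cabs_gt0; apply: lt_le_trans (wind_ge s0).
move=> e e0.
pose C := 16 * (2 * (2 * K2)) / s / 4.
have C0 : 0 <= C by rewrite /C !(divr_ge0, mulr_ge0)// ltW.
exists (Num.min (rho / 8) (e / (C + 1))); first by rewrite lt_min !divr_gt0// ltr_wpDl.
move=> h; rewrite lt_min => /andP[h1 h2].
have zh : vn (z + h - z) = vn h by rewrite [z + h]addrC addrK.
have hr : vn (z - z) + 2 * s < rho by rewrite zz /s; move: rho0; lra.
have hr' : vn (z + h - z) + 2 * s < rho by rewrite zh /s; move: rho0 h1; lra.
have c1 := @line_ctsd (z + h) j s (f (z + h)) hr'.
have c1' := @line_ctsd z j s (f z) hr.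
have cs : ctsd (fun x => \sum_i (pd i f (z + x *: e_ j) - pd i f z) * h ord0 i) s.
  by move=> x xs; apply: cts_sum => i; apply: ctsM; [exact: ci|exact: cts_cst].
have c2 : ctsd (fun x => f (z + h + x *: e_ j) - f (z + h) - (f (z + x *: e_ j) - f z)) s.
  by move=> x xs; apply: ctsD; [exact: c1|apply: ctsN; exact: c1'].
pose T x := f (z + h + x *: e_ j) - f (z + h) - (f (z + x *: e_ j) - f z) - \sum_i (pd i f (z + x *: e_ j) - pd i f z) * h ord0 i.
have E : ker T s = (pd j f (z + h) - pd j f z - \sum_i ker (fun x => pd i f (z + x *: e_ j) - pd i f z) s / wind s * h ord0 i) * wind s.
  apply: (etrans (kerB s0 c2 cs)); apply: etrans (esym (mulrBl _ _ _)).
  congr (_ - _).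
    apply: (etrans (kerB s0 c1 c1')); apply: etrans (esym (mulrBl _ _ _)).
    exact: (congr2 (fun a b => a - b) (cauchy_pd j s0 hr') (cauchy_pd j s0 hr)).
  rewrite ker_sum//; last by move=> i x xs; apply: ctsM; [exact: ci|exact: cts_cst].
  by rewrite mulr_suml; apply: eq_bigr => i _; rewrite kerZ//; field.
have : cabs (ker T s) <= 16 * (2 * (2 * (K2 * vn h ^+ 2)) / s).
  apply: ker_bound => //.
    by move=> x xs; apply: ctsD; [exact: c2|apply: ctsN; exact: cs].
  move=> x xs.
  rewrite (_ : T x = (f (z + x *: e_ j + h) - f (z + x *: e_ j) - \sum_i pd i f (z + x *: e_ j) * h ord0 i) - (f (z + h) - f z - \sum_i pd i f z * h ord0 i)); last first.
    rewrite /T (_ : z + h + x *: e_ j = z + x *: e_ j + h); last by rewrite addrAC.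
    rewrite (_ : \sum_i (pd i f (z + x *: e_ j) - pd i f z) * h ord0 i = \sum_i pd i f (z + x *: e_ j) * h ord0 i - \sum_i pd i f z * h ord0 i); last first.
      by rewrite -sumrB; apply: eq_bigr => i _; rewrite mulrBl.
    exact: alg6.
  apply: (le_trans (cabsD _ _)); rewrite cabsN [leRHS]mulr_natl mulr2n.
  have xin : vn (z + x *: e_ j - z) < rho / 8.
    rewrite [z + _]addrC addrK vn_e; apply: (le_lt_trans xs); rewrite /s; move: rho0; lra.
  apply: lerD; apply: taylor1; rewrite ?zz ?zh; try (move: rho0 h1 xin; lra).
  rewrite (_ : z + x *: e_ j + h - z = (z + x *: e_ j - z) + h); last by rewrite addrAC.
  by apply: (le_lt_trans (vnD _ _)); move: xin h1; lra.
move=> /(wind_div s0 E)/le_trans; apply.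
rewrite (_ : 16 * _ / 4 = C * vn h * vn h); last by rewrite /C; field; exact: lt0r_neq0.
rewrite ler_wpM2r ?vn_ge0//; move: h2; rewrite ltr_pdivlMr ?ltr_wpDl// => /ltW.
by apply: le_trans; rewrite mulrC ler_wpM2l ?vn_ge0// lerDl.
Qed.

End Ball.

Lemma holomorphic_pd (U : set (CN R N)) f j : open U ->
  holomorphic_on U f -> holomorphic_on U (pd j f).
Proof.
move=> oU hf z Uz.
have [d d0 dU] := open_vn oU Uz.
have : {for z, continuous f} by apply: differentiable_continuous; exact: hf.
move=> /continuous_cabsP/(_ 1 ltr01)/nbhs_vn[d' d'0 hd'].
have mp : 0 < Num.min d d' by rewrite lt_min d0.
have [||G gG] := @pd_grad f z (Num.min d d') (cabs (f z) + 1) mp _ _ j.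
- by move=> w; rewrite lt_min => /andP[/dU Uw _]; apply: differentiable_grad; exact: hf.
- move=> w; rewrite lt_min => /andP[_ /hd' h].
  have := cabsBr (f w) (f z); move: h; lra.
by have [] := grad_differentiable gG.
Qed.

End PartialDerivatives.

(** * Compactness and extrema of continuous real functions on C^N *)

Section Topology.
Variables (R : realType) (N : nat).
Implicit Types (z w h : CN R N).

Lemma compact_disc (rho : R) : compact [set x : CC R | cabs x <= rho].
Proof.
have cpt : continuous (fun ab : R * R => pt ab.1 ab.2 : CC R).
  move=> [a b]; apply/continuous_cabsP => e e0.
  apply/nbhs_ballP; exists (e / 2); first by rewrite /= divr_gt0.
  move=> [c d] [/=]; rewrite /ball /= => ac bd.
  apply: (le_lt_trans (cabs_le _)); rewrite /= distrC [`|d - b|]distrC; lra.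
have cK : compact ((fun ab : R * R => pt ab.1 ab.2 : CC R) @` (`[- rho, rho] `*` `[- rho, rho])).
  apply: continuous_compact; first exact: continuous_subspaceT.
  by apply: compact_setX; exact: segment_compact.
apply: subclosed_compact cK _; last first.
  move=> x /= xr; exists (cre x, cim x); last by rewrite /= pt_eta.
  have := le_trans (cre_le x) xr; have := le_trans (cim_le x) xr.
  by rewrite !ler_norml => h1 h2; split; rewrite /= in_itv /=.
rewrite -[X in closed X]setCK; apply: open_closedC; rewrite openE => x /=.
move/negP; rewrite -ltNge => xr; apply/nbhs_cabs; exists (cabs x - rho); first by rewrite subr_gt0.
move=> y yx /=; apply/negP; rewrite -ltNge; have := cabsBr x y; rewrite cabsB; move: yx; lra.
Qed.

Definition vcts (u : CN R N -> R) z := forall e : R, 0 < e ->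
  exists2 d : R, 0 < d & forall w, vn (w - z) < d -> `|u w - u z| < e.

Lemma vctsP (u : CN R N -> R) z : vcts u z <-> {for z, continuous u}.
Proof.
split=> [h A /nbhs_ballP[e e0 eA]|h e e0].
  have [d d0 hd] := h e e0; apply/nbhs_vn; exists d => // w /hd wd; apply: eA.
  by rewrite /ball /= distrC.
have /nbhs_vn[d d0 hd] := h _ (nbhsx_ballx (u z) e e0).
by exists d => // w /hd; rewrite /ball /= distrC.
Qed.

Lemma vcts_lip (u : CN R N -> R) z : (forall w, `|u w - u z| <= vn (w - z)) -> vcts u z.
Proof. by move=> h e e0; exists e => // w; exact: le_lt_trans (h w). Qed.

Lemma compact_closed_bounded (A : set (CN R N)) c (rho : R) : closed A ->
  (forall z, A z -> vn (z - c) <= rho) -> compact A.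
Proof.
move=> cA Ab.
have cK : compact [set v : CN R N | forall i, [set x : CC R | cabs x <= rho + vn c] (v ord0 i)].
  by apply: (@rV_compact (CC R) N (fun=> [set x : CC R | cabs x <= rho + vn c])) => i; exact: compact_disc.
apply: subclosed_compact cA cK _ => z /Ab zr i /=.
apply: (le_trans (cabs_le_vn _ _)); rewrite -{1}(subrK c z).
by apply: (le_trans (vnD _ _)); rewrite lerD2r.
Qed.

Lemma closed_vcts_le (u : CN R N -> R) (a : R) : (forall z, vcts u z) ->
  closed [set z | u z <= a].
Proof.
move=> cu; rewrite -[X in closed X]setCK; apply: open_closedC; apply: vn_open => z /=.
move/negP; rewrite -ltNge => az.
have [|d d0 hd] := cu z (u z - a); first by rewrite subr_gt0.
exists d => // w /hd; rewrite ltr_norml => /andP[h1 h2]; apply/negP; rewrite -ltNge; lra.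
Qed.

Lemma vmax (A : set (CN R N)) (u : CN R N -> R) : compact A -> A !=set0 ->
  (forall z, A z -> vcts u z) -> exists2 q, A q & forall z, A z -> u z <= u q.
Proof.
move=> cA A0 cu.
have [|q /set_mem Aq qm] := compact_EVT_max A0 cA (f := u).
  by apply: continuous_in_subspaceT => z /set_mem /cu /vctsP.
by exists q => // z Az; apply: qm; exact: mem_set.
Qed.

Lemma vmin (A : set (CN R N)) (u : CN R N -> R) : compact A -> A !=set0 ->
  (forall z, A z -> vcts u z) -> exists2 q, A q & forall z, A z -> u q <= u z.
Proof.
move=> cA A0 cu; have [|q Aq h] := @vmax A (fun z => - u z) cA A0.
  by move=> z /cu cz e /cz[d d0 hd]; exists d => // w /hd; rewrite -opprD normrN.
by exists q => // z /h; rewrite lerN2.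
Qed.

Lemma vcts_vn c z : vcts (fun w => vn (w - c)) z.
Proof.
apply: vcts_lip => w; rewrite ler_norml; apply/andP; split.
  by have := vn_triangle z c w; rewrite (vnB z w); lra.
by have := vn_triangle w c z; lra.
Qed.

Lemma vctsD (u v : CN R N -> R) z : vcts u z -> vcts v z -> vcts (fun w => u w + v w) z.
Proof. by move=> /vctsP hu /vctsP hv; apply/vctsP; exact: (continuousD hu hv). Qed.

Lemma vctsM (u v : CN R N -> R) z : vcts u z -> vcts v z -> vcts (fun w => u w * v w) z.
Proof. by move=> /vctsP hu /vctsP hv; apply/vctsP; exact: (continuousM hu hv). Qed.

Lemma vcts_cst (c : R) z : vcts (fun=> c) z.
Proof. by apply/vctsP; exact: cst_continuous. Qed.

Lemma vctsX (u : CN R N -> R) n z : vcts u z -> vcts (fun w => u w ^+ n) z.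
Proof.
move=> hu; elim: n => [|n ih]; first exact: (vcts_cst 1).
rewrite (_ : (fun w => u w ^+ n.+1) = (fun w => u w * u w ^+ n)); first exact: vctsM.
by apply/funext => w; rewrite exprS.
Qed.

Lemma vcts_cabs (f : CN R N -> CC R) z : {for z, continuous f} -> vcts (fun w => cabs (f w)) z.
Proof.
move=> /continuous_cabsP h e /h/nbhs_vn[d d0 hd]; exists d => // w /hd; apply: le_lt_trans.
rewrite ler_norml; apply/andP; split; last exact: cabsBr.
by rewrite -lerN2 opprK opprB cabsB; exact: cabsBr.
Qed.

Lemma vcts_comp (g : R -> R) (u : CN R N -> R) z : continuous g -> vcts u z -> vcts (fun w => g (u w)) z.
Proof. by move=> cg /vctsP hu; apply/vctsP; exact: (continuous_comp hu (cg _)). Qed.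

End Topology.

(** * Closure properties of holomorphic functions and the chain rule *)

Section Holomorphic.
Variables (R : realType) (N : nat) (U : set (CN R N)).
Implicit Types (f g : CN R N -> CC R).
Local Notation hol := (holomorphic_on U).

Lemma hol_cst (c : CC R) : hol (fun=> c).
Proof. by move=> z _; exact: differentiable_cst. Qed.

Lemma holD f g : hol f -> hol g -> hol (fun z => f z + g z).
Proof. by move=> hf hg z Uz; exact: (differentiableD (hf z Uz) (hg z Uz)). Qed.

Lemma holM f g : hol f -> hol g -> hol (fun z => f z * g z).
Proof. by move=> hf hg z Uz; exact: (differentiableM (hf z Uz) (hg z Uz)). Qed.

Lemma holX f n : hol f -> hol (fun z => f z ^+ n).
Proof.
move=> hf; elim: n => [|n ih]; first exact: (hol_cst 1).
rewrite (_ : (fun z => f z ^+ n.+1) = (fun z => f z * f z ^+ n)); first exact: holM.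
by apply/funext => w; rewrite exprS.
Qed.

Lemma hol_sum (I : Type) (s : seq I) (P : pred I) (F : I -> CN R N -> CC R) :
  (forall i, hol (F i)) -> hol (fun z => \sum_(i <- s | P i) F i z).
Proof.
move=> h; elim: s => [|i s ih].
  rewrite (_ : (fun x => _) = fun=> 0); first exact: hol_cst.
  by apply/funext => y; rewrite big_nil.
rewrite (_ : (fun x => _) = fun x => (if P i then F i x else 0) + \sum_(i <- s | P i) F i x).
  by apply: holD => //; case: (P i) => //; exact: hol_cst.
by apply/funext => y; rewrite big_cons; case: ifP; rewrite ?add0r.
Qed.

Lemma hol_prod (I : Type) (s : seq I) (P : pred I) (F : I -> CN R N -> CC R) :
  (forall i, hol (F i)) -> hol (fun z => \prod_(i <- s | P i) F i z).
Proof.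
move=> h; elim: s => [|i s ih].
  rewrite (_ : (fun x => _) = fun=> 1); first exact: hol_cst.
  by apply/funext => y; rewrite big_nil.
rewrite (_ : (fun x => _) = fun x => (if P i then F i x else 1) * \prod_(i <- s | P i) F i x).
  by apply: holM => //; case: (P i) => //; exact: hol_cst.
by apply/funext => y; rewrite big_cons; case: ifP; rewrite ?mul1r.
Qed.

Lemma hol_det m (F : 'I_m -> 'I_m -> CN R N -> CC R) :
  (forall i j, hol (F i j)) -> hol (fun z => \det (\matrix_(i, j) F i j z)).
Proof.
move=> h; rewrite /determinant.
apply: hol_sum => s; apply: holM; first exact: hol_cst.
by apply: hol_prod => i; under eq_fun do rewrite mxE; exact: h.
Qed.

Lemma hol_coord i : hol (fun z => z ord0 i).
Proof.
move=> z _; have [] // := @grad_differentiable R N (fun z => z ord0 i) z (fun j => (j == i)%:R).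
move=> e e0; exists 1 => // h _.
rewrite (bigD1 i)//= eqxx mul1r big1 ?addr0.
  rewrite mxE (_ : _ + h ord0 i - z ord0 i - _ = 0); last by ring.
  by rewrite cabs0 mulr_ge0 ?vn_ge0// ltW.
by move=> j /negbTE ->; rewrite mul0r.
Qed.

Lemma hol_cont f z : U z -> hol f -> {for z, continuous f}.
Proof. by move=> Uz hf; apply: differentiable_continuous; exact: hf. Qed.

Lemma hol_grad f z : U z -> hol f -> grad f z (fun i => pd i f z).
Proof. by move=> Uz hf; apply: differentiable_grad; exact: hf. Qed.

End Holomorphic.

Section Chain.
Variables (R : realType) (N : nat).

Definition vdif (phi : CC R -> CN R N) t (d : CN R N) :=
  forall i, cdif (fun s => phi s ord0 i) t (d ord0 i).

(** Makes one radius serve finitely many conditions; the default 1 in the minimum keeps it positive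
    when there is none. *)
Lemma fin_delta (P : 'I_N -> R -> Prop) :
  (forall i d d', 0 < d' -> d' <= d -> P i d -> P i d') ->
  (forall i, exists2 d : R, 0 < d & P i d) -> exists2 d : R, 0 < d & forall i, P i d.
Proof.
move=> mono h.
have /choice[D hD] i : exists d : R, 0 < d /\ P i d by have [d ? ?] := h i; exists d.
exists (\big[Num.min/1]_i D i).
  by apply: lt_bigmin => // i _; case: (hD i).
move=> i; have [Di PDi] := hD i; apply: mono PDi; last exact: bigmin_le_cond.
by apply: lt_bigmin => // j _; case: (hD j).
Qed.

Lemma chain_grad (e : CN R N -> CC R) (phi : CC R -> CN R N) t d (G : 'I_N -> CC R) :
  vdif phi t d -> grad e (phi t) G ->
  cdif (fun s => e (phi s)) t (\sum_i G i * d ord0 i).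
Proof.
move=> dphi ge eps eps0.
pose S := \sum_i cabs (G i); pose D := vn d + N%:R + 1.
have S0 : 0 <= S by apply: sumr_ge0 => i _; exact: cabs_ge0.
have D0 : 0 < D by rewrite /D ltr_wpDl// addr_ge0 ?vn_ge0.
have [d1 d10 h1] := ge (eps / 2 / D) ltac:(by rewrite !divr_gt0).
pose e2 := Num.min 1 (eps / 2 / (S + 1)).
have e20 : 0 < e2 by rewrite /e2 lt_min ltr01 !divr_gt0// ltr_wpDl.
have [d2 d20 h2] : exists2 d2 : R, 0 < d2 & forall i, forall h, cabs h < d2 ->
    cabs (phi (t + h) ord0 i - phi t ord0 i - d ord0 i * h) <= e2 * cabs h.
  apply: fin_delta; last by move=> i; exact: (dphi i e2 e20).
  by move=> i a b _ ba H h hb; apply: H; exact: lt_le_trans ba.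
exists (Num.min d2 (d1 / D)); first by rewrite lt_min d20 divr_gt0.
move=> h; rewrite lt_min => /andP[hd2]; rewrite ltr_pdivlMr// => hd1.
pose k := phi (t + h) - phi t.
have ki i : cabs (k ord0 i - d ord0 i * h) <= e2 * cabs h by rewrite !mxE; exact: h2.
have kn : vn k <= cabs h * D.
  apply: (@le_trans _ _ (\sum_i (cabs (d ord0 i) * cabs h + cabs h))).
    apply: ler_sum => i _; rewrite -(subrK (d ord0 i * h) (k ord0 i)).
    apply: (le_trans (cabsD _ _)); rewrite cabsM addrC lerD2l.
    apply: (le_trans (ki i)); rewrite ler_piMl ?cabs_ge0//.
    by rewrite /e2 ge_min lexx.
  rewrite big_split /= -mulr_suml sumr_const card_ord -[_ *+ N]mulr_natl -/(vn d).
  rewrite -mulrDl mulrC ler_wpM2l ?cabs_ge0// /D; lra.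
have := h1 k; rewrite {1 2}/k [phi t + _]addrC subrK => /(_ (le_lt_trans kn hd1)) H.
rewrite (_ : _ - _ = (e (phi (t + h)) - e (phi t) - \sum_i G i * k ord0 i) +
   \sum_i G i * (k ord0 i - d ord0 i * h)); last first.
  rewrite (_ : \sum_i G i * (k ord0 i - d ord0 i * h) =
    \sum_i G i * k ord0 i - (\sum_i G i * d ord0 i) * h); first by rewrite addrA subrK.
  by rewrite mulr_suml -sumrB; apply: eq_bigr => i _; rewrite mulrBr mulrA.
apply: (le_trans (cabsD _ _)).
have H1 : eps / 2 / D * vn k <= eps / 2 * cabs h.
  apply: (@le_trans _ _ (eps / 2 / D * (cabs h * D))).
    by rewrite ler_wpM2l// !divr_ge0// ltW.
  by rewrite mulrCA divfK ?gt_eqF// mulrC.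
have H2 : cabs (\sum_i G i * (k ord0 i - d ord0 i * h)) <= eps / 2 * cabs h.
  apply: (le_trans (cabs_sum _ _ _)).
  apply: (@le_trans _ _ (S * (e2 * cabs h))).
    rewrite /S mulr_suml; apply: ler_sum => i _; rewrite cabsM ler_wpM2l ?cabs_ge0//.
  rewrite mulrA ler_wpM2r ?cabs_ge0//.
  apply: (@le_trans _ _ (S * (eps / 2 / (S + 1)))).
    by rewrite ler_wpM2l// /e2 ge_min lexx orbT.
  rewrite mulrA ler_pdivrMr ?ltr_wpDl// mulrC ler_wpM2l ?divr_ge0 ?lerDl// ltW//.
by move: H H1 H2; lra.
Qed.

End Chain.

Opaque pd determinant.

(** * A holomorphic function vanishing to infinite order is zero *)

Section IdentityTheorem.
Variable R : realType.

Lemma near_neq0 (a b : CC R) : cabs (b - a) < cabs a -> b != 0.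
Proof. by apply: contraTneq => ->; rewrite sub0r cabsN ltxx. Qed.

(** No power series: the Cauchy estimate for [a t / t ^+ n] on the square of half-side 2, whose
    boundary keeps distance 2 from 0, bounds [|a p|] by [8 * M / 2 ^+ n] for every [n]. *)
Lemma identity_disc (a : CC R -> CC R) :
  (forall t, cabs t < 8 -> exists l, cdif a t l) ->
  (forall n, exists C : R, forall t, cabs t <= 4 -> cabs (a t) <= C * cabs t ^+ n) ->
  forall t, cabs t <= 1 -> a t = 0.
Proof.
move=> da hC p p1; apply/eqP; rewrite -cabs_eq0 eq_le cabs_ge0 andbT.
have [M hM] := hC 0%N.
have M0 : 0 <= M.
  have := hM 0; rewrite cabs0 expr0 mulr1 => /(_ _)/(le_trans (cabs_ge0 _)); apply; lra.
have [p0|p0] := eqVneq p 0.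
  by have [C hC1] := hC 1%N; have := hC1 0; rewrite p0 cabs0 expr1 mulr0; apply; lra.
have dX n (t : CC R) : exists l, cdif (fun s : CC R => s ^+ n) t l.
  elim: n => [|n [l hl]]; first by exists 0; exact: (cdif_cst 1).
  eexists; rewrite (_ : (fun s : CC R => s ^+ n.+1) = fun s => s * s ^+ n); last by apply/funext => s; rewrite exprS.
  exact: cdifM (cdif_id _) hl.
have key n : cabs (a p) <= 8 * M / 2 ^+ n.
  have : cabs (a p * (p ^+ n)^-1) <= 8 * (M / 2 ^+ n).
    apply: (@cauchy_estimate R (fun t => a t * (t ^+ n)^-1) 0 2 _ p) => //.
    - by rewrite subr0 divff.
    - move=> t /csquare_le; rewrite subr0 => t4.
      have t8 : cabs t < 8 by move: t4; lra.
      have [l hl] := da t t8.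
      have [->|t0] := eqVneq t 0.
        (* The quotient is 0 at 0 because [a 0 = 0]; vanishing of [a] to order [n.+2] gives it
           derivative 0 there. *)
        exists (0 : CC R) => e e0; have [C hCn] := hC n.+2.
        have C0 : 0 <= C.
          have := hCn 1; rewrite cabs1 expr1n mulr1 => /(_ _)/(le_trans (cabs_ge0 _)); apply; lra.
        have a0 : a 0 = 0.
          apply/eqP; rewrite -cabs_eq0 eq_le cabs_ge0 andbT.
          by have := hCn 0; rewrite cabs0 expr0n /= mulr0; apply; lra.
        exists (Num.min 1 (e / (C + 1))); first by rewrite lt_min ltr01 divr_gt0// ltr_wpDl.
        move=> h; rewrite lt_min => /andP[h1 h2].
        rewrite add0r a0 mul0r subr0 mul0r subr0.
        have [->|h0] := eqVneq h 0; first by rewrite a0 mul0r cabs0 mulr0.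
        rewrite cabsM cabsV cabsX ler_pdivrMr ?exprn_gt0 ?cabs_gt0//.
        apply: (le_trans (hCn h _)); first by move: h1; lra.
        rewrite !exprS mulrCA !mulrA ler_wpM2r ?exprn_ge0 ?cabs_ge0//.
        rewrite [e * _]mulrC -!mulrA ler_wpM2l ?cabs_ge0//.
        move: h2; rewrite ltr_pdivlMr ?ltr_wpDl// => /ltW; apply: le_trans.
        by rewrite mulrC ler_wpM2l ?cabs_ge0// lerDl.
      have [l' hl'] := dX n t; eexists; apply: cdifM; first exact: hl.
      by apply: cdifV; [rewrite expf_neq0|exact: hl'].
    - move=> t tb; have [t0 t2 t4] := cbd0 (ltr0Sn R 1) tb.
      rewrite cabsM cabsV cabsX; apply: ler_pM; rewrite ?cabs_ge0 ?invr_ge0 ?exprn_ge0 ?cabs_ge0//.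
        by have := hM t; rewrite expr0 mulr1; apply; move: t4; lra.
      rewrite lef_pV2 ?posrE ?exprn_gt0 ?cabs_gt0//.
      by rewrite lerXn2r// nnegrE ?cabs_ge0.
  rewrite mulrA; apply: le_trans; rewrite cabsM cabsV cabsX ler_peMr ?cabs_ge0//.
  by rewrite invf_ge1 ?exprn_gt0 ?cabs_gt0// exprn_ile1 ?cabs_ge0.
apply/ler_addgt0Pr => /= e e0; rewrite add0r.
have [n nP] : exists n : nat, 8 * M / e < n%:R.
  by exists (Num.Def.archi_bound (8 * M / e)); apply: archi_boundP; rewrite divr_ge0 ?mulr_ge0// ltW.
apply: (le_trans (key n)); rewrite ler_pdivrMr ?exprn_gt0//.
move: nP; rewrite ltr_pdivrMr// => /ltW/le_trans; apply.
rewrite [e * _]mulrC ler_wpM2r ?(ltW e0)//.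
by rewrite -natrX ler_nat ltnW// ltn_expl.
Qed.

End IdentityTheorem.

(** * The inverse function theorem in terms of curves *)

Section InverseFunction.
Variables (R : realType) (N : nat).
Implicit Types (z w h u x : CN R N).

Lemma vcts_sum (I : Type) (s : seq I) (F : I -> CN R N -> R) z :
  (forall i, vcts (F i) z) -> vcts (fun x => \sum_(i <- s) F i x) z.
Proof.
move=> h; elim: s => [|i s ih].
  rewrite (_ : (fun x => _) = fun=> 0); first exact: vcts_cst.
  by apply/funext => y; rewrite big_nil.
rewrite (_ : (fun x => _) = fun x => F i x + \sum_(i <- s) F i x); first exact: vctsD.
by apply/funext => y; rewrite big_cons.
Qed.

Lemma grad_sum (f : 'I_N -> CN R N -> CC R) (c : 'I_N -> CC R) z (G : 'I_N -> 'I_N -> CC R) :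
  (forall k, grad (f k) z (G k)) ->
  grad (fun z => \sum_k c k * f k z) z (fun j => \sum_k c k * G k j).
Proof.
move=> gf e e0; pose S := \sum_k cabs (c k).
have S0 : 0 <= S by apply: sumr_ge0 => k _; exact: cabs_ge0.
have [d d0 hd] : exists2 d : R, 0 < d & forall k, forall h, vn h < d ->
    cabs (f k (z + h) - f k z - \sum_i G k i * h ord0 i) <= e / (S + 1) * vn h.
  apply: fin_delta; first by move=> i a b _ ba H h hb; apply: H; exact: lt_le_trans ba.
  by move=> k; apply: gf; rewrite divr_gt0// ltr_wpDl.
exists d => // h hh.
rewrite (_ : _ - _ = \sum_k c k * (f k (z + h) - f k z - \sum_i G k i * h ord0 i)); last first.
  under [RHS]eq_bigr do rewrite !mulrBr.
  rewrite !sumrB; congr (_ - _); under eq_bigr do rewrite mulr_suml.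
  rewrite exchange_big /=; apply: eq_bigr => k _; rewrite mulr_sumr; apply: eq_bigr => i _.
  by rewrite mulrA.
apply: (le_trans (cabs_sum _ _ _)).
apply: (@le_trans _ _ (S * (e / (S + 1) * vn h))).
  rewrite /S mulr_suml; apply: ler_sum => k _; rewrite cabsM ler_wpM2l ?cabs_ge0//.
  exact: hd.
rewrite mulrA ler_wpM2r ?vn_ge0// mulrA ler_pdivrMr ?ltr_wpDl// mulrC ler_wpM2l ?lerDl// ltW//.
Qed.

Definition Jac (f : 'I_N -> CN R N -> CC R) z : 'M[CC R]_N := \matrix_(i, j) pd j (f i) z.

Section NearIdentity.
Variables (g : 'I_N -> CN R N -> CC R) (D : 'I_N -> 'I_N -> CN R N -> CC R) (x : CN R N) (rho0 : R).
Hypothesis rho00 : 0 < rho0.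
Hypothesis gD : forall z, vn (z - x) < rho0 -> forall i, grad (g i) z (fun j => D i j z).
Hypothesis cD : forall i j, {for x, continuous (D i j)}.
Hypothesis Dx : forall i j, D i j x = (i == j)%:R.

Definition grow z : CN R N := \row_i g i z.

Lemma near_identity : exists2 rho : R, 0 < rho <= rho0 & forall z h,
  vn (z - x) < rho -> vn (z + h - x) < rho ->
  vn (grow (z + h) - grow z - h) <= vn h / 2.
Proof.
(* Each of the [N] components contributes at most [2 * e * vn h], the 2 coming from
   [mean_value_cabs], so that the sum is at most [vn h / 2]. *)
pose e : R := (4 * N.+1%:R)^-1.
have e0 : 0 < e by rewrite invr_gt0 mulr_gt0.
have [d d0 hd] : exists2 d : R, 0 < d & forall i j w, vn (w - x) < d -> cabs (D i j w - (i == j)%:R) <= e.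
  apply: fin_delta; first by move=> i a b _ ba H j w wb; apply: H; exact: lt_le_trans ba.
  move=> i; apply: fin_delta; first by move=> j a b _ ba H w wb; apply: H; exact: lt_le_trans ba.
  move=> j; have /continuous_cabsP/(_ e e0)/nbhs_vn[d d0 hd] := @cD i j.
  by exists d => // w /hd /ltW; rewrite Dx.
exists (Num.min d rho0); first by rewrite lt_min d0 rho00 /= ge_min lexx orbT.
move=> z h; rewrite !lt_min => /andP[z1 z2] /andP[h1 h2].
have key i : cabs (g i (z + h) - g i z - h ord0 i) <= 2 * (e * vn h).
  have := @mean_value_cabs R (fun t => g i (z + t *: h) + (- h ord0 i) * t)
    (fun t => \sum_j (D i j (z + t%:C%C *: h) - (i == j)%:R) * h ord0 j) (e * vn h).
  rewrite scale1r scale0r addr0 mulr1 mulr0 addr0 addrAC; apply.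
    move=> t t01.
    rewrite (_ : \sum_j (D i j (z + t%:C%C *: h) - (i == j)%:R) * h ord0 j =
        \sum_j D i j (z + t%:C%C *: h) * h ord0 j + (- h ord0 i)); last first.
      under eq_bigr do rewrite mulrBl.
      rewrite sumrB; congr (_ - _); rewrite (bigD1 i)//= eqxx mul1r big1 ?addr0// => j.
      by rewrite eq_sym => /negbTE ->; rewrite mul0r.
    apply: cdifD; first by apply: grad_line; apply: gD; exact: seg_in.
    have := cdifM (cdif_cst (- h ord0 i) (t%:C%C)) (cdif_id (t%:C%C)).
    by rewrite mul0r add0r mulr1.
  move=> t t01; apply: (le_trans (cabs_sum _ _ _)); rewrite /vn mulr_sumr.
  apply: ler_sum => j _; rewrite cabsM ler_wpM2r ?cabs_ge0//; apply: hd; exact: seg_in.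
apply: (@le_trans _ _ (\sum_(i < N) (2 * (e * vn h)))).
  by apply: ler_sum => i _; rewrite !mxE; exact: key.
rewrite sumr_const card_ord -[_ *+ N]mulr_natl.
have -> : N%:R * (2 * (e * vn h)) = (N%:R * (2 * e)) * vn h by ring.
rewrite [leRHS]mulrC ler_wpM2r ?vn_ge0// /e invfM mulrA.
rewrite (_ : N%:R * 2 * (4^-1 / N.+1%:R) = N%:R / N.+1%:R * 2^-1); last first.
  by move: (N.+1%:R^-1) (N%:R) => a b; field.
by rewrite ler_piMl ?invr_ge0// ler_pdivrMr// mul1r ler_nat.
Qed.

Variable rho : R.
Hypothesis rho0' : 0 < rho <= rho0.
Hypothesis contr : forall z h, vn (z - x) < rho -> vn (z + h - x) < rho ->
  vn (grow (z + h) - grow z - h) <= vn h / 2.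

Lemma grow_lip z w : vn (z - x) < rho -> vn (w - x) < rho ->
  vn (w - z) <= 2 * vn (grow w - grow z).
Proof.
move=> zr wr; have := contr (h := w - z) zr; rewrite [z + _]addrC subrK => /(_ wr).
have := vnD (grow w - grow z) (- (grow w - grow z - (w - z))).
rewrite vnN opprB [_ + (w - z - _)]addrC subrK.
have := vn_ge0 (w - z); lra.
Qed.

(** Minimisation over a compact ball instead of a fixed point iteration. Comparison with the centre,
    by [grow_lip], puts the minimiser in the interior; moving it by a small multiple of minus the
    error would reduce the error, so the error is 0. *)
Lemma grow_surj v : vn v < rho / 8 -> exists2 z, vn (z - x) <= rho / 2 & grow z = grow x + v.
Proof.
move=> vr; have [rp rr] := andP rho0'.
pose A := [set z : CN R N | vn (z - x) <= rho / 2].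
have cA : compact A.
  apply: (@compact_closed_bounded R N A x (rho / 2)) => //.
  by apply: closed_vcts_le => z; exact: vcts_vn.
pose F z := vn (grow z - (grow x + v)).
have cF z : A z -> vcts F z.
  move=> Az; rewrite /F /vn; apply: vcts_sum => i.
  apply: vcts_cabs; apply/continuous_cabsP => e e0.
  have zr : vn (z - x) < rho0 by move: Az; rewrite /A /=; move: rp rr; lra.
  have [G _] := grad_differentiable (gD zr i).
  move/differentiable_continuous : G => /continuous_cabsP/(_ e e0); apply: filterS => w.
  by rewrite !mxE (_ : g i w - _ - _ = g i w - g i z)//; ring.
have A0 : A x by rewrite /A /= subrr vn0 divr_ge0// ltW.
have [|z Az zmin] := vmin cA _ cF; first by exists x.
have Fx : F x = vn v by rewrite /F opprD addrA subrr add0r vnN.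
have zx := zmin x A0; rewrite Fx in zx.
have xr : vn (x - x) < rho by rewrite subrr vn0.
have zr : vn (z - x) < rho by move: Az; rewrite /A /=; move: rp; lra.
have zint : vn (z - x) < rho / 2.
  have := grow_lip xr zr.
  have := vnD (grow z - (grow x + v)) v; rewrite opprD addrA subrK -/(F z).
  move: zx vr rp; rewrite /F opprD addrA; lra.
exists z; first exact: ltW.
pose e := grow z - (grow x + v).
have [E|E] := eqVneq (vn e) 0; first by apply/eqP; rewrite -subr_eq0; apply/eqP; exact: vn_eq0.
exfalso; have e0 : 0 < vn e by rewrite lt_neqAle eq_sym E vn_ge0.
pose s : R := Num.min 1 ((rho / 2 - vn (z - x)) / vn e).
have s0 : 0 < s by rewrite lt_min ltr01 divr_gt0// subr_gt0.
have s1 : s <= 1 by rewrite ge_min lexx.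
have se : s * vn e <= rho / 2 - vn (z - x).
  by rewrite -ler_pdivlMr// ge_min lexx orbT.
pose h := - (s%:C%C *: e).
have vh : vn h = s * vn e by rewrite vnN vnZ cabsR ger0_norm// ltW.
have zh : A (z + h).
  rewrite /A /= (_ : z + h - x = (z - x) + h); last by rewrite addrAC.
  by apply: (le_trans (vnD _ _)); rewrite vh; move: se; lra.
have zhr : vn (z + h - x) < rho by move: zh; rewrite /A /=; move: rp; lra.
have := zmin _ zh; rewrite /F.
rewrite (_ : grow (z + h) - (grow x + v) = (1 - s)%:C%C *: e + (grow (z + h) - grow z - h)); last first.
  by rewrite /h /e rmorphB rmorph1; apply/rowP => i; rewrite !mxE; ring.
have := vnD ((1 - s)%:C%C *: e) (grow (z + h) - grow z - h).
have := contr zr zhr; rewrite vh vnZ cabsR ger0_norm ?subr_ge0// -/e.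
have : 0 < s * vn e by rewrite mulr_gt0.
rewrite mulrBl mul1r; lra.
Qed.

End NearIdentity.

(** The curves are straight lines in the chart [f]. They exist for [cabs t < 8], the room that
    [identity_disc] demands, and reach any given nearby point at [t = 1]. Composing [f] with the
    inverse of its Jacobian at [x] reduces to a map close to the identity. *)
Lemma inverse_curve (U : set (CN R N)) (f : 'I_N -> CN R N -> CC R) x (rho0 : R) :
  open U -> U x -> (forall i, holomorphic_on U (f i)) -> \det (Jac f x) != 0 -> 0 < rho0 ->
  exists rho eta : R, [/\ 0 < rho <= rho0, 0 < eta,
    (forall z, vn (z - x) < rho -> U z /\ \det (Jac f z) != 0) &
    forall u, vn u < eta -> exists phi : CC R -> CN R N, [/\ phi 0 = x,
      (forall t, cabs t < 8 -> [/\ vn (phi t - x) < rho,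
         (forall i, f i (phi t) = f i x + t * u ord0 i) &
         exists2 d, vdif phi t d & forall i, \sum_j Jac f (phi t) i j * d ord0 j = u ord0 i]) &
      forall z, vn (z - x) < rho -> (forall i, f i z = f i x + u ord0 i) -> phi 1 = z]].
Proof.
move=> oU Ux hf dJ rho00.
have [d1 d10 dU] := open_vn oU Ux.
have hdet : holomorphic_on U (fun z => \det (Jac f z)).
  by apply: hol_det => i j; exact: holomorphic_pd.
have [d2 d20 hd2] : exists2 d2 : R, 0 < d2 & forall z, vn (z - x) < d2 -> \det (Jac f z) != 0.
  have p0 : 0 < cabs (\det (Jac f x)) by rewrite cabs_gt0.
  have := hol_cont Ux hdet; move=> /continuous_cabsP/(_ _ p0)/nbhs_vn[d d0 hd].
  by exists d; [exact: d0|move=> z /hd hz; exact: (near_neq0 hz)].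
pose r1 := Num.min rho0 (Num.min d1 d2).
have r10 : 0 < r1 by rewrite !lt_min rho00 d10.
have r1U z : vn (z - x) < r1 -> U z /\ \det (Jac f z) != 0.
  by rewrite !lt_min => /and3P[_ /dU ? /hd2].
pose J := Jac f x; pose B := invmx J.
have Ju : J \in unitmx by rewrite unitmxE unitfE.
pose g i z := \sum_k B i k * f k z.
pose D i j z := \sum_k B i k * pd j (f k) z.
have gD z : vn (z - x) < r1 -> forall i, grad (g i) z (fun j => D i j z).
  by move=> /r1U[Uz _] i; apply: grad_sum => k; exact: hol_grad (hf k).
have cD i j : {for x, continuous (D i j)}.
  apply: (hol_cont Ux); apply: hol_sum => k; apply: holM; first exact: hol_cst.
  exact: holomorphic_pd.
have Dx i j : D i j x = (i == j)%:R.
  have := mulVmx Ju => /matrixP/(_ i j); rewrite !mxE => <-.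
  by apply: eq_bigr => k _; rewrite mxE.
have [rho /[dup] rhoP /andP[rp rr1] contr] := near_identity r10 gD cD Dx.
pose Cb := \sum_i \sum_k cabs (B i k).
have Cb0 : 0 <= Cb by apply: sumr_ge0 => i _; apply: sumr_ge0 => k _; exact: cabs_ge0.
pose G := grow g.
have GE z i : G z ord0 i = \sum_k B i k * f k z by rewrite mxE.
have fE z i : f i z = \sum_k J i k * G z ord0 k.
  have := mulmxV Ju => JB.
  transitivity ((J *m (B *m (\col_k f k z))) i ord0); last first.
    rewrite mxE; apply: eq_bigr => k _; congr (_ * _); rewrite GE [LHS]mxE.
    by apply: eq_bigr => l _; congr (_ * _); rewrite mxE.
  by rewrite mulmxA JB mul1mx mxE.
pose V u : CN R N := \row_i \sum_k B i k * u ord0 k.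
have Vn u : vn (V u) <= Cb * vn u.
  rewrite /vn /Cb mulr_suml; apply: ler_sum => i _; rewrite mxE.
  apply: (le_trans (cabs_sum _ _ _)); rewrite mulr_suml; apply: ler_sum => k _.
  by rewrite cabsM ler_wpM2l ?cabs_ge0// cabs_le_vn.
have VE t u i : (t *: V u) ord0 i = \sum_k B i k * (t * u ord0 k).
  by rewrite !mxE mulr_sumr; apply: eq_bigr => k _; ring.
have Gf z u t : G z = G x + t *: V u <-> forall i, f i z = f i x + t * u ord0 i.
  split=> [E i|E].
    rewrite (fE z) (fE x) E.
    rewrite (eq_bigr (fun k => J i k * G x ord0 k + J i k * (t *: V u) ord0 k)); last first.
      by move=> k _; rewrite -mulrDr; congr (_ * _); rewrite mxE.
    rewrite big_split /=; congr (_ + _).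
    transitivity ((J *m (B *m (\col_k (t * u ord0 k)))) i ord0); last by rewrite mulmxA mulmxV// mul1mx mxE.
    rewrite [RHS]mxE; apply: eq_bigr => k _; congr (_ * _); rewrite VE [RHS]mxE; apply: eq_bigr => l _; congr (_ * _); by rewrite mxE.
  apply/rowP => i; rewrite [RHS]mxE VE !GE -big_split; apply: eq_bigr => k _ /=.
  by rewrite E mulrDr.
(* With [cabs t < 8] and [vn (V u) <= Cb * vn u], this makes [vn (t *: V u) < rho / 8], as
   [grow_surj] requires. *)
exists rho, (rho / (64 * (Cb + 1))); split.
- by rewrite rp (le_trans rr1)// ge_min lexx.
- by rewrite divr_gt0// mulr_gt0// ltr_wpDl.
- by move=> z zr; apply: r1U; exact: lt_le_trans rr1.
move=> u ur.
have tV t : cabs t < 8 -> vn (t *: V u) < rho / 8.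
  move=> t8; rewrite vnZ; apply: (@le_lt_trans _ _ (8 * (Cb * vn u))).
    by apply: ler_pM; rewrite ?cabs_ge0 ?vn_ge0// ltW.
  move: ur; rewrite ltr_pdivlMr ?mulr_gt0 ?ltr_wpDl// => ur.
  have := vn_ge0 u; move: ur; rewrite mulrCA mulrDr mulr1; rewrite [Cb * _]mulrC; lra.
have /choice[phi phiP] (t : CC R) : exists z, cabs t < 8 -> vn (z - x) <= rho / 2 /\ G z = G x + t *: V u.
  have [t8|t8] := ltP (cabs t) 8; last by exists x.
  by have [z z1 z2] := grow_surj gD rhoP contr (tV _ t8); exists z.
have inj z w : vn (z - x) < rho -> vn (w - x) < rho -> G z = G w -> w = z.
  move=> zr wr E; have := grow_lip contr zr wr; rewrite -/G E subrr vn0 mulr0 => h.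
  by apply/eqP; rewrite -subr_eq0; apply/eqP/vn_eq0/le_anti; rewrite h vn_ge0.
have pr t : cabs t < 8 -> vn (phi t - x) < rho.
  by move=> /phiP[h _]; move: h rp; lra.
have x0 : vn (x - x) < rho by rewrite subrr vn0.
have z8 : cabs (0 : CC R) < 8 by rewrite cabs0; lra.
have o8 : cabs (1 : CC R) < 8 by rewrite cabs1; lra.
exists phi; split.
- apply: inj => //; first exact: pr.
  by have [_ ->] := phiP _ z8; rewrite scale0r addr0.
- move=> t t8; split; [exact: pr|by apply/Gf; have [] := phiP _ t8|].
  set z := phi t; have [Uz dz] := r1U z (lt_le_trans (pr t t8) rr1).
  have Jzu : Jac f z \in unitmx by rewrite unitmxE unitfE.
  pose I := invmx (Jac f z).
  pose d : CN R N := \row_i \sum_l I i l * u ord0 l.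
  exists d; last first.
    move=> i; transitivity ((Jac f z *m (I *m (\col_l u ord0 l))) i ord0); last by rewrite mulmxA mulmxV// mul1mx mxE.
    rewrite [RHS]mxE; apply: eq_bigr => j _; congr (_ * _); rewrite [LHS]mxE [RHS]mxE; apply: eq_bigr => l _; congr (_ * _); by rewrite mxE.
  move=> i e e0.
  pose S := \sum_l cabs (I i l).
  have S0 : 0 <= S by apply: sumr_ge0 => l _; exact: cabs_ge0.
  pose L := 2 * vn (V u) + 1.
  have L0 : 0 < L by rewrite /L ltr_wpDl// mulr_ge0// vn_ge0.
  have [d3 d30 hd3] : exists2 d3 : R, 0 < d3 & forall l h, vn h < d3 ->
      cabs (f l (z + h) - f l z - \sum_j pd j (f l) z * h ord0 j) <= e / (S + 1) / L * vn h.
    apply: fin_delta; first by move=> l a b _ ba H h hb; apply: H; exact: lt_le_trans ba.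
    by move=> l; apply: (hol_grad Uz (hf l)); rewrite !divr_gt0// ltr_wpDl.
  exists (Num.min (8 - cabs t) (d3 / L)); first by rewrite lt_min subr_gt0 t8 divr_gt0.
  move=> h; rewrite lt_min => /andP[h8]; rewrite ltr_pdivlMr// => h3.
  have th8 : cabs (t + h) < 8 by apply: (le_lt_trans (cabsD _ _)); move: h8; lra.
  pose k := phi (t + h) - phi t.
  have kn : vn k <= cabs h * L.
    have := grow_lip contr (pr t t8) (pr _ th8); rewrite -/G -/k.
    have [_ ->] := phiP _ th8; have [_ ->] := phiP _ t8.
    rewrite (_ : _ - _ = h *: V u); last by rewrite opprD addrACA subrr add0r -scalerBl [t + h]addrC addrK.
    rewrite vnZ; move/le_trans; apply; rewrite /L mulrCA mulrDr mulr1 lerDl cabs_ge0//.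
  have zk : z + k = phi (t + h) by rewrite /k /z [z + _]addrC subrK.
  have fk l : f l (z + k) - f l z = h * u ord0 l.
    rewrite zk; have /Gf E1 := (phiP _ th8).2; have /Gf E2 := (phiP _ t8).2.
    by rewrite E1 /z E2; ring.
  pose o l := h * u ord0 l - \sum_j pd j (f l) z * k ord0 j.
  have ol l : cabs (o l) <= e / (S + 1) / L * vn k.
    by rewrite /o -fk; apply: hd3; exact: le_lt_trans kn h3.
  have kE : k ord0 i = \sum_l I i l * (\sum_j pd j (f l) z * k ord0 j).
    transitivity ((I *m (Jac f z *m k^T)) i ord0); first by rewrite mulmxA mulVmx// mul1mx [RHS]mxE.
    rewrite [LHS]mxE; apply: eq_bigr => l _; congr (_ * _); rewrite [LHS]mxE; apply: eq_bigr => j _; congr (_ * _); by rewrite mxE.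
  rewrite (_ : _ - _ = - \sum_l I i l * o l); last first.
    rewrite (_ : phi (t + h) ord0 i - phi t ord0 i = k ord0 i); last by rewrite !mxE.
    rewrite kE /o [d ord0 i]mxE mulr_suml -sumrB -sumrN; apply: eq_bigr => l _; by ring.
  rewrite cabsN; apply: (le_trans (cabs_sum _ _ _)).
  apply: (@le_trans _ _ (S * (e / (S + 1) / L * (cabs h * L)))).
    rewrite /S mulr_suml; apply: ler_sum => l _; rewrite cabsM ler_wpM2l ?cabs_ge0//.
    apply: (le_trans (ol l)); apply: ler_wpM2l => //.
    by apply: divr_ge0; [apply: divr_ge0; [exact: ltW|exact: addr_ge0]|exact: ltW].
  rewrite (_ : S * _ = e * cabs h * (S / (S + 1))); last first.
    have S1 : S + 1 != 0 by apply: lt0r_neq0; rewrite ltr_wpDl.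
    have L1 : L != 0 by exact: lt0r_neq0.
    by move: (L) L1 S1 => L' L1 S1; field; rewrite ?S1 ?L1.
  by rewrite ler_piMr ?mulr_ge0 ?cabs_ge0 ?(ltW e0)// ler_pdivrMr ?ltr_wpDl// mul1r lerDl.
- move=> z zr zE; have [_ E] := phiP _ o8.
  apply: inj => //; first exact: pr.
  by rewrite E; apply/Gf => i; rewrite mul1r.
Qed.

End InverseFunction.

(** * Second order expansions and averages over four points of a circle *)

Section SecondOrder.
Variable R : realType.
Implicit Types (b : CC R -> CC R) (t : CC R) (s : R).

Lemma cts_comp b (p : CC R -> CC R) t : cts p t -> cts b (p t) -> cts (fun w => b (p w)) t.
Proof.
move=> hp hb e /hb[d d0 hd]; have [d' d'0 hd'] := hp d d0.
by exists d' => // w /hd' /hd.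
Qed.

Lemma cdif_scale b t c l : cdif b (t * c) l -> cdif (fun w => b (w * c)) t (l * c).
Proof.
move=> /cdif_car[p [cp <-] bE]; apply/cdif_car; exists (fun w => p (w * c) * c).
  split => //; apply: ctsM; last exact: cts_cst.
  by apply: (@cts_comp p (fun w => w * c)) => //; apply: ctsM; [exact: cts_id|exact: cts_cst].
by move=> w; rewrite bE -mulrBl; ring.
Qed.

(** Seen as a function on [C^1], [b] has a differentiable derivative by [holomorphic_pd]; the mean
    value inequality integrates the first order expansion of that derivative. *)
Lemma second_order b c1 : (forall t, cabs t < 8 -> exists l, cdif b t l) -> cdif b 0 c1 ->
  exists c2, forall e : R, 0 < e -> exists2 d : R, 0 < d & forall t, cabs t < d ->
    cabs (b t - b 0 - c1 * t - c2 * t ^+ 2) <= e * cabs t ^+ 2.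
Proof.
move=> hb hc1.
pose f (z : CN R 1) := b (z ord0 ord0).
pose U := [set z : CN R 1 | vn z < 8].
have vn1 (z : CN R 1) : vn z = cabs (z ord0 ord0) by rewrite /vn big_ord1.
have oU : open U.
  apply: vn_open => z zU; exists (8 - vn z); first by rewrite subr_gt0.
  move=> w wz; rewrite /U /= -(subrK z w); apply: (le_lt_trans (vnD _ _)); move: wz; lra.
have gf (z : CN R 1) l : cdif b (z ord0 ord0) l -> grad f z (fun=> l).
  move=> h e /h[d d0 hd]; exists d => // k kd; rewrite vn1 in kd *.
  by rewrite big_ord1 /f mxE; exact: hd.
have hf : holomorphic_on U f.
  move=> z zU; have [|l hl] := hb (z ord0 ord0); first by rewrite -vn1.
  by have [] := grad_differentiable (gf z l hl).
have pf (z : CN R 1) l : cdif b (z ord0 ord0) l -> pd ord0 f z = l.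
  by move=> /gf h; have [_ ->] := grad_differentiable h.
have U0 : U 0 by rewrite /U /= vn0; lra.
have := hol_grad U0 (holomorphic_pd ord0 oU hf); set G := fun i => _ => hG.
have p0 : pd ord0 f 0 = c1 by apply: pf; rewrite mxE.
exists (G ord0 / 2) => e e0; have [d d0 hd] := hG (e / 2) ltac:(by rewrite divr_gt0).
exists (Num.min d 8); first by rewrite lt_min d0; lra.
move=> t; rewrite lt_min => /andP[td t8].
have /choice[D DP] (s : R) : exists l, `|s| <= 1 -> cdif b (s%:C%C * t) l.
  have [s1|s1] := leP `|s| 1; last by exists 0.
  have [|l hl] := hb (s%:C%C * t); last by exists l.
  by apply: le_lt_trans t8; rewrite cabsM cabsR ler_piMl ?cabs_ge0.
have := @mean_value_cabs R (fun w => b (w * t) + (- c1 * t) * w + (- (G ord0 / 2 * t ^+ 2)) * (w * w))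
  (fun s => (D s - c1 - G ord0 * (s%:C%C * t)) * t) (e / 2 * cabs t ^+ 2).
have s01 (s : R) : 0 <= s <= 1 -> `|s| <= 1.
  by move=> /andP[a c]; rewrite ger0_norm.
rewrite !mul1r !mul0r !mulr0 !addr0 !mulr1 => H.
have := H _ _; rewrite (_ : _ - b 0 = b t - b 0 - c1 * t - G ord0 / 2 * t ^+ 2); last by ring.
move=> {H} /(_ _ _) H; apply: le_trans (H _ _) _.
- move=> s /s01 s1.
  rewrite (_ : (D s - _ - _) * t = D s * t + (- c1 * t) * 1 + (- (G ord0 / 2 * t ^+ 2)) * (1 * s%:C%C + s%:C%C * 1)); last by field.
  apply: cdifD; first apply: cdifD.
  + by apply: cdif_scale; exact: DP.
  + have := cdifM (cdif_cst (- c1 * t) s%:C%C) (cdif_id s%:C%C).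
    by rewrite mul0r add0r.
  + have := cdifM (cdif_cst (- (G ord0 / 2 * t ^+ 2)) s%:C%C) (cdifM (cdif_id s%:C%C) (cdif_id s%:C%C)).
    by rewrite mul0r add0r.
- move=> s /s01 s1; pose h : CN R 1 := const_mx (s%:C%C * t).
  have hh : h ord0 ord0 = s%:C%C * t by rewrite mxE.
  have vh : vn h <= cabs t by rewrite vn1 hh cabsM cabsR ler_piMl ?cabs_ge0.
  have := hd h (le_lt_trans vh td); rewrite add0r big_ord1 p0 hh.
  rewrite (pf h (D s)); last by rewrite hh; exact: DP.
  move=> H2; rewrite cabsM expr2 mulrA; apply: ler_wpM2r; first exact: cabs_ge0.
  apply: (le_trans H2); apply: ler_wpM2l vh; lra.
- by rewrite mulrA; apply: ler_wpM2r; [rewrite exprn_ge0 ?cabs_ge0|lra].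
Qed.

Definition o2 (E : R -> R) := forall e : R, 0 < e -> exists2 d : R, 0 < d &
  forall s, 0 < s < d -> `|E s| <= e * s ^+ 2.

Lemma o2D E E' : o2 E -> o2 E' -> o2 (fun s => E s + E' s).
Proof.
move=> h h' e e0; have [d d0 hd] := h (e / 2) ltac:(by rewrite divr_gt0).
have [d' d'0 hd'] := h' (e / 2) ltac:(by rewrite divr_gt0).
exists (Num.min d d'); first by rewrite lt_min d0.
move=> s /andP[s0]; rewrite lt_min => /andP[sd sd'].
apply: (le_trans (ler_normD _ _)).
have := hd s; have := hd' s; rewrite s0 sd sd' => /(_ isT) a /(_ isT) c; move: a c; lra.
Qed.

Lemma o2Z c E : o2 E -> o2 (fun s => c * E s).
Proof.
move=> h e e0; have c0 : 0 < `|c| + 1 by rewrite ltr_wpDl.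
have [d d0 hd] := h (e / (`|c| + 1)) ltac:(by rewrite divr_gt0).
exists d => // s /hd H; rewrite normrM.
apply: (@le_trans _ _ (`|c| * (e / (`|c| + 1) * s ^+ 2))); first exact: ler_wpM2l.
rewrite mulrA ler_wpM2r ?sqr_ge0// mulrA ler_pdivrMr// mulrC ler_wpM2l ?(ltW e0)//.
by rewrite lerDl.
Qed.

Lemma o2_sum (I : Type) (r : seq I) (E : I -> R -> R) : (forall i, o2 (E i)) ->
  o2 (fun s => \sum_(i <- r) E i s).
Proof.
move=> h; elim: r => [|i r ih].
  move=> e e0; exists 1 => // s _; rewrite big_nil normr0 mulr_ge0 ?sqr_ge0// ltW//.
rewrite (_ : (fun s => _) = (fun s => E i s + \sum_(i <- r) E i s)); first exact: o2D.
by apply/funext => s; rewrite big_cons.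
Qed.

(** Four equally spaced points on a circle already detect the Laplacian to second order, so no
    circle integrals are needed for subharmonicity. *)
Definition four (u : CC R -> R) s : R :=
  u s%:C%C + u (ii R * s%:C%C) + u (- s%:C%C) + u (- (ii R * s%:C%C)).

Lemma cabs_ii : cabs (ii R) = 1.
Proof. by rewrite /cabs /= expr0n expr1n /= add0r sqrtr1. Qed.

Lemma ii2 : ii R * ii R = -1.
Proof. by apply/eqP; rewrite eq_complex /=; apply/andP; split; apply/eqP; ring. Qed.

(** The mixed terms cancel because both [t] and [t ^+ 2] sum to 0 over the four points. *)
Lemma four_quad (c0 c1 c2 : CC R) s :
  four (fun t => cabs (c0 + c1 * t + c2 * t ^+ 2) ^+ 2) s =
  4 * cabs c0 ^+ 2 + 4 * cabs c1 ^+ 2 * s ^+ 2 + 4 * cabs c2 ^+ 2 * s ^+ 4.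
Proof.
rewrite /four !cabs_sqr; case: c0 => a0 b0; case: c1 => a1 b1; case: c2 => a2 b2.
by rewrite /= ; ring.
Qed.

Lemma four_pts s t : 0 < s -> [|| t == s%:C%C, t == ii R * s%:C%C, t == - s%:C%C | t == - (ii R * s%:C%C)] ->
  cabs t = s.
Proof.
by move=> s0 /or4P[]/eqP->; rewrite ?cabsN ?cabsM ?cabs_ii ?mul1r cabsR gtr0_norm.
Qed.

Lemma four_close (u v : CC R -> R) s (e : R) : 0 < s -> (forall t, cabs t = s -> `|u t - v t| <= e) ->
  `|four u s - four v s| <= 4 * e.
Proof.
move=> s0 h; rewrite /four.
have h1 : `|u s%:C%C - v s%:C%C| <= e by apply: h; apply: (four_pts s0); rewrite eqxx.
have h2 : `|u (ii R * s%:C%C) - v (ii R * s%:C%C)| <= e by apply: h; apply: (four_pts s0); rewrite eqxx orbT.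
have h3 : `|u (- s%:C%C) - v (- s%:C%C)| <= e by apply: h; apply: (four_pts s0); rewrite eqxx !orbT.
have h4 : `|u (- (ii R * s%:C%C)) - v (- (ii R * s%:C%C))| <= e by apply: h; apply: (four_pts s0); rewrite eqxx !orbT.
move: h1 h2 h3 h4; rewrite !ler_norml => /andP[a1 b1] /andP[a2 b2] /andP[a3 b3] /andP[a4 b4].
by apply/andP; split; lra.
Qed.

Lemma four_sq b c1 : (forall t, cabs t < 8 -> exists l, cdif b t l) -> cdif b 0 c1 ->
  o2 (fun s => four (fun t => cabs (b t) ^+ 2) s - 4 * cabs (b 0) ^+ 2 - 4 * cabs c1 ^+ 2 * s ^+ 2).
Proof.
move=> hb hc; have [c2 H] := second_order hb hc.
move=> e e0.
pose B := cabs (b 0) + cabs c1 + cabs c2 + 1.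
have B1 : 1 <= B by rewrite /B; have := cabs_ge0 (b 0); have := cabs_ge0 c1; have := cabs_ge0 c2; lra.
pose e1 := Num.min 1 (e / (24 * B)).
have e10 : 0 < e1 by rewrite lt_min ltr01 divr_gt0// mulr_gt0//; lra.
have e1B : 12 * B * e1 <= e / 2.
  have : e1 <= e / (24 * B) by rewrite ge_min lexx orbT.
  rewrite ler_pdivlMr; last by rewrite mulr_gt0//; lra.
  by rewrite mulrC; lra.
have [d d0 hd] := H e1 e10.
pose C := 8 * cabs c2 ^+ 2 + 1.
have C0 : 0 < C by rewrite /C ltr_wpDl// mulr_ge0// sqr_ge0.
exists (Num.min (Num.min d 1) (e / C)); first by rewrite !lt_min d0 ltr01 divr_gt0.
move=> s /andP[s0]; rewrite !lt_min => /andP[/andP[sd s1] se].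
pose P t := b 0 + c1 * t + c2 * t ^+ 2.
have PB t : cabs t = s -> cabs (P t) <= B.
  move=> ts; apply: (le_trans (cabsD _ _)); rewrite cabsM cabsX ts.
  have := cabsD (b 0) (c1 * t); rewrite cabsM ts.
  have : cabs c1 * s <= cabs c1 by rewrite ler_piMr ?cabs_ge0// ltW.
  have : cabs c2 * s ^+ 2 <= cabs c2 by rewrite ler_piMr ?cabs_ge0// exprn_ile1// ltW.
  rewrite /B; lra.
have bP t : cabs t = s -> `|cabs (b t) ^+ 2 - cabs (P t) ^+ 2| <= 3 * B * e1 * s ^+ 2.
  move=> ts; have r1 : cabs (b t - P t) <= e1 * s ^+ 2.
    rewrite (_ : b t - P t = b t - b 0 - c1 * t - c2 * t ^+ 2); last by rewrite /P; ring.
    by have := hd t; rewrite ts; apply.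
  have r2 : e1 * s ^+ 2 <= 1.
    by rewrite mulr_ile1 ?sqr_ge0 ?(ltW e10)// ?exprn_ile1 ?(ltW s0) ?(ltW s1)// ge_min lexx.
  have r3 := PB t ts; have r4 : cabs (b t) <= B + 1.
    by have := cabsBr (b t) (P t); lra.
  rewrite subr_sqr normrM.
  have n1 : `|cabs (b t) - cabs (P t)| <= e1 * s ^+ 2.
    apply: le_trans r1; rewrite ler_norml; apply/andP; split; last exact: cabsBr.
    by have := cabsBr (P t) (b t); rewrite cabsB; lra.
  have n2 : `|cabs (b t) + cabs (P t)| <= 3 * B.
    by rewrite ger0_norm ?addr_ge0 ?cabs_ge0//; lra.
  rewrite (_ : 3 * B * e1 * s ^+ 2 = (e1 * s ^+ 2) * (3 * B)); last by ring.
  by apply: ler_pM.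
have := four_close s0 bP; rewrite /P four_quad => K.
have s2 : 0 <= s ^+ 2 by exact: sqr_ge0.
have q1 : 4 * cabs c2 ^+ 2 * s ^+ 4 <= e / 2 * s ^+ 2.
  rewrite (_ : s ^+ 4 = s ^+ 2 * s ^+ 2); last by ring.
  rewrite mulrA; apply: ler_wpM2r => //.
  apply: (@le_trans _ _ (4 * cabs c2 ^+ 2 * s)).
    apply: ler_wpM2l; first by rewrite mulr_ge0// sqr_ge0.
    by rewrite expr2 ler_piMl// ltW.
  move: se; rewrite ltr_pdivlMr// /C mulrDr mulr1 => se.
  have : 0 < s by []. move: se; rewrite [s * _]mulrC; lra.
have q0 : 0 <= 4 * cabs c2 ^+ 2 * s ^+ 4 
  by apply: mulr_ge0; [apply: mulr_ge0 => //; exact: sqr_ge0|apply: exprn_ge0; exact: ltW].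
have q2 : 4 * (3 * B * e1 * s ^+ 2) <= e / 2 * s ^+ 2.
  rewrite (_ : 4 * (3 * B * e1 * s ^+ 2) = 12 * B * e1 * s ^+ 2); last by ring.
  exact: ler_wpM2r.
move: K; rewrite !ler_norml => /andP[k1 k2]; apply/andP; split; lra.
Qed.

(** The product over the four rotations is a holomorphic function of [t] invariant under
    multiplication by [ii], hence has no terms of degree 1 and 2. It plays the role of the
    harmonicity of log|b|. *)
Lemma four_prod b : (forall t, cabs t < 8 -> exists l, cdif b t l) ->
  o2 (fun s => cabs (b s%:C%C * b (ii R * s%:C%C) * b (- s%:C%C) * b (- (ii R * s%:C%C)) - b 0 ^+ 4)).
Proof.
move=> hb.
pose B t := b (t * 1) * b (t * ii R) * b (t * -1) * b (t * - ii R).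
have hB t : cabs t < 8 -> exists l, cdif B t l.
  move=> t8.
  have [l1 h1] := hb (t * 1) ltac:(by rewrite mulr1).
  have [l2 h2] := hb (t * ii R) ltac:(by rewrite cabsM cabs_ii mulr1).
  have [l3 h3] := hb (t * -1) ltac:(by rewrite cabsM cabsN cabs1 mulr1).
  have [l4 h4] := hb (t * - ii R) ltac:(by rewrite cabsM cabsN cabs_ii mulr1).
  eexists; rewrite /B; apply: cdifM; last exact: cdif_scale h4.
  apply: cdifM; last exact: cdif_scale h3.
  apply: cdifM; last exact: cdif_scale h2.
  exact: cdif_scale h1.
have [|c1 hc1] := hB 0; first by rewrite cabs0; lra.
have [c2 H] := second_order hB hc1.
have B0 : B 0 = b 0 ^+ 4 by rewrite /B !mul0r; ring.
have Bi t : B (t * ii R) = B t.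
  have e1 : t * ii R * ii R = t * -1 by rewrite -mulrA ii2.
  have e2 : t * ii R * -1 = t * - ii R by ring.
  have e3 : t * ii R * - ii R = t * 1 by rewrite mulrN -mulrA ii2; ring.
  rewrite /B e1 e2 e3 mulr1 -[t * 1]/(t * 1) mulr1; ring.
move=> e e0; have [d d0 hd] := H e e0; exists d => // s /andP[s0 sd].
rewrite ger0_norm ?cabs_ge0//.
pose t : CC R := s%:C%C.
have ts : cabs t = s by rewrite cabsR gtr0_norm.
have E : b s%:C%C * b (ii R * s%:C%C) * b (- s%:C%C) * b (- (ii R * s%:C%C)) = B t.
  by rewrite /B /t mulr1 mulrN1 mulrN [_ * ii R]mulrC.
rewrite E -B0.
have h0 := hd t; have h1 := hd (t * ii R); have h2 := hd (t * ii R * ii R); have h3 := hd (t * ii R * ii R * ii R).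
rewrite !cabsM !cabs_ii !mulr1 ts !Bi in h0 h1 h2 h3.
move: (h0 sd) (h1 sd) (h2 sd) (h3 sd) => {h0 h1 h2 h3}.
set A0 := _ - _; set A1 := _ - _; set A2 := _ - _; set A3 := _ - _ => h0 h1 h2 h3.
(* By the invariance all four expansions have the same left-hand side, while the terms in [c1] and
   [c2] sum to 0. *)
have Esum : 4 * (B t - B 0) = A0 + A1 + A2 + A3.
  rewrite /A0 /A1 /A2 /A3.
  have i2 : ii R ^+ 2 = -1 by rewrite expr2 ii2.
  rewrite !exprMn !i2 -[t * ii R * ii R]mulrA ii2; ring.
have : cabs (4 * (B t - B 0)) <= 4 * (e * s ^+ 2).
  rewrite Esum; have := cabsD (A0 + A1 + A2) A3; have := cabsD (A0 + A1) A2; have := cabsD A0 A1.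
  by move: h0 h1 h2 h3; lra.
rewrite cabsM (_ : cabs (4 : CC R) = 4); last first.
  by rewrite -[4 : CC R](rmorph_nat (real_complex R)) cabsR ger0_norm.
by rewrite ler_pM2l.
Qed.

End SecondOrder.

(** * Cramer's rule for directional derivatives *)

Section Cramer.
Variable (K : fieldType).

Definition rowrep N (J : 'M[K]_N) (i : 'I_N) (w : 'I_N -> K) : 'M[K]_N :=
  \matrix_(a, b) if a == i then w b else J a b.

Lemma cofactor_rowrep N (J : 'M[K]_N) i w j : cofactor (rowrep J i w) i j = cofactor J i j.
Proof.
rewrite /cofactor; congr (_ * \det _); apply/matrixP => a b; rewrite !mxE.
by rewrite eq_sym (negbTE (neq_lift _ _)).
Qed.

(** To be read with [J] the Jacobian of a chart [f], [d] the velocity of a curve, [u] its velocity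
    in the chart and [w] the differential of a function [e]: the derivative of [e] along the curve
    is a combination of determinants, up to the factor [\det J]. *)
Lemma cramer_sum N (J : 'M[K]_N) (d u w : 'I_N -> K) :
  (forall i, \sum_j J i j * d j = u i) ->
  \det J * (\sum_j w j * d j) = \sum_i u i * \det (rowrep J i w).
Proof.
move=> Jd.
have dE j : \det J * d j = \sum_i cofactor J i j * u i.
  have := mul_adj_mx J => /matrixP H.
  transitivity (\sum_k (\sum_i cofactor J i j * J i k) * d k); last first.
    under eq_bigr do rewrite mulr_suml.
    rewrite exchange_big /=; apply: eq_bigr => i _; rewrite -Jd mulr_sumr.
    by apply: eq_bigr => k _; rewrite mulrA.
  rewrite (bigD1 j)//= [X in _ = _ + X]big1 ?addr0.
    have := H j j; rewrite !mxE eqxx mulr1n => <-; congr (_ * _).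
    by apply: eq_bigr => i _; rewrite !mxE.
  move=> k kj; have := H j k; rewrite !mxE eq_sym (negbTE kj) mulr0n => E.
  rewrite (_ : \sum_i _ = 0) ?mul0r//; rewrite -[RHS]E; apply: eq_bigr => i _; by rewrite !mxE.
rewrite mulr_sumr; under eq_bigr do rewrite mulrCA dE mulr_sumr.
rewrite exchange_big /=; apply: eq_bigr => i _.
rewrite (expand_det_row _ i) mulr_sumr; apply: eq_bigr => j _.
by rewrite cofactor_rowrep mxE eqxx; ring.
Qed.

Lemma big_supp N (A : {set 'I_N}) (u F : 'I_N -> K) : (forall i, i \in A -> u i = 0) ->
  \sum_i u i * F i = \sum_(i | i \notin A) u i * F i.
Proof.
move=> uA; rewrite (bigID (fun j => j \in A)) /= big1 ?add0r// => i /uA ->.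
by rewrite mul0r.
Qed.

End Cramer.

(** * Peak sets on which V is given by coordinate functions *)

Section LocalStructure.
Variables (R : realType) (N : nat) (V U W Q : set (CN R N)) (phi0 : CN R N -> R).
Hypotheses (oU : open U) (cQ : compact Q) (QU : Q `<=` U).
Hypotheses (phi0_gt0 : forall z, 0 < phi0 z) (phi0_cts : forall z, vcts phi0 z).
Local Notation hol := (holomorphic_on U).
Implicit Types (h e : CN R N -> CC R) (f : 'I_N -> CN R N -> CC R) (k : nat) (tau : R).

(** The exponent [k] makes the family stable under powers: the [K]-th power of [wval h k] has the
    same form, with [h ^+ K] and [K * k]. *)
Definition wval h k z : R := cabs (h z) * phi0 z ^+ k.
Definition Oset h k tau := [set z | Q z /\ tau < wval h k z].

(** The last two clauses say that values above [tau] occur on [Q], and only inside [W]; a maximum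
    over [Q] then stays away from the boundary. *)
Definition good h k tau := [/\ hol h, (0 < k)%N, 0 < tau,
  (forall z, Q z -> ~ W z -> wval h k z <= tau) & Oset h k tau !=set0].

Definition subst f j e : 'I_N -> CN R N -> CC R := fun i => if i == j then e else f i.

(** Up to the factor [\det (Jac f z)], the partial derivative of [e] with respect to the [j]-th
    coordinate of the chart [f]. *)
Definition sdet f j e z := \det (Jac (subst f j e) z).

(* The f_i with i in A vanish on the part of V where h peaks, and all the f_i form
   local coordinates there; if A is maximal, the f_i with i in A define V there. *)
Definition PA (A : {set 'I_N}) f h k tau := [/\ (forall i, hol (f i)), good h k tau,
  (forall z, Oset h k tau z -> forall i, i \in A -> f i z = 0) &
  (forall z, Oset h k tau z -> \det (Jac f z) != 0)].

Lemma hol_sdet f j e : (forall i, hol (f i)) -> hol e -> hol (sdet f j e).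
Proof.
move=> hf he; apply: hol_det => a b; apply: holomorphic_pd => //.
by rewrite /subst; case: ifP.
Qed.

Lemma val_cts h k z : U z -> hol h -> vcts (wval h k) z.
Proof.
move=> Uz hh; apply: vctsM; last exact: vctsX.
by apply: vcts_cabs; exact: hol_cont hh.
Qed.

Lemma pow_large (a c : R) : 1 < a -> 0 < c -> exists2 K : nat, (0 < K)%N & 1 < a ^+ K * c.
Proof.
move=> a1 c0.
have ber (n : nat) : 1 + n%:R * (a - 1) <= a ^+ n.
  elim: n => [|n ih]; first by rewrite mul0r addr0 expr0.
  rewrite exprS -natr1; have : 0 <= n%:R * (a - 1) * (a - 1) by rewrite !mulr_ge0// subr_ge0 ltW.
  have : a * (1 + n%:R * (a - 1)) <= a * a ^+ n by rewrite ler_wpM2l//; lra.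
  by set x := n%:R; lra.
have [n nP] : exists n : nat, (c * (a - 1))^-1 < n%:R.
  by exists (Num.Def.archi_bound (c * (a - 1))^-1); apply: archi_boundP; rewrite invr_ge0 mulr_ge0 ?subr_ge0// ltW.
exists n.+1 => //; apply: (@lt_le_trans _ _ (a ^+ n * c)); last first.
  by rewrite ler_wpM2r ?(ltW c0)// exprS ler_peMl ?exprn_ge0//; lra.
apply: (@lt_le_trans _ _ (n%:R * (a - 1) * c)).
  move: nP; rewrite -[X in X < _]mul1r ltr_pdivrMr ?mulr_gt0 ?subr_gt0//.
  by rewrite [c * _]mulrC mulrA.
by rewrite ler_wpM2r ?(ltW c0)//; have := ber n; lra.
Qed.

(** [e] becomes the [j]-th coordinate. The new Jacobian may vanish on parts of the old peak set, so
    [h] is raised to a power and multiplied by that Jacobian, normalised to modulus at most 1: the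
    new peak set lies inside the old one and avoids the zeros. *)
Lemma PA_step A f h k tau e j z1 : PA A f h k tau -> hol e ->
  (forall z, Oset h k tau z -> e z = 0) -> j \notin A ->
  Oset h k tau z1 -> sdet f j e z1 != 0 ->
  exists f' h' k' tau', PA (j |: A) f' h' k' tau'.
Proof.
move=> [hf [hh k0 t0 hW hO] fA dJ] he eO jA Oz1 dz1.
have hd : hol (sdet f j e) by exact: hol_sdet.
have [zM QM zMax] : exists2 zM, Q zM & forall z, Q z -> cabs (sdet f j e z) <= cabs (sdet f j e zM).
  apply: (@vmax _ _ Q (fun z => cabs (sdet f j e z))) => //; first by exists z1; case: Oz1.
  by move=> z /QU Uz; apply: vcts_cabs; exact: hol_cont hd.
pose M := cabs (sdet f j e zM) + 1.
have M0 : 0 < M by rewrite ltr_wpDl// cabs_ge0.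
pose dl z := M%:C%C^-1 * sdet f j e z.
have cdl z : cabs (dl z) = M^-1 * cabs (sdet f j e z).
  by rewrite cabsM cabsV cabsR gtr0_norm.
have dl1 z : Q z -> cabs (dl z) <= 1.
  move=> /zMax h1; rewrite cdl mulrC ler_pdivrMr// mul1r; apply: (le_trans h1).
  by rewrite /M lerDl.
have v1 : 1 < wval h k z1 / tau by rewrite ltr_pdivlMr// mul1r; case: Oz1.
have c1 : 0 < cabs (dl z1) by rewrite cdl mulr_gt0 ?invr_gt0// cabs_gt0.
(* A large power of the ratio [wval h k z1 / tau > 1] outweighs the factor [cabs (dl z1)], which
   keeps [z1] in the new peak set. *)
have [K K0 KP] := pow_large v1 c1.
pose h' z := h z ^+ K * dl z.
have valE z : wval h' (K * k)%N z = wval h k z ^+ K * cabs (dl z).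
  by rewrite /wval /h' cabsM cabsX exprMn -exprM [(k * K)%N]mulnC; ring.
have v0 z : 0 <= wval h k z by rewrite mulr_ge0 ?cabs_ge0// exprn_ge0// ltW.
have O'O z : Oset h' (K * k)%N (tau ^+ K) z -> Oset h k tau z /\ sdet f j e z != 0.
  case=> Qz; rewrite valE => tz; split; last first.
    apply: contraTneq tz => z0; rewrite cdl z0 cabs0 !mulr0 -leNgt exprn_ge0// ltW//.
  split => //; rewrite ltNge; apply/negP => le.
  move: tz; rewrite ltNge => /negP; apply.
  apply: (@le_trans _ _ (wval h k z ^+ K)).
    by rewrite ler_piMr ?exprn_ge0// dl1.
  by rewrite lerXn2r// nnegrE// ltW.
exists (subst f j e), h', (K * k)%N, (tau ^+ K); split.
- by move=> i; rewrite /subst; case: ifP.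
- split.
  + by apply: holM; [exact: holX|apply: holM => //; exact: hol_cst].
  + by rewrite muln_gt0 K0.
  + exact: exprn_gt0.
  + move=> z Qz nW; rewrite valE; apply: (@le_trans _ _ (wval h k z ^+ K)).
      by rewrite ler_piMr ?exprn_ge0// dl1.
    by rewrite lerXn2r// ?nnegrE ?hW// ltW.
  + exists z1; split; first by case: Oz1.
    by rewrite valE; move: KP; rewrite exprMn exprVn mulrAC ltr_pdivlMr ?exprn_gt0// mul1r.
- move=> z /O'O[Oz _] i; rewrite !inE /subst => /orP[/eqP->|iA]; first by rewrite eqxx eO.
  by case: eqP => [_|_]; [rewrite eO|exact: fA].
- by move=> z /O'O[].
Qed.

Lemma pd_coord (i j : 'I_N) z : pd j (fun z : CN R N => z ord0 i) z = (i == j)%:R.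
Proof.
have gr : grad (fun z : CN R N => z ord0 i) z (fun j => (i == j)%:R).
  move=> e e0; exists 1 => // h _.
  rewrite (bigD1 i)//= eqxx mul1r big1 ?addr0.
    rewrite mxE (_ : _ + h ord0 i - z ord0 i - _ = 0); last by ring.
    by rewrite cabs0 mulr_ge0 ?vn_ge0// ltW.
  by move=> k; rewrite eq_sym => /negbTE ->; rewrite mul0r.
by have [_ ->] := grad_differentiable gr.
Qed.

Lemma PA_set0 h k tau : good h k tau -> PA finset.set0 (fun i z => z ord0 i) h k tau.
Proof.
move=> g; split => //.
- by move=> i; exact: hol_coord.
- by move=> z _ i; rewrite inE.
- move=> z _; rewrite (_ : Jac _ z = 1%:M) ?det1 ?oner_neq0//.
  by apply/matrixP => i j; rewrite !mxE pd_coord.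
Qed.

(** With [A] of maximal size no [PA_step] is possible. Hence the functions vanishing on the peak set
    are closed under the chart derivatives in the directions outside [A], which is what
    [curve_order] iterates. *)
Lemma PA_max h k tau : good h k tau -> exists A f' h' k' tau', PA A f' h' k' tau' /\
  forall e, hol e -> (forall z, Oset h' k' tau' z -> e z = 0) -> forall j, j \notin A ->
    forall z, Oset h' k' tau' z -> sdet f' j e z = 0.
Proof.
move=> g.
pose P (A : {set 'I_N}) : bool := `[< exists f' h' k' tau', PA A f' h' k' tau' >].
have P0 : P finset.set0 by apply/asboolP; do 4 eexists; exact: PA_set0 g.
case: (@arg_maxnP _ finset.set0 P (fun A => #|A|) P0) => A /asboolP[f' [h' [k' [tau' PAA]]]] Amax.
exists A, f', h', k', tau'; split => // e he eO j jA z Oz; apply: contrapT => /eqP ne.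
have PjA : P (j |: A) by apply/asboolP; exact: (PA_step PAA he eO jA Oz ne).
by have := Amax _ PjA; rewrite /geq /= cardsU1 jA add1n ltnn.
Qed.

End LocalStructure.

(** * Curves along which a class of functions closed under derivatives vanishes *)

Section CurvesInV.
Variables (R : realType) (N : nat) (U : set (CN R N)).
Hypothesis oU : open U.
Variables (f : 'I_N -> CN R N -> CC R) (A : {set 'I_N}) (x : CN R N).
Hypothesis hf : forall i, holomorphic_on U (f i).
Variable I : (CN R N -> CC R) -> Prop.
Hypothesis Ihol : forall e, I e -> holomorphic_on U e.
Hypothesis Ix : forall e, I e -> e x = 0.
Hypothesis Iclosed : forall e, I e -> forall j, j \notin A -> I (sdet f j e).

Variables (u : CN R N) (phi : CC R -> CN R N).
Hypothesis uA : forall i, i \in A -> u ord0 i = 0.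
Hypothesis phi0 : phi 0 = x.
Hypothesis phiU : forall t, cabs t < 8 -> U (phi t).
Hypothesis phiJ : forall t, cabs t < 8 -> \det (Jac f (phi t)) != 0.
Hypothesis phiD : forall t, cabs t < 8 ->
  exists2 d, vdif phi t d & forall i, \sum_j Jac f (phi t) i j * d ord0 j = u ord0 i.

Lemma sdetE (g : 'I_N -> CN R N -> CC R) j (e : CN R N -> CC R) z : sdet g j e z = \det (rowrep (Jac g z) j (fun b => pd b e z)).
Proof.
rewrite /sdet; congr (\det _); apply/matrixP => a b; rewrite !mxE /subst.
by case: eqP.
Qed.

Lemma disc_bound (a : CC R -> R) : (forall t, cabs t <= 4 ->
    forall e : R, 0 < e -> exists2 d : R, 0 < d & forall s, cabs (s - t) < d -> `|a s - a t| < e) ->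
  exists C : R, forall t, cabs t <= 4 -> a t <= C.
Proof.
move=> ca.
have [|||q _ qm] := @compact_EVT_max _ R a [set t : CC R | cabs t <= 4].
- by exists 0 => /=; rewrite cabs0; lra.
- exact: compact_disc.
- apply: continuous_in_subspaceT => t /set_mem /= t4 B /nbhs_ballP[e e0 eB].
  have [d d0 hd] := ca t t4 e e0; apply/nbhs_cabs; exists d => // s /hd h; apply: eB.
  by rewrite /ball /= distrC.
by exists (a q) => t t4; apply: qm; exact: mem_set.
Qed.

Lemma cts_cabs_bound (b : CC R -> CC R) : (forall t, cabs t <= 4 -> cts b t) ->
  exists C : R, forall t, cabs t <= 4 -> cabs (b t) <= C.
Proof.
move=> cb; apply: disc_bound => t /cb ct e /ct[d d0 hd]; exists d => // s /hd; apply: le_lt_trans.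
rewrite ler_norml; apply/andP; split; last exact: cabsBr.
by have := cabsBr (b t) (b s); rewrite cabsB; lra.
Qed.

Lemma curve_cdif e t : holomorphic_on U e -> cabs t < 8 ->
  cdif (fun s => e (phi s)) t ((\det (Jac f (phi t)))^-1 * \sum_(j | j \notin A) u ord0 j * sdet f j e (phi t)).
Proof.
move=> he t8; have [d vd dE] := phiD t8.
have := chain_grad vd (hol_grad (phiU t8) he).
rewrite (_ : \sum_i _ = (\det (Jac f (phi t)))^-1 * \sum_(j | j \notin A) u ord0 j * sdet f j e (phi t))//.
have E := etrans (cramer_sum (fun j => pd j e (phi t)) dE) (big_supp _ uA).
apply: (mulfI (phiJ t8)); apply: (etrans E); rewrite mulrA mulfV ?phiJ// mul1r.
by apply: eq_bigr => j _; congr (_ * _); rewrite sdetE.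
Qed.

(** Induction on [n] for all [e] at once: the derivative of [e] along the curve is a combination of
    the [sdet f j e] with [j] outside [A]. These belong to [I] and vanish to order [n], and
    integrating from [t = 0] gains one order. *)
Lemma curve_order n e : I e -> exists C : R, forall t, cabs t <= 4 -> cabs (e (phi t)) <= C * cabs t ^+ n.
Proof.
have lt8 (t : CC R) : cabs t <= 4 -> cabs t < 8 by lra.
elim: n e => [|n ih] e Ie.
  have [C hC] : exists C : R, forall t, cabs t <= 4 -> cabs (e (phi t)) <= C.
    apply: (@cts_cabs_bound (fun t => e (phi t))) => t /lt8 t8.
    exact: cdif_cts (curve_cdif (Ihol Ie) t8).
  by exists C => t t4; rewrite expr0 mulr1; exact: hC.
have [D hD] : exists D : R, forall t, cabs t <= 4 -> cabs ((\det (Jac f (phi t)))^-1) <= D.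
  apply: (@cts_cabs_bound (fun t => (\det (Jac f (phi t)))^-1)) => t /lt8 t8.
  apply: ctsV; first exact: phiJ.
  have hdet : holomorphic_on U (fun z => \det (Jac f z)).
    by apply: hol_det => i j; exact: holomorphic_pd.
  exact: cdif_cts (curve_cdif hdet t8).
have /choice[C hC] (j : 'I_N) : exists C : R, j \notin A -> forall t, cabs t <= 4 -> cabs (sdet f j e (phi t)) <= C * cabs t ^+ n.
  have [jA|jA] := boolP (j \in A); first by exists 0.
  by have [C hC] := ih _ (Iclosed Ie jA); exists C.
have D0 : 0 <= D by apply: le_trans (cabs_ge0 _) (hD 0 _); rewrite cabs0; lra.
pose S := \sum_(j | j \notin A) cabs (u ord0 j) * C j.
have C0 j : j \notin A -> 0 <= C j.
  move=> jA; have := hC j jA 1; rewrite cabs1 expr1n mulr1 => /(_ _)/(le_trans (cabs_ge0 _)); apply; lra.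
have S0 : 0 <= S by apply: sumr_ge0 => j jA; rewrite mulr_ge0 ?cabs_ge0 ?C0.
exists (2 * (D * S)) => t t4.
have sb (s : R) : 0 <= s <= 1 -> cabs (s%:C%C * t) <= cabs t.
  by move=> /andP[s0 s1]; rewrite cabsM cabsR ger0_norm// ler_piMl ?cabs_ge0.
have := @mean_value_cabs R (fun w => e (phi (w * t)))
  (fun s => ((\det (Jac f (phi (s%:C%C * t))))^-1 * \sum_(j | j \notin A) u ord0 j * sdet f j e (phi (s%:C%C * t))) * t)
  (D * S * cabs t ^+ n * cabs t).
rewrite mul1r mul0r phi0 (Ix Ie) subr0 => H.
rewrite (_ : 2 * (D * S) * cabs t ^+ n.+1 = 2 * (D * S * cabs t ^+ n * cabs t)); last by rewrite exprSr; ring.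
apply: H => s s01; have st := sb s s01; have s4 := le_trans st t4.
  by apply: (@cdif_scale R (fun w => e (phi w))); apply: curve_cdif; [exact: Ihol|exact: lt8].
rewrite cabsM; apply: ler_wpM2r; first exact: cabs_ge0.
rewrite cabsM -mulrA; apply: ler_pM; rewrite ?cabs_ge0//; first exact: hD.
apply: (le_trans (cabs_sum _ _ _)); rewrite /S mulr_suml; apply: ler_sum => j jA.
rewrite cabsM -mulrA; apply: ler_wpM2l; first exact: cabs_ge0.
apply: (le_trans (hC j jA _ s4)); apply: ler_wpM2l; first exact: C0.
by rewrite lerXn2r ?nnegrE ?cabs_ge0.
Qed.

Lemma curve_zero e t : I e -> cabs t <= 1 -> e (phi t) = 0.
Proof.
move=> Ie; apply: (@identity_disc R (fun t => e (phi t))).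
  by move=> s s8; eexists; exact: curve_cdif (Ihol Ie) s8.
by move=> n; exact: curve_order.
Qed.

End CurvesInV.

(** * The peak point is regular; discs in V tangent to a level set *)

Section RegularData.
Variables (R : realType) (N r : nat) (V U : set (CN R N)) (g : 'I_r -> CN R N -> CC R).
Hypothesis oU : open U.
Hypothesis VU : forall z, U z -> (V z <-> forall i, g i z = 0).
Variables (f : 'I_N -> CN R N -> CC R) (A : {set 'I_N}) (x : CN R N) (rho1 : R).
Hypotheses (Ux : U x) (Vx : V x) (rho10 : 0 < rho1).
Hypothesis hf : forall i, holomorphic_on U (f i).
Hypothesis dJ : \det (Jac f x) != 0.
Hypothesis fA : forall z, V z -> vn (z - x) < rho1 -> forall i, i \in A -> f i z = 0.
Variable I : (CN R N -> CC R) -> Prop.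
Hypothesis Ihol : forall e, I e -> holomorphic_on U e.
Hypothesis Ix : forall e, I e -> e x = 0.
Hypothesis Iclosed : forall e, I e -> forall j, j \notin A -> I (sdet f j e).
Hypothesis Ig : forall i, I (g i).

Lemma x_fA i : i \in A -> f i x = 0.
Proof. by move=> iA; apply: fA => //; rewrite subrr vn0. Qed.

Lemma f_near (eta : R) : 0 < eta -> exists2 d : R, 0 < d & forall z, vn (z - x) < d ->
  vn (\row_i (f i z - f i x) : CN R N) < eta.
Proof.
move=> eta0; have e0 : 0 < eta / N.+1%:R by rewrite divr_gt0.
have [d d0 hd] : exists2 d : R, 0 < d & forall i z, vn (z - x) < d -> cabs (f i z - f i x) < eta / N.+1%:R.
  apply: fin_delta; first by move=> i a b _ ba H z zb; apply: H; exact: lt_le_trans ba.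
  by move=> i; have := hol_cont Ux (hf i) => /continuous_cabsP/(_ _ e0)/nbhs_vn.
exists d => // z /hd h; rewrite /vn.
apply: (@le_lt_trans _ _ (\sum_(i < N) (eta / N.+1%:R))).
  by apply: ler_sum => i _; rewrite mxE; exact/ltW/h.
rewrite sumr_const card_ord -[_ *+ N]mulr_natr -mulrA gtr_pMr//.
by rewrite mulrC ltr_pdivrMr// mul1r ltr_nat.
Qed.

(** If all [f i] with [i] in [A] vanish at a nearby [z], the line in the chart from [x] to [z] moves
    only in directions outside [A]. By [curve_zero] the equations [g i] hold along it, so that [z]
    lies in [V]. *)
Lemma regular_here : regular_point_codim V #|A| x.
Proof.
split => //.
have [rho [eta [/andP[rp rr1] eta0 rU curves]]] := inverse_curve oU Ux hf dJ rho10.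
have [d d0 hd] := f_near eta0.
pose B := [set z | vn (z - x) < Num.min rho d].
have oB : open B.
  apply: vn_open => z zB; exists (Num.min rho d - vn (z - x)); first by rewrite subr_gt0.
  by move=> w wz; have := vn_triangle w x z; rewrite /B /=; move: wz; lra.
have BU z : B z -> U z /\ \det (Jac f z) != 0.
  by rewrite /B /= lt_min => /andP[zr _]; exact: rU.
exists B, (fun i => f (enum_val i)); split => //.
- by rewrite /B /= subrr vn0 lt_min rp.
- by move=> i z /BU[Uz _]; exact: hf.
- apply/seteqP; split => z /=.
    move=> [Vz Bz]; split => // i; apply: (fA Vz); last exact: enum_valP.
    by move: Bz; rewrite /B /= lt_min => /andP[/lt_le_trans + _]; apply.
  move=> [Bz fz]; split => //.
  have [Uz _] := BU z Bz.
  move: Bz; rewrite /B /= lt_min => /andP[zr zd].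
  pose u : CN R N := \row_i (f i z - f i x).
  have [phi [p0 pt p1]] := curves u (hd z zd).
  have uA i : i \in A -> u ord0 i = 0.
    move=> iA; rewrite mxE x_fA// subr0.
    by have := fz (enum_rank_in iA i); rewrite enum_rankK_in.
  have E : phi 1 = z by apply: p1 => // i; rewrite mxE [f i x + _]addrC subrK.
  apply/(VU Uz) => i; rewrite -E.
  have pU t : cabs t < 8 -> U (phi t) by move=> /pt[tr _ _]; exact: (proj1 (rU _ tr)).
  have pJ t : cabs t < 8 -> \det (Jac f (phi t)) != 0 by move=> /pt[tr _ _]; exact: (proj2 (rU _ tr)).
  have pD t : cabs t < 8 -> exists2 d, vdif phi t d & forall i, \sum_j Jac f (phi t) i j * d ord0 j = u ord0 i.
    by move=> /pt[_ _ pd']; exact: pd'.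
  have c1 : cabs (1 : CC R) <= 1 by rewrite cabs1.
  exact: (curve_zero oU hf Ihol Ix Iclosed uA p0 pU pJ pD (Ig i) c1).
- move=> z Vz /BU[Uz dz] c cz i.
  (* A vanishing combination of the differentials is a row annihilated by the invertible
     Jacobian. *)
  pose c' : 'rV[CC R]_N := \sum_i c i *: delta_mx ord0 (enum_val i).
  have c'J : c' *m Jac f z = 0.
    apply/rowP => j; rewrite [RHS]mxE -[RHS](cz (delta_mx ord0 j)) mxE.
    rewrite /c'; under eq_bigr do rewrite summxE mulr_suml.
    rewrite exchange_big /=; apply: eq_bigr => k _.
    rewrite (bigD1 (enum_val k))//= !mxE !eqxx mulr1 big1 ?addr0 -?pdE// => l lk.
    by rewrite !mxE (negbTE lk) andbF mulr0 mul0r.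
  have c'0 : c' = 0.
    have Ju : Jac f z \in unitmx by rewrite unitmxE unitfE.
    by rewrite -(mulmxK Ju c') c'J mul0mx.
  have := congr1 (fun M : 'rV[CC R]_N => M ord0 (enum_val i)) c'0.
  rewrite mxE => <-; rewrite /c' summxE (bigD1 i)//= !mxE !eqxx mulr1 big1 ?addr0// => k ki.
  by rewrite !mxE /= (inj_eq enum_val_inj) eq_sym (negbTE ki) mulr0.
Qed.

(** At least two chart directions lie outside [A], and tangency to the level set of [F] is a single
    linear condition on them. *)
Lemma tangent_disc (F : CN R N -> CC R) : (#|A| + 2 <= N)%N ->
  exists (phi : CC R -> CN R N) (d : CN R N), [/\ phi 0 = x,
    (forall t, cabs t < 8 -> U (phi t) /\ exists d, vdif phi t d),
    (forall t, cabs t <= 1 -> V (phi t)),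
    vdif phi 0 d & d != 0 /\ \sum_j pd j F x * d ord0 j = 0].
Proof.
move=> cA.
have [a [b [aA bA ab]]] : exists a b : 'I_N, [/\ a \notin A, b \notin A & a != b].
  have : (1 < #|~: A|)%N by have := cardsC A; rewrite card_ord; lia.
  by case/card_gt1P => a [b [] ]; rewrite !inE => *; exists a, b.
have [rho [eta [/andP[rp rr1] eta0 rU curves]]] := inverse_curve oU Ux hf dJ rho10.
have Ju : Jac f x \in unitmx by rewrite unitmxE unitfE.
(* The differential of [F] expressed in the chart coordinates. *)
pose w : 'rV[CC R]_N := (\row_j pd j F x) *m invmx (Jac f x).
have [u0 [u0A u0n0 wu]] : exists u0 : CN R N, [/\ forall i, i \in A -> u0 ord0 i = 0, u0 != 0 & \sum_i w ord0 i * u0 ord0 i = 0].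
  pose mk (p q : CC R) : CN R N := p *: delta_mx ord0 a + q *: delta_mx ord0 b.
  have mka p q : mk p q ord0 a = p.
    by rewrite /mk !mxE !eqxx (negbTE ab) mulr1 mulr0 addr0.
  have mkb p q : mk p q ord0 b = q.
    by rewrite /mk !mxE !eqxx eq_sym (negbTE ab) mulr1 mulr0 add0r.
  have mko p q i : i != a -> i != b -> mk p q ord0 i = 0.
    by move=> ia ib; rewrite /mk !mxE !eqxx (negbTE ia) (negbTE ib) !mulr0 addr0.
  have mkA p q i : i \in A -> mk p q ord0 i = 0.
    by move=> iA; apply: mko; apply: contraTneq iA => ->.
  have mks p q : \sum_i w ord0 i * mk p q ord0 i = w ord0 a * p + w ord0 b * q.
    rewrite (bigD1 a)//= (bigD1 b) /=; last by rewrite eq_sym.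
    rewrite mka mkb big1 ?addr0// => i /andP[ia ib]; by rewrite mko ?mulr0.
  have mkn p q : p != 0 \/ q != 0 -> mk p q != 0.
    move=> pq; apply/eqP => m0; have := mka p q; have := mkb p q; rewrite m0 !mxE => q0 p0.
    by case: pq; rewrite -?q0 -?p0 eqxx.
  have [wa|wa] := eqVneq (w ord0 a) 0.
    exists (mk 1 0); split; [exact: mkA|by apply: mkn; left; exact: oner_neq0|].
    by rewrite mks wa mul0r mulr0 addr0.
  exists (mk (- w ord0 b) (w ord0 a)); split; [exact: mkA|by apply: mkn; right|].
  by rewrite mks; ring.
have vu0 : 0 < vn u0.
  by rewrite lt_neqAle vn_ge0 andbT eq_sym; apply: contraNneq u0n0 => /vn_eq0 ->.
pose c : R := eta / 2 / vn u0.
have c0 : 0 < c by rewrite !divr_gt0.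
pose u := c%:C%C *: u0.
have un : vn u < eta.
  rewrite vnZ cabsR gtr0_norm// /c divfK ?gt_eqF//; move: eta0; lra.
have [phi [p0 pt p1]] := curves u un.
have z8 : cabs (0 : CC R) < 8 by rewrite cabs0; lra.
have [_ _ [d vd dE]] := pt 0 z8.
exists phi, d; split => //.
- by move=> t /pt[tr _ [d' vd' _]]; split; [case: (rU _ tr)|exists d'].
- move=> t t1; have t8 : cabs t < 8 by move: t1; lra.
  have [tr _ _] := pt t t8; have [Ut _] := rU _ tr.
  apply/(VU Ut) => i.
  have uA j : j \in A -> u ord0 j = 0 by move=> jA; rewrite mxE u0A// mulr0.
  have pU s : cabs s < 8 -> U (phi s) by move=> /pt[tr' _ _]; exact: (proj1 (rU _ tr')).
  have pJ s : cabs s < 8 -> \det (Jac f (phi s)) != 0 by move=> /pt[tr' _ _]; exact: (proj2 (rU _ tr')).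
  have pD s : cabs s < 8 -> exists2 d, vdif phi s d & forall i, \sum_j Jac f (phi s) i j * d ord0 j = u ord0 i.
    by move=> /pt[_ _ pd']; exact: pd'.
  exact: (curve_zero oU hf Ihol Ix Iclosed uA p0 pU pJ pD (Ig i) t1).
- have dT : Jac f x *m d^T = u^T.
    apply/colP => i; rewrite [RHS]mxE -dE p0 mxE; apply: eq_bigr => j _; congr (_ * _); by rewrite mxE.
  split.
    apply: contraNneq u0n0 => d0; move: dT; rewrite d0 trmx0 mulmx0 => /esym/eqP.
    rewrite -trmx0 (inj_eq (can_inj (@trmxK _ _ _))) scaler_eq0 => /orP[|//].
    by rewrite -cabs_eq0 cabsR normr_eq0 gt_eqF.
  have E : ((\row_j pd j F x) *m d^T) ord0 ord0 = (w *m u^T) ord0 ord0.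
    by rewrite -dT /w -mulmxA [invmx _ *m _]mulmxA mulVmx// mul1mx.
  rewrite !mxE in E; transitivity (\sum_j (\row_j pd j F x) ord0 j * d^T j ord0).
    by apply: eq_bigr => j _; rewrite !mxE.
  rewrite E; transitivity (c%:C%C * \sum_i w ord0 i * u0 ord0 i); last by rewrite wu mulr0.
  by rewrite mulr_sumr; apply: eq_bigr => j _; rewrite [u^T _ _]mxE [u _ _]mxE; ring.
Qed.

End RegularData.

(** * Strict subharmonicity excludes a maximum at a regular point *)

Section MaxContra.
Variables (R : realType) (N : nat) (U : set (CN R N)).

Definition n2 (z : CN R N) : R := \sum_i cabs (z ord0 i) ^+ 2.

(** The term with [z - q] makes a maximum at [q] strict and uses up only half of the strict
    subharmonicity that [dl * n2 z] supplies. *)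
Definition Psi (H F : CN R N -> CC R) (dl A : R) (q z : CN R N) : R :=
  cabs (H z) ^+ 2 + dl * n2 z - dl / 2 * n2 (z - q) - A * cabs (F z) ^+ 2.

Variables (H F h : CN R N -> CC R) (dl A : R) (q x d : CN R N) (k : nat) (phi : CC R -> CN R N).
Hypotheses (hH : holomorphic_on U H) (hF : holomorphic_on U F) (hh : holomorphic_on U h).
Hypotheses (phi0 : phi 0 = x) (dl0 : 0 < dl) (k0 : (0 < k)%N) (hx : h x != 0).
Hypothesis phiU : forall t, cabs t < 8 -> U (phi t) /\ exists d, vdif phi t d.
Hypotheses (vd : vdif phi 0 d) (dn0 : d != 0) (Fd : \sum_j pd j F x * d ord0 j = 0).

Lemma along e : holomorphic_on U e -> forall t, cabs t < 8 -> exists l, cdif (fun t => e (phi t)) t l.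
Proof.
by move=> he t /phiU[Ut [d' vd']]; eexists; apply: (chain_grad vd'); exact: (hol_grad Ut he).
Qed.

Lemma along0 e : holomorphic_on U e -> cdif (fun t => e (phi t)) 0 (\sum_j pd j e x * d ord0 j).
Proof.
move=> he; have [|U0 _] := phiU (t := 0); first by rewrite cabs0; lra.
by rewrite -phi0; apply: (chain_grad vd); exact: (hol_grad U0 he).
Qed.

Lemma fourD (u v : CC R -> R) s : four (fun t => u t + v t) s = four u s + four v s.
Proof. by rewrite /four; ring. Qed.

Lemma fourZ c (u : CC R -> R) s : four (fun t => c * u t) s = c * four u s.
Proof. by rewrite /four; ring. Qed.

Lemma four_sum (J : finType) (u : J -> CC R -> R) s :
  four (fun t => \sum_j u j t) s = \sum_j four (u j) s.
Proof. by rewrite /four !big_split. Qed.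

Lemma n2d_gt0 : 0 < n2 d.
Proof.
rewrite lt_neqAle; apply/andP; split; last by apply: sumr_ge0 => i _; exact: sqr_ge0.
rewrite eq_sym; apply: contraNneq dn0 => /eqP; rewrite psumr_eq0; last by move=> i _; exact: sqr_ge0.
move=> /allP h0; apply/eqP/rowP => i; rewrite mxE; apply/eqP.
have := h0 i; rewrite mem_index_enum => /(_ isT) /=.
by rewrite sqrf_eq0 cabs_eq0.
Qed.

(** Since the differential of [F] kills [d], the penalty drops out to second order, however large
    [A] is. The [n2] terms leave [4 * dl - 2 * dl] times [n2 d]. *)
Lemma four_Psi : exists c : R, o2 (fun s => four (fun t => Psi H F dl A q (phi t)) s
  - 4 * Psi H F dl A q x - (c ^+ 2 + 2 * dl * n2 d) * s ^+ 2).
Proof.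
have oH := four_sq (along hH) (along0 hH).
have c0F : cdif (fun t => F (phi t)) 0 0 by have := along0 hF; rewrite Fd.
have oF := four_sq (along hF) c0F.
have oi i := four_sq (fun t t8 => let: conj _ (ex_intro d' vd') := phiU t8 in ex_intro _ (d' ord0 i) (vd' i)) (vd i).
have ci i t : cabs t < 8 -> exists l, cdif (fun t => phi t ord0 i - q ord0 i) t l.
  move=> /phiU[_ [d' vd']]; eexists; apply: cdifD; [exact: (vd' i)|exact: cdif_cst].
have ci0 i : cdif (fun t => phi t ord0 i - q ord0 i) 0 (d ord0 i).
  by rewrite -[d ord0 i]addr0; apply: cdifD; [exact: (vd i)|exact: cdif_cst].
have oq i := four_sq (ci i) (ci0 i).
exists (2 * cabs (\sum_j pd j H x * d ord0 j)).
have := o2D (o2D oH (o2Z dl (o2_sum (index_enum _) oi))) (o2D (o2Z (- (dl / 2)) (o2_sum (index_enum _) oq)) (o2Z (- A) oF)).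
rewrite phi0; set G := fun s => _; set G' := fun s => _; suff -> : G = G' by [].
apply/funext => s; rewrite /G /G' {G G'}.
have nsum (v : CN R N) (u : 'I_N -> CC R -> CC R) :
    \sum_i (four (fun t => cabs (u i t) ^+ 2) s - 4 * cabs (v ord0 i) ^+ 2 - 4 * cabs (d ord0 i) ^+ 2 * s ^+ 2) =
    four (fun t => \sum_i cabs (u i t) ^+ 2) s - 4 * n2 v - 4 * n2 d * s ^+ 2.
  by rewrite !sumrB four_sum /n2 !mulr_sumr mulr_suml.
rewrite (nsum x (fun i t => phi t ord0 i)).
have -> : \sum_i (four (fun t => cabs (phi t ord0 i - q ord0 i) ^+ 2) s - 4 * cabs (x ord0 i - q ord0 i) ^+ 2 - 4 * cabs (d ord0 i) ^+ 2 * s ^+ 2) =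
    four (fun t => \sum_i cabs (phi t ord0 i - q ord0 i) ^+ 2) s - 4 * n2 (x - q) - 4 * n2 d * s ^+ 2.
  rewrite -(nsum (x - q) (fun i t => phi t ord0 i - q ord0 i)).
  by apply: eq_bigr => i _; rewrite !mxE.
have -> : (fun t => \sum_i cabs (phi t ord0 i - q ord0 i) ^+ 2) = (fun t => n2 (phi t - q)).
  by apply/funext => t; apply: eq_bigr => i _; rewrite !mxE.
have -> : (fun t => \sum_i cabs (phi t ord0 i) ^+ 2) = (fun t => n2 (phi t)) by [].
have FE : four (fun t => Psi H F dl A q (phi t)) s =
    four (fun t => cabs (H (phi t)) ^+ 2) s + dl * four (fun t => n2 (phi t)) s +
    (- (dl / 2)) * four (fun t => n2 (phi t - q)) s + (- A) * four (fun t => cabs (F (phi t)) ^+ 2) s.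
  rewrite -!fourZ -!fourD; apply: (congr1 (fun u => four u s)); apply/funext => t.
  by rewrite /Psi !mulNr.
rewrite FE cabs0 /Psi.
move: (four (fun t => cabs (H (phi t)) ^+ 2) s) (four (fun t => n2 (phi t)) s) (four (fun t => n2 (phi t - q)) s) (four (fun t => cabs (F (phi t)) ^+ 2) s) => a1 a2 a3 a4.
move: (n2 x) (n2 (x - q)) (cabs (H x)) (cabs (F x)) (cabs (\sum_j pd j H x * d ord0 j)) (n2 d) => b1 b2 b3 b4 b5 b6.
by field.
Qed.

(** The maximum inequality is multiplied over the four points. By [four_prod] the factors [h] lose
    only a small multiple of [s ^+ 2], whereas the exponential gains a definite one. *)
Lemma max_contra : (exists2 d1 : R, 0 < d1 & forall t, cabs t < d1 ->
    cabs (h (phi t)) * expR (Psi H F dl A q (phi t)) ^+ k <= cabs (h x) * expR (Psi H F dl A q x) ^+ k) ->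
  False.
Proof.
case=> d1 d10 hmax.
pose P t := Psi H F dl A q (phi t); pose P0 := Psi H F dl A q x.
have [c oP] := four_Psi.
have [kap [kapE kap0]] : exists kap : R, 2 * dl * n2 d = kap /\ 0 < kap.
  by exists (2 * dl * n2 d); split => //; rewrite !mulr_gt0// n2d_gt0.
rewrite kapE in oP.
pose b0 := cabs (h x) ^+ 4.
have b00 : 0 < b0 by rewrite exprn_gt0// cabs_gt0.
have [d2 d20 h2] := oP (kap / 2) ltac:(by rewrite divr_gt0).
(* The loss is kept to 1/8 of [kap * s ^+ 2], relative to [b0], against a gain of 1/2:
   [(1 - y / 8) * (1 + y / 2) > 1] for [0 < y <= 1]. *)
have e0 : 0 < b0 * kap / 8 by apply: divr_gt0 => //; exact: mulr_gt0.
have [d3 d30 h3] := four_prod (along hh) e0.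
have [s [s0 [s1 s2 s3 s4 s5]]] : exists s : R, 0 < s /\ [/\ s < d1, s < d2, s < d3, s < 1 & s < kap^-1].
  have mp : 0 < Num.min (Num.min d1 d2) (Num.min d3 (Num.min 1 kap^-1)) by rewrite !lt_min d10 d20 d30 ltr01 invr_gt0.
  exists (Num.min (Num.min d1 d2) (Num.min d3 (Num.min 1 kap^-1)) / 2); split; first by rewrite divr_gt0.
  have : Num.min (Num.min d1 d2) (Num.min d3 (Num.min 1 kap^-1)) / 2 < Num.min (Num.min d1 d2) (Num.min d3 (Num.min 1 kap^-1)) by move: mp; lra.
  by rewrite !lt_min => /andP[/andP[-> ->] /andP[-> /andP[-> ->]]].
have ks : kap * s ^+ 2 <= 1.
  have ks1 : kap * s <= 1.
    by move: s5; rewrite -[kap^-1]mul1r ltr_pdivlMr// => /ltW; rewrite mulrC.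
  by rewrite expr2 mulrA mulr_ile1 ?mulr_ge0 ?(ltW s0) ?(ltW kap0) ?(ltW s4).
have s2p : 0 < s ^+ 2 by rewrite exprn_gt0.
have PP : 4 * P0 + kap / 2 * s ^+ 2 <= four P s.
  have := h2 s; rewrite s0 s2 => /(_ isT); rewrite ler_norml => /andP[+ _].
  have : 0 <= c ^+ 2 * s ^+ 2 by rewrite mulr_ge0 ?sqr_ge0.
  by rewrite -/P0 mulrDl -/(four P s); lra.
have := h3 s; rewrite s0 s3 => /(_ isT); rewrite ger0_norm ?cabs_ge0// phi0 => h3'.
pose B := h (phi s%:C%C) * h (phi (ii R * s%:C%C)) * h (phi (- s%:C%C)) * h (phi (- (ii R * s%:C%C))).
have Bge : b0 - b0 * kap / 8 * s ^+ 2 <= cabs B.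
  have := cabsBr (h x ^+ 4) B; rewrite cabsX cabsB -/b0 => h4.
  by move: h3' h4; rewrite -/B; lra.
have eX y : expR y ^+ k = expR (k%:R * y) :> R by rewrite expRM_natl.
have mx t : cabs t = s -> cabs (h (phi t)) * expR (k%:R * P t) <= cabs (h x) * expR (k%:R * P0).
  by move=> ts; rewrite -!eX; apply: hmax; rewrite ts.
have fp (t : CC R) := @four_pts R s t s0.
have m1 := mx s%:C%C (fp s%:C%C ltac:(by rewrite eqxx)).
have m2 := mx (ii R * s%:C%C) (fp (ii R * s%:C%C) ltac:(by rewrite eqxx orbT)).
have m3 := mx (- s%:C%C) (fp (- s%:C%C) ltac:(by rewrite eqxx !orbT)).
have m4 := mx (- (ii R * s%:C%C)) (fp (- (ii R * s%:C%C)) ltac:(by rewrite eqxx !orbT)).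
have nn t : 0 <= cabs (h (phi t)) * expR (k%:R * P t) by rewrite mulr_ge0 ?cabs_ge0 ?expR_ge0.
have M := ler_pM (mulr_ge0 (mulr_ge0 (nn _) (nn _)) (nn _)) (nn _) (ler_pM (mulr_ge0 (nn _) (nn _)) (nn _) (ler_pM (nn _) (nn _) m1 m2) m3) m4.
have L : cabs B * expR (k%:R * four P s) <= b0 * expR (k%:R * (4 * P0)).
  move: M; rewrite /B !cabsM /b0 /four.
  rewrite (_ : k%:R * (P s%:C%C + P (ii R * s%:C%C) + P (- s%:C%C) + P (- (ii R * s%:C%C))) =
    k%:R * P s%:C%C + k%:R * P (ii R * s%:C%C) + k%:R * P (- s%:C%C) + k%:R * P (- (ii R * s%:C%C))); last by ring.
  rewrite (_ : k%:R * (4 * P0) = k%:R * P0 + k%:R * P0 + k%:R * P0 + k%:R * P0); last by ring.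
  rewrite !expRD.
  set E0 := expR (k%:R * P0); set E1 := expR (k%:R * P _); set E2 := expR (k%:R * P _).
  set E3 := expR (k%:R * P _); set E4 := expR (k%:R * P _).
  set H1 := cabs (h (phi s%:C%C)); set H2 := cabs (h (phi (ii R * _))); set H3 := cabs (h (phi (- s%:C%C))).
  set H4 := cabs (h (phi _)); set H0 := cabs (h x).
  move: E0 E1 E2 E3 E4 H0 H1 H2 H3 H4 => E0 E1 E2 E3 E4 H0 H1 H2 H3 H4 M.
  rewrite (_ : H1 * H2 * H3 * H4 * (E1 * E2 * E3 * E4) = H1 * E1 * (H2 * E2) * (H3 * E3) * (H4 * E4)); last by ring.
  by apply: (le_trans M); rewrite le_eqVlt; apply/orP; left; apply/eqP; ring.
have k1 : 1 <= k%:R :> R by rewrite ler1n.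
have L2 : cabs B * expR (kap / 2 * s ^+ 2) <= b0.
  rewrite -(ler_pM2r (expR_gt0 (k%:R * (4 * P0)))); apply: le_trans L.
  rewrite -[cabs B * _ * _]mulrA -expRD ler_wpM2l ?cabs_ge0// ler_expR.
  have : kap / 2 * s ^+ 2 <= k%:R * (kap / 2 * s ^+ 2).
    by rewrite ler_peMl// mulr_ge0 ?divr_ge0 ?ltW.
  have : k%:R * (4 * P0 + kap / 2 * s ^+ 2) <= k%:R * four P s by rewrite ler_wpM2l.
  by rewrite [k%:R * (_ + _)]mulrDr; lra.
have L3 := expR_ge1Dx (kap / 2 * s ^+ 2).
have L4 : cabs B * (1 + kap / 2 * s ^+ 2) <= b0.
  by apply: le_trans L2; rewrite ler_wpM2l ?cabs_ge0.
have y0 : 0 < kap * s ^+ 2 by rewrite mulr_gt0.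
have E1 : kap / 2 * s ^+ 2 = kap * s ^+ 2 / 2 by rewrite mulrAC.
have E2 : b0 * kap / 8 * s ^+ 2 = b0 * (kap * s ^+ 2 / 8) by field.
rewrite E1 in L4; rewrite E2 in Bge.
move: (kap * s ^+ 2) y0 ks Bge L4 => y y0 y1 Bge L4.
have : b0 * ((1 - y / 8) * (1 + y / 2)) <= b0.
  apply: le_trans L4; rewrite mulrA; apply: ler_wpM2r; first by move: y0; lra.
  by rewrite mulrBr mulr1.
rewrite ger_pMr// => L5.
have : y * y <= y by rewrite ler_piMl// ltW.
by move: L5 y0; rewrite mulrBl mul1r mulrDr mulr1; rewrite (_ : y / 8 * (y / 2) = y * y / 16); [lra|field].
Qed.

End MaxContra.

(** * The maximum principle on the zero set of F in V *)

Section MaximumPrinciple.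
Variables (R : realType) (N : nat).
Implicit Types (z w q : CN R N) (V : set (CN R N)).

Lemma n2_ge0 z : 0 <= n2 z.
Proof. by apply: sumr_ge0 => i _; exact: sqr_ge0. Qed.

Lemma n2_0 : n2 (0 : CN R N) = 0.
Proof. by rewrite /n2 big1// => i _; rewrite mxE cabs0 expr0n. Qed.

Lemma cabs_n2 z i : cabs (z ord0 i) ^+ 2 <= n2 z.
Proof. by rewrite /n2 (bigD1 i)//= lerDl; apply: sumr_ge0 => j _; exact: sqr_ge0. Qed.

Lemma n2_vn z (e : R) : 0 <= e -> n2 z <= e ^+ 2 -> vn z <= N%:R * e.
Proof.
move=> e0 h; rewrite mulr_natl -[X in _ <= _ *+ X]card_ord -sumr_const; apply: ler_sum => i _.
rewrite -(@ler_pXn2r _ 2)// ?nnegrE ?cabs_ge0//.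
exact: le_trans (cabs_n2 _ _) h.
Qed.

Lemma vcts_n2 c z : vcts (fun w => n2 (w - c)) z.
Proof.
rewrite /n2; apply: vcts_sum => i; apply: vctsX; apply: vcts_lip => w.
apply: le_trans (_ : cabs ((w - c) ord0 i - (z - c) ord0 i) <= _).
  rewrite ler_norml; apply/andP; split; last exact: cabsBr.
  by have := cabsBr ((z - c) ord0 i) ((w - c) ord0 i); rewrite cabsB; lra.
rewrite !mxE (_ : _ - _ = (w - z) ord0 i); last by rewrite !mxE; ring.
exact: cabs_le_vn.
Qed.

Lemma vcts_n2' z : vcts (@n2 R N) z.
Proof.
rewrite (_ : @n2 R N = fun w => n2 (w - 0)); first exact: vcts_n2.
by apply/funext => w; rewrite subr0.
Qed.

Lemma compact_n2 V c (rho : R) : closed V -> compact [set z | V z /\ n2 (z - c) <= rho].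
Proof.
move=> cV; apply: (@compact_closed_bounded R N _ c (N%:R * (rho + 1))).
  rewrite (_ : [set z | _] = V `&` [set z | n2 (z - c) <= rho])//.
  by apply: closedI => //; apply: closed_vcts_le => z; exact: vcts_n2.
move=> z [_ zr]; have r0 : 0 <= rho := le_trans (n2_ge0 _) zr.
apply: n2_vn; first by rewrite addr_ge0.
by apply: (le_trans zr); rewrite sqrrD mulr1 expr1n; have := sqr_ge0 rho; lra.
Qed.

Lemma compact_n20 V (rho : R) : closed V -> compact [set z | V z /\ n2 z <= rho].
Proof.
move=> cV; rewrite (_ : [set z | _] = [set z | V z /\ n2 (z - 0) <= rho]).
  exact: compact_n2.
by apply/seteqP; split => z /=; rewrite subr0.
Qed.

Lemma vcts_sq (F : CN R N -> CC R) z : holomorphic_on setT F -> vcts (fun w => cabs (F w) ^+ 2) z.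
Proof. by move=> hF; apply: vctsX; apply: vcts_cabs; exact: (hol_cont _ hF). Qed.

Lemma vctsN (u : CN R N -> R) z : vcts u z -> vcts (fun w => - u w) z.
Proof.
move=> h; rewrite (_ : (fun w => - u w) = (fun w => (-1) * u w)).
  by apply: vctsM => //; exact: vcts_cst.
by apply/funext => w; rewrite mulN1r.
Qed.

Section Penalty.
Variables (S : set (CN R N)) (a b : CN R N -> R).
Hypotheses (cS : compact S) (ca : forall z, vcts a z) (cb : forall z, vcts b z).
Hypotheses (b0 : forall z, 0 <= b z) (ab : forall z, S z -> b z = 0 -> 0 < a z).

(** Where [a] is not positive, [b] is bounded below by compactness, so a large multiple of [b] wins;
    the minimum over [S] then gives [eta]. *)
Lemma penalty : exists A eta : R, [/\ 0 <= A, 0 < eta & forall z, S z -> eta <= a z + A * b z].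
Proof.
have [A A0 hA] : exists2 A : R, 0 <= A & forall z, S z -> 0 < a z + A * b z.
  pose S' := [set z | S z /\ a z <= 0].
  have cS' : compact S'.
    apply: (subclosed_compact _ cS); last by move=> z [].
    rewrite (_ : S' = S `&` [set z | a z <= 0])//; apply: closedI.
      by apply: compact_closed => //; exact: norm_hausdorff.
    exact: closed_vcts_le.
  have [S'0|S'0] := pselect (S' !=set0); last first.
    exists 0 => // z Sz; rewrite mul0r addr0 ltNge; apply/negP => az.
    by apply: S'0; exists z.
  have [zb [Szb azb] zbm] := vmin cS' S'0 (fun z _ => cb z).
  have [|za Sza zam] := vmin cS _ (fun z _ => ca z); first by exists zb.
  have bp : 0 < b zb.
    rewrite lt_neqAle b0 andbT; apply/negP => /eqP E.
    by have := ab Szb (esym E); rewrite ltNge azb.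
  exists ((`|a za| + 1) / b zb); first by rewrite divr_ge0// addr_ge0.
  move=> z Sz; have [az|az] := leP (a z) 0; last first.
    by rewrite ltr_wpDr// mulr_ge0// divr_ge0// addr_ge0.
  have h1 : `|a za| + 1 <= (`|a za| + 1) / b zb * b z.
    by rewrite mulrAC ler_pdivlMr// ler_wpM2l ?addr_ge0// zbm.
  have h2 := zam z Sz; have h3 : - `|a za| <= a za by rewrite lerNl -normrN ler_norm.
  by move: h1 h2 h3; lra.
have [S0|S0] := pselect (S !=set0); last first.
  by exists A, 1; split => // z Sz; case: S0; exists z.
have [|z0 Sz0 zm] := vmin cS S0 (u := fun z => a z + A * b z).
  by move=> z _; apply: vctsD => //; apply: vctsM => //; exact: vcts_cst.
by exists A, (a z0 + A * b z0); split => //; exact: hA.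
Qed.

End Penalty.

Lemma small_n2_ball (U : set (CN R N)) q : open U -> U q ->
  exists2 rho : R, 0 < rho & forall z, n2 (z - q) <= rho -> U z.
Proof.
move=> oU Uq; have [d d0 hd] := open_vn oU Uq.
have e0 : 0 < d / N.+1%:R by rewrite divr_gt0.
exists ((d / N.+1%:R) ^+ 2); first exact: exprn_gt0.
move=> z zr; apply: hd; apply: (le_lt_trans (n2_vn (ltW e0) zr)).
by rewrite mulrCA gtr_pMr// ltr_pdivrMr// mul1r ltr_nat.
Qed.

Lemma open_n2_lt (q : CN R N) (rho : R) : open [set z | n2 (z - q) < rho].
Proof.
apply: vn_open => z /= zr; have [|d d0 hd] := @vcts_n2 q z (rho - n2 (z - q)).
  by rewrite subr_gt0.
by exists d => // w /hd; rewrite ltr_norml => /andP[_]; lra.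
Qed.

(** The point [q] may be singular. The weight [expR (P z)] is larger at [q] than on the rim of a
    small ball; [PA_max] modifies it by a holomorphic factor so that the new maximum is attained at
    a regular point, where [max_contra] applies. *)
Lemma no_local_max V m (H F : CN R N -> CC R) (dl A rho : R) q :
  pure_codim_subvariety m V -> (m + 2 <= N)%N ->
  holomorphic_on setT H -> holomorphic_on setT F -> 0 < dl -> V q -> n2 q < rho ->
  ~ (forall z, V z -> n2 z <= rho ->
      cabs (H z) ^+ 2 + dl * n2 z - A * cabs (F z) ^+ 2 <= cabs (H q) ^+ 2 + dl * n2 q - A * cabs (F q) ^+ 2).
Proof.
move=> [[cV anV] pV] mN hH hF dl0 Vq qr qmax.
have [U0 [r [g [oU0 U0q hg VE]]]] := anV q.
pose U := U0 `&` [set z | n2 (z - 0) < rho].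
have oU : open U by apply: openI => //; exact: open_n2_lt.
have Uq : U q by split => //=; rewrite subr0.
have [rp rp0 rpU] := small_n2_ball oU Uq.
pose W := [set z | n2 (z - q) < rp].
pose Q := [set z | V z /\ n2 (z - q) <= rp].
have cQ : compact Q by exact: compact_n2.
have QU : Q `<=` U by move=> z [_ /rpU].
pose P := Psi H F dl A q.
have PE z : P z = (cabs (H z) ^+ 2 + dl * n2 z - A * cabs (F z) ^+ 2) - dl / 2 * n2 (z - q).
  by rewrite /P /Psi addrAC.
have Pq : P q = cabs (H q) ^+ 2 + dl * n2 q - A * cabs (F q) ^+ 2 by rewrite PE subrr n2_0 mulr0 subr0.
have Pcts z : vcts P z.
  rewrite /P /Psi; apply: vctsD; [apply: vctsD; [apply: vctsD|]|].
  - exact: vcts_sq.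
  - by apply: vctsM; [exact: vcts_cst|exact: vcts_n2'].
  - by apply: vctsN; apply: vctsM; [exact: vcts_cst|exact: vcts_n2].
  - by apply: vctsN; apply: vctsM; [exact: vcts_cst|exact: vcts_sq].
pose phi0 z := expR (P z).
have phi0_gt0 z : 0 < phi0 z by exact: expR_gt0.
have phi0_cts z : vcts phi0 z by apply: (vcts_comp (@continuous_expR R)).
have hU (e : CN R N -> CC R) : holomorphic_on setT e -> holomorphic_on U e by move=> he z _; exact: he.
(* The threshold is the bound on the rim, where the strictness term costs at least [dl / 2 * rp]. *)
have gd : good U W Q phi0 (fun=> 1) 1 (expR (P q - dl / 2 * rp)).
  split; [exact: (@hol_cst R N U 1)|by []|exact: expR_gt0| |].
    move=> z [Vz zr] nW; rewrite /wval cabs1 mul1r expr1 ler_expR Pq PE.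
    have zrp : rp <= n2 (z - q) by rewrite leNgt; apply/negP.
    have [_ /=] := rpU z zr; rewrite subr0 => /ltW zrho.
    have := qmax z Vz zrho.
    have : dl / 2 * rp <= dl / 2 * n2 (z - q) by rewrite ler_wpM2l// divr_ge0// ltW.
    lra.
  exists q; split; first by split => //; rewrite subrr n2_0 ltW.
  by rewrite /wval cabs1 mul1r expr1 ltr_expR ltrBlDr ltrDl mulr_gt0// divr_gt0.
have [A' [f [h [k [tau [[hf [hh k0 t0 hW [z1 Oz1]] fA dJ] cl]]]]]] := PA_max oU cQ QU phi0_gt0 gd.
have [||x Qx xmax] := @vmax R N Q (wval phi0 h k) cQ.
- by exists z1; case: Oz1.
- by move=> z /QU Uz; exact: (val_cts phi0_cts k Uz hh).
have Ox : Oset Q phi0 h k tau x by split => //; apply: lt_le_trans (xmax z1 _); case: Oz1.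
have Wx : W x.
  apply: contrapT => nW; have := hW x Qx nW; rewrite leNgt => /negP; apply; by case: Ox.
have Ux := QU x Qx; have Vx : V x by case: Qx.
have [d1 d10 hd1] := open_vn (@open_n2_lt q rp) Wx.
have [d2 d20 hd2] : exists2 d2 : R, 0 < d2 & forall z, vn (z - x) < d2 -> tau < wval phi0 h k z.
  have tx : 0 < wval phi0 h k x - tau by rewrite subr_gt0; case: Ox.
  have [d2 d20 hd2] := val_cts phi0_cts k Ux hh tx.
  by exists d2; [exact: d20|move=> z /hd2; rewrite ltr_norml => /andP[+ _]; lra].
pose rho1 := Num.min d1 d2.
have rho10 : 0 < rho1 by rewrite lt_min d10.
have VO z : V z -> vn (z - x) < rho1 -> Oset Q phi0 h k tau z.
  move=> Vz; rewrite lt_min => /andP[z1' z2]; split; last exact: hd2.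
  by split => //; apply: ltW; exact: hd1.
pose I e := holomorphic_on U e /\ forall z, Oset Q phi0 h k tau z -> e z = 0.
have Ihol e : I e -> holomorphic_on U e by case.
have Ix e : I e -> e x = 0 by case=> _; apply.
have Icl e : I e -> forall j, j \notin A' -> I (sdet f j e).
  move=> [he eO] j jA; split; first exact: hol_sdet.
  by move=> z Oz; exact: (cl e he eO j jA z Oz).
have UU0 z : U z -> U0 z by case.
have VU z : U z -> (V z <-> forall i, g i z = 0).
  move=> /UU0 Uz; split=> [Vz|gz].
    have : (V `&` U0) z by [].
    by rewrite VE => -[].
  have : (V `&` U0) z by rewrite VE.
  by case.
have Ig i : I (g i).
  split; first by move=> z /UU0 Uz; exact: (hg i z Uz).
  by move=> z [Qz _]; have Vz : V z by [case: Qz]; exact: (iffLR (VU z (QU z Qz)) Vz i).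
have fA' z : V z -> vn (z - x) < rho1 -> forall i, i \in A' -> f i z = 0.
  by move=> Vz zr i iA; exact: (fA z (VO z Vz zr) i iA).
have reg := regular_here oU VU Ux Vx rho10 hf (dJ x Ox) fA' Ihol Ix Icl Ig.
(* Here the pure codimension of [V] enters: it identifies the number of equations at the regular
   point just found, leaving two free directions. *)
have Am := pV _ _ reg; rewrite -Am in mN.
have [phi [d [p0 pU pV' vd [dn0 Fd]]]] := tangent_disc oU VU Ux rho10 hf (dJ x Ox) Ihol Ix Icl Ig F mN.
have hx : h x != 0.
  apply/eqP => h0; have := lt_trans t0 (proj2 Ox); by rewrite /wval h0 cabs0 mul0r ltxx.
apply: (max_contra (q := q) (hU _ hH) (hU _ hF) hh p0 dl0 k0 hx pU vd dn0 Fd (A := A)).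
have [d3 d30 hd3] : exists2 d3 : R, 0 < d3 & forall i t, cabs t < d3 -> cabs (phi t ord0 i - x ord0 i) < d1 / N.+1%:R.
  apply: fin_delta; first by move=> i a b _ ba Hh t tb; apply: Hh; exact: lt_le_trans ba.
  move=> i; have e0 : 0 < d1 / N.+1%:R by rewrite divr_gt0.
  have [d3 d30 hd3] := cdif_cts (vd i) e0; exists d3 => // t td.
  by have := hd3 t; rewrite subr0 p0; apply.
exists (Num.min d3 1); first by rewrite lt_min d30 ltr01.
move=> t; rewrite lt_min => /andP[td t1].
apply: xmax; split; first by apply: pV'; exact: ltW.
apply: ltW; apply: hd1; rewrite /vn.
apply: (@le_lt_trans _ _ (\sum_(i < N) (d1 / N.+1%:R))).
  by apply: ler_sum => i _; rewrite !mxE; apply: ltW; exact: hd3.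
rewrite sumr_const card_ord -[_ *+ N]mulr_natr -mulrA gtr_pMr//.
by rewrite mulrC ltr_pdivrMr// mul1r ltr_nat.
Qed.

(* The penalty - A |F|^2 pushes an almost maximal point towards F = 0; the term
   dl * n2 makes the function strictly subharmonic along discs tangent to F = const. *)
Lemma max_principle V m (H F : CN R N -> CC R) (rho : R) y :
  pure_codim_subvariety m V -> (m + 2 <= N)%N ->
  holomorphic_on setT H -> holomorphic_on setT F ->
  V y -> F y = 0 -> n2 y <= rho ->
  exists y', [/\ V y', F y' = 0, n2 y' = rho & cabs (H y) <= cabs (H y')].
Proof.
move=> pV mN hH hF Vy Fy yr; have [[cV anV] _] := pV.
apply: contrapT => /forallNP ne.
have {}ne z : V z -> F z = 0 -> n2 z = rho -> cabs (H z) < cabs (H y).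
  by move=> Vz Fz zr; rewrite ltNge; apply/negP => h; exact: (ne z).
have {}yr : n2 y < rho.
  rewrite lt_neqAle yr andbT; apply/negP => /eqP E.
  by have := ne y Vy Fy E; rewrite ltxx.
have rho0 : 0 < rho := le_lt_trans (n2_ge0 y) yr.
pose S := [set z | (V z /\ n2 z <= rho) /\ - n2 z <= - rho].
have cS : compact S.
  apply: (subclosed_compact _ (compact_n20 (rho := rho) cV)); last by move=> z [].
  rewrite (_ : S = (V `&` [set z | n2 z <= rho]) `&` [set z | - n2 z <= - rho])//.
  apply: closedI; first apply: closedI => //.
    by apply: closed_vcts_le => z; exact: vcts_n2'.
  by apply: closed_vcts_le => z; apply: vctsN; exact: vcts_n2'.
have SE z : S z -> V z /\ n2 z = rho.
  by move=> [[Vz h1] h2]; split => //; apply/eqP; rewrite eq_le h1 -lerN2.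
have [||||A [eta [A0 eta0 hA]]] := @penalty S (fun z => cabs (H y) ^+ 2 - cabs (H z) ^+ 2) (fun z => cabs (F z) ^+ 2) cS.
- by move=> z; apply: vctsD; [exact: vcts_cst|apply: vctsN; exact: vcts_sq].
- by move=> z; exact: vcts_sq.
- by move=> z; exact: sqr_ge0.
- move=> z /SE[Vz zr] /eqP; rewrite sqrf_eq0 cabs_eq0 => /eqP Fz.
  by rewrite subr_gt0 ltr_pXn2r ?nnegrE ?cabs_ge0// ne.
(* On the sphere the added term is [dl * rho = eta / 2], less than the margin [eta], so the maximum
   of [P] over the ball cannot lie there. *)
pose dl := eta / (2 * rho).
have dl0 : 0 < dl by rewrite divr_gt0// mulr_gt0.
have dr : dl * rho = eta / 2 by rewrite /dl; field; exact: lt0r_neq0.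
pose P z := cabs (H z) ^+ 2 + dl * n2 z - A * cabs (F z) ^+ 2.
have [||q [Vq qr] qm] := @vmax R N [set z | V z /\ n2 z <= rho] P (compact_n20 (rho := rho) cV).
- by exists y; split => //; exact: ltW.
- move=> z _; rewrite /P; apply: vctsD; [apply: vctsD|].
  + exact: vcts_sq.
  + by apply: vctsM; [exact: vcts_cst|exact: vcts_n2'].
  + by apply: vctsN; apply: vctsM; [exact: vcts_cst|exact: vcts_sq].
have Py : cabs (H y) ^+ 2 <= P y.
  by rewrite /P Fy cabs0 expr0n /= mulr0 subr0 lerDl mulr_ge0 ?n2_ge0// ltW.
have qr' : n2 q < rho.
  rewrite lt_neqAle qr andbT; apply/negP => /eqP E.
  have Sq : S q by split => //; rewrite E.
  have := hA q Sq; have := qm y (conj Vy (ltW yr)); rewrite /P E dr -/(P y).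
  by move: Py eta0; lra.
apply: (no_local_max pV mN hH hF dl0 Vq qr' (A := A)) => z Vz zr.
exact: qm.
Qed.

End MaximumPrinciple.

(** * One step of the walk: a peaking function against a weighted product *)

Section WalkStep.
Variables (R : realType) (N : nat).
Implicit Types (z w y : CN R N) (V : set (CN R N)).

Lemma cauchy_schwarz1 (I : finType) (x y : I -> R) : \sum_i y i ^+ 2 <= 1 ->
  (\sum_i x i * y i) ^+ 2 <= \sum_i x i ^+ 2.
Proof.
move=> y1; set S := \sum_i x i * y i.
have : 0 <= \sum_i (x i - S * y i) ^+ 2 by apply: sumr_ge0 => i _; exact: sqr_ge0.
have E (s : R) : \sum_i (x i - s * y i) ^+ 2 = \sum_i x i ^+ 2 - 2 * s * \sum_i x i * y i + s ^+ 2 * \sum_i y i ^+ 2.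
  by rewrite !mulr_sumr -sumrB -big_split /=; apply: eq_bigr => i _; ring.
rewrite E -/S.
have : S ^+ 2 * \sum_i y i ^+ 2 <= S ^+ 2 by rewrite ler_piMr// sqr_ge0.
by rewrite -mulrA -expr2; lra.
Qed.

Lemma prod_le1 (I : Type) (r : seq I) (P : pred I) (f : I -> R) :
  (forall i, 0 <= f i <= 1) -> \prod_(i <- r | P i) f i <= 1.
Proof.
move=> f01; suff /andP[] : 0 <= \prod_(i <- r | P i) f i <= 1 by [].
elim/big_rec : _ => [|i x _ /andP[x0 x1]]; first by rewrite ler01 lexx.
by have /andP[f0 f1] := f01 i; rewrite mulr_ge0//= mulr_ile1.
Qed.

Definition cj (u : CC R) : CC R := ((cre u) -i* (cim u))%C.

Lemma cabs_cj u : cabs (cj u) = cabs u.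
Proof.
apply/eqP; rewrite -(@eqrXn2 _ 2)// ?cabs_ge0//; apply/eqP.
by rewrite !cabs_sqr /= sqrrN.
Qed.

Lemma polar_cj (u v : CC R) :
  cabs u ^+ 2 = cabs v ^+ 2 + 2 * cre ((u - v) * cj v) + cabs (u - v) ^+ 2.
Proof. by rewrite !cabs_sqr !(creD, cimD, creN, cimN, creM) /=; ring. Qed.

Lemma cre_sum (I : Type) (r : seq I) (P : pred I) (F : I -> CC R) :
  cre (\sum_(i <- r | P i) F i) = \sum_(i <- r | P i) cre (F i).
Proof. by elim/big_rec2 : _ => // i a b _ <-; rewrite creD. Qed.

(* At y this equals 1, and on spheres a little larger than the one through y its
   modulus is large only near y; it keeps the walk steps short. *)
Definition peak y z : CC R := 1 + (2^-1 : R)%:C%C * \sum_i (z ord0 i - y ord0 i) * cj (y ord0 i).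

Lemma hol_peak y : holomorphic_on setT (peak y).
Proof.
apply: holD; first exact: hol_cst; apply: holM; first exact: hol_cst.
apply: hol_sum => i; apply: holM; last exact: hol_cst.
by apply: holD; [exact: hol_coord|exact: hol_cst].
Qed.

Lemma peak_id y : peak y y = 1.
Proof. by rewrite /peak big1 ?mulr0 ?addr0// => i _; rewrite subrr mul0r. Qed.

(** With [w] the sum in [peak], [2 * cre w = n2 z - n2 y - n2 (z - y)], and
    [cabs w ^+ 2 <= n2 (z - y)] by Cauchy-Schwarz. The quadratic term therefore eats only half of
    the negative contribution of the linear one. *)
Lemma peak_le y z : n2 y <= 1 ->
  cabs (peak y z) ^+ 2 <= 1 + (n2 z - n2 y) / 2 - n2 (z - y) / 4.
Proof.
move=> y1; rewrite /peak; set w := \sum_i _.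
have -> : cabs (1 + (2^-1 : R)%:C%C * w) ^+ 2 = 1 + cre w + cabs w ^+ 2 / 4.
  by case: w => a b; rewrite !cabs_sqr /=; field.
have wr : n2 z = n2 y + 2 * cre w + n2 (z - y).
  rewrite /n2 /w cre_sum mulr_sumr -!big_split /=; apply: eq_bigr => i _.
  by rewrite !mxE; exact: polar_cj.
have ww : cabs w ^+ 2 <= n2 (z - y).
  apply: (@le_trans _ _ ((\sum_i cabs ((z - y) ord0 i) * cabs (y ord0 i)) ^+ 2)); last exact: cauchy_schwarz1.
  rewrite ler_pXn2r ?nnegrE ?cabs_ge0//; last by apply: sumr_ge0 => i _; rewrite mulr_ge0 ?cabs_ge0.
  apply: le_trans (cabs_sum _ _ _) _; apply: ler_sum => i _.
  by rewrite !mxE cabsM cabs_cj.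
by move: wr ww; lra.
Qed.

Variables (p : nat -> CN R N -> CC R) (a : nat -> nat).
Hypothesis holp : forall n, holomorphic_on setT (p n).
Hypothesis p_le1 : forall n z, n2 z <= 1 -> cabs (p n z) <= 1.
Hypothesis a_gt0 : forall n, (0 < a n)%N.
Hypothesis p0_ge : forall n, expR (- ((a n)%:R * 2^-1 ^+ n.+1)) <= cabs (p n 0).

(* The weight of p_j is 1 / a j; the common denominator wT makes the exponents integers. *)
Definition wT n : nat := \prod_(j < n.+1) a j.
Definition wb n (j : 'I_n.+1) : nat := \prod_(i < n.+1 | i != j) a i.
Definition wprod n z : CC R := \prod_(j < n.+1) p j z ^+ wb j.

Lemma wT_gt0 n : (0 < wT n)%N.
Proof. exact: prodn_gt0. Qed.

Lemma wTE n (j : 'I_n.+1) : wT n = (a j * wb j)%N.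
Proof. by rewrite /wT (bigD1 j). Qed.

Lemma hol_wprod n : holomorphic_on setT (wprod n).
Proof. by apply: hol_prod => j; exact: holX. Qed.

Lemma cabs_prod (I : Type) (r : seq I) (P : pred I) (F : I -> CC R) :
  cabs (\prod_(i <- r | P i) F i) = \prod_(i <- r | P i) cabs (F i).
Proof. by elim/big_rec2 : _ => [|i u v _ <-]; rewrite ?cabs1// cabsM. Qed.

Lemma wprod_le1 n z : n2 z <= 1 -> cabs (wprod n z) <= 1.
Proof.
move=> z1; rewrite cabs_prod; apply: prod_le1 => j.
by rewrite cabsX exprn_ge0 ?cabs_ge0//= exprn_ile1 ?cabs_ge0// p_le1.
Qed.

(** The [j]-th factor costs [wT n * 2^-1 ^+ j.+1] in the exponent, and these costs sum to less than
    [wT n]. *)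
Lemma wprod0_ge n : expR (- (wT n)%:R) <= cabs (wprod n 0).
Proof.
apply: (@le_trans _ _ (\prod_(j < n.+1) expR (- ((wT n)%:R * 2^-1 ^+ j.+1)))).
  rewrite -expR_sum ler_expR sumrN lerN2 -mulr_sumr ler_piMr//.
  have E m : \sum_(j < m) (2^-1 : R) ^+ j.+1 = 1 - 2^-1 ^+ m.
    elim: m => [|m ih]; first by rewrite big_ord0 expr0 subrr.
    by rewrite big_ord_recr /= ih exprS; set t := _ ^+ m; field.
  by rewrite E lerBlDr lerDl exprn_ge0.
rewrite cabs_prod; apply: ler_prod => j _; rewrite expR_ge0 /= cabsX (wTE j) natrM.
rewrite (_ : - _ = (wb j)%:R * - ((a j)%:R * 2^-1 ^+ j.+1)); last by ring.
by rewrite expRM_natl lerXn2r ?nnegrE ?expR_ge0 ?cabs_ge0.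
Qed.

Lemma wprod_ge n z (c : R) (j : 'I_n.+1) : n2 z <= 1 ->
  expR (- ((wT n)%:R * c)) <= cabs (wprod n z) -> expR (- ((a j)%:R * c)) <= cabs (p j z).
Proof.
move=> z1 h.
have bj : (0 < wb j)%N by have := wT_gt0 n; rewrite (wTE j) muln_gt0 => /andP[].
rewrite -(@ler_pXn2r _ (wb j)) ?nnegrE ?expR_ge0 ?cabs_ge0//.
rewrite -expRM_natl (_ : _ * - _ = - ((wT n)%:R * c)); last by rewrite (wTE j) natrM; ring.
apply: (le_trans h); rewrite cabs_prod (bigD1 j)//= cabsX ler_piMr ?exprn_ge0 ?cabs_ge0//.
apply: prod_le1 => i.
by rewrite cabsX exprn_ge0 ?cabs_ge0//= exprn_ile1 ?cabs_ge0// p_le1.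
Qed.

(** The inequality between the values of [H] at [y] and [y'] is read twice: omitting the distance
    term bounds the loss of [wprod], and using [wprod <= 1] bounds the distance. *)
Lemma walk_step V m n (F : CN R N -> CC R) y (rho c : R) (L : nat) :
  pure_codim_subvariety m V -> (m + 2 <= N)%N -> holomorphic_on setT F ->
  V y -> F y = 0 -> n2 y <= rho -> rho <= 1 -> (0 < L)%N ->
  expR (- ((wT n)%:R * c)) <= cabs (wprod n y) ->
  exists y', [/\ V y', F y' = 0, n2 y' = rho,
    expR (- ((wT n)%:R * (c + L%:R * (rho - n2 y) / 4))) <= cabs (wprod n y') &
    L%:R * n2 (y' - y) <= 8 * c + 2 * L%:R * (rho - n2 y)].
Proof.
move=> pV mN hF Vy Fy yr r1 L0 hc.
pose T := wT n; have T0 : 0 < (T%:R : R) by rewrite ltr0n wT_gt0.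
(* The factor [T] in the exponent matches the scale of [wprod], so that the resulting bounds do not
   depend on [n]; [L] trades loss for shortness of the step. *)
pose H z := peak y z ^+ (T * L) * wprod n z.
have hH : holomorphic_on setT H by apply: holM; [apply: holX; exact: hol_peak|exact: hol_wprod].
have [y' [Vy' Fy' y'r]] := max_principle pV mN hH hF Vy Fy yr.
rewrite /H peak_id expr1n mul1r cabsM cabsX => hy.
have y1 : n2 y <= 1 := le_trans yr r1.
have G2 := peak_le y' y1; rewrite y'r in G2.
set D := rho - n2 y in G2 *; set d := n2 (y' - y) in G2 *.
have Ge : cabs (peak y y') ^+ (T * L) <= expR (T%:R * L%:R * (D / 4 - d / 8)).
  rewrite -natrM expRM_natl lerXn2r ?nnegrE ?expR_ge0 ?cabs_ge0//.
  rewrite -(@ler_pXn2r _ 2) ?nnegrE ?expR_ge0 ?cabs_ge0//.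
  rewrite -expRM_natl; apply: (le_trans G2); apply: le_trans (expR_ge1Dx _).
  by lra.
have wy' : 0 <= cabs (wprod n y') by exact: cabs_ge0.
have d0 : 0 <= d by exact: n2_ge0.
have w1 : cabs (wprod n y') <= 1 by apply: wprod_le1; rewrite y'r.
have h1 : expR (- (T%:R * c)) <= expR (T%:R * L%:R * (D / 4 - d / 8)) * cabs (wprod n y').
  by apply: (le_trans hc); apply: (le_trans hy); rewrite ler_wpM2r.
exists y'; split => //.
  have -> : - (T%:R * (c + L%:R * D / 4)) = - (T%:R * L%:R * (D / 4)) + - (T%:R * c) by field.
  rewrite expRD expRN ler_pdivrMl ?expR_gt0//.
  apply: (le_trans h1); rewrite ler_wpM2r// ler_expR ler_wpM2l//.
  by lra.
have : expR (- (T%:R * c)) <= expR (T%:R * L%:R * (D / 4 - d / 8)).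
  by apply: (le_trans h1); rewrite ler_piMr// expR_ge0.
rewrite -/d ler_expR -mulrA -mulrN ler_pM2l//; lra.
Qed.

End WalkStep.

(** A cluster point serves as limit: it satisfies every closed condition that holds eventually, and
    no subsequence has to be chosen. *)
Lemma cluster_limit (T : topologicalType) (A : set T) (f : nat -> T) : compact A ->
  (forall s, A (f s)) ->
  exists2 x, A x & forall C s0, closed C -> (forall s, (s0 <= s)%N -> C (f s)) -> C x.
Proof.
move=> cA Af; have [|x [Ax cl]] := cA (f @ \oo) _; first by exists 0%N => // s _; exact: Af.
exists x => // C s0 cC hC; move: cl; rewrite clusterE => /(_ C) cl.
by rewrite closure_id in cC; rewrite cC; apply: cl; exists s0.
Qed.

(** Cantor's diagonal argument: [d] differs at [n] from the sequence that [G] sends to [n]. *)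
Lemma no_inj_bool_seq (G : (nat -> bool) -> nat) : ~ injective G.
Proof.
move=> Gi; pose d n := `[< exists b, G b = n /\ b n = false >].
have [dn|dn] : (d (G d) = true) \/ (d (G d) = false) by case: (d _); [left|right].
  have /asboolP[b [/Gi bd]] := dn.
  by rewrite bd dn.
by move: (dn); rewrite /d => /asboolP; apply; exists d.
Qed.

(** Four consecutive integers contain every residue modulo 4, so both bits can be prescribed at the
    cost of passing at most four shells. *)
Lemma residue_choice (J : nat) (a b : bool) :
  exists i, (J < 4 * i + 2 * a + b)%N /\ (4 * i + 2 * a + b <= J + 4)%N.
Proof.
have [h|h] := leqP (J %/ 4 * 4 + 2 * a + b)%N J.
  exists (J %/ 4)%N.+1; have := divn_eq J 4; have : (J %% 4 < 4)%N by rewrite ltn_mod.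
  by move: h; case: a; case: b; lia.
exists (J %/ 4)%N; have := divn_eq J 4; have : (J %% 4 < 4)%N by rewrite ltn_mod.
by move: h; case: a; case: b; lia.
Qed.

(** * Shells and grids *)

Section Levels.
Variables (R : realType) (N : nat) (cc : nat -> 'I_N).
Implicit Types (z w y : CN R N).

Definition mesh k : R := 2^-1 ^+ k.
(** The spacing of squared radii. The fourth power of the mesh leaves room for an exponent [L] of
    order [mesh k ^- 2] in [walk_step]: four shells cost [L * sig k] of order [mesh k ^+ 2], while
    [L] already forces steps shorter than [mesh k / 32]. *)
Definition sig k : R := (mesh k / 16) ^+ 4.
Definition qc k z : R := if odd k then cim (z ord0 (cc k)) else cre (z ord0 (cc k)).
(* In the shell of index jx i a b, the bit b shifts the grid by half a mesh, so that
   one of the two kinds of shells can be entered far from the walls, and the bit a is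
   free. *)
Definition jx (i : nat) (a b : bool) : nat := (4 * i + 2 * a + b)%N.
Definition band k (j : nat) z := j%:R * sig k <= n2 z /\ n2 z <= j%:R * sig k + sig k / 2.
Definition shf k (b : bool) z : R := qc k z / mesh k - (b : nat)%:R / 2.
Definition walls k b z := forall m : int, 1 / 8 <= `|shf k b z - m%:~R|.
Definition lev k a z := exists i b, band k (jx i a b) z /\ walls k b z.

Lemma mesh_gt0 k : 0 < mesh k. Proof. by rewrite exprn_gt0. Qed.
Lemma mesh_le1 k : mesh k <= 1. Proof. by rewrite exprn_ile1// invf_le1// ler1n. Qed.
Lemma meshS k : mesh k.+1 = mesh k / 2. Proof. by rewrite /mesh exprSr. Qed.
Lemma sig_gt0 k : 0 < sig k. Proof. by rewrite exprn_gt0// divr_gt0// mesh_gt0. Qed.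
Lemma sigS k : sig k.+1 = sig k / 16. Proof. by rewrite /sig meshS; field. Qed.
Lemma sig_le k : sig k <= 16^-1.
Proof.
have m0 := mesh_gt0 k; have m1 := mesh_le1 k.
have t1 : mesh k / 16 <= 1 by lra.
rewrite /sig exprS; apply: (@le_trans _ _ (mesh k / 16)); last by lra.
by rewrite ler_piMr ?exprn_ile1//; lra.
Qed.

Lemma qc_lip k z w : `|qc k z - qc k w| <= cabs ((z - w) ord0 (cc k)).
Proof.
rewrite /qc !mxE; case: (odd k); first by rewrite -cimN -cimD; exact: cim_le.
by rewrite -creN -creD; exact: cre_le.
Qed.

Lemma vcts_qc k z : vcts (qc k) z.
Proof. by apply: vcts_lip => w; exact: le_trans (qc_lip _ _ _) (cabs_le_vn _ _). Qed.

Lemma vcts_shf k b z : vcts (shf k b) z.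
Proof.
apply: vctsD; last exact: vcts_cst; apply: vctsM; [exact: vcts_qc|exact: vcts_cst].
Qed.

Lemma vcts_norm (u : CN R N -> R) z : vcts u z -> vcts (fun w => `|u w|) z.
Proof.
move=> hu e e0; have [d d0 hd] := hu e e0; exists d => // w /hd.
by apply: le_lt_trans; exact: ler_dist_dist.
Qed.

Lemma closed_vcts_ge (u : CN R N -> R) (c : R) : (forall z, vcts u z) -> closed [set z | c <= u z].
Proof.
move=> hu; rewrite (_ : [set z | _] = [set z | - u z <= - c]).
  by apply: closed_vcts_le => z; exact: vctsN.
by apply/seteqP; split => z /=; rewrite lerN2.
Qed.

Lemma closed_band k j : closed [set z | band k j z].
Proof.
apply: closedI; first by apply: closed_vcts_ge => z; exact: vcts_n2'.
by apply: closed_vcts_le => z; exact: vcts_n2'.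
Qed.

Lemma closed_walls k b : closed [set z | walls k b z].
Proof.
rewrite (_ : [set z | _] = \bigcap_(m in [set: int]) [set z | 1 / 8 <= `|shf k b z - m%:~R|]).
  apply: closed_bigI => m _; apply: closed_vcts_ge => z; apply: vcts_norm.
  by apply: vctsD; [exact: vcts_shf|exact: vcts_cst].
by apply/seteqP; split => z /= h m; [move=> _; exact: h|exact: h].
Qed.

(** The bound [n2 z <= 1] leaves finitely many shells, so the union is closed. *)
Lemma closed_lev k a : closed [set z | n2 z <= 1 /\ lev k a z].
Proof.
pose B := (Num.trunc (1 / sig k)).+1.
have hB : 1 / sig k < B%:R.
  have s0 : 0 <= 1 / sig k by rewrite divr_ge0// ltW// sig_gt0.
  by have /andP[] := truncn_itv s0.
rewrite (_ : [set z | _] = \bigcup_(ib in [set i | (i < B)%N] `*` [set: bool])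
   ([set z | n2 z <= 1] `&` ([set z | band k (jx ib.1 a ib.2) z] `&` [set z | walls k ib.2 z]))).
  apply: closed_bigcup; first by apply: finite_setX; [exact: finite_II|exact: finite_finset].
  move=> ib _; apply: closedI; first by apply: closed_vcts_le => z; exact: vcts_n2'.
  by apply: closedI; [exact: closed_band|exact: closed_walls].
apply/seteqP; split=> z; last by move=> [[i b] _ [z1 [h1 h2]]]; split => //; exists i, b.
move=> [z1 [i [b [h1 h2]]]]; exists (i, b) => //; split => //=.
rewrite -(@ltr_nat R); apply: le_lt_trans hB; rewrite ler_pdivlMr ?sig_gt0//.
apply: le_trans z1; apply: le_trans h1.1; rewrite ler_wpM2r ?ler_nat /jx; [lia|exact/ltW/sig_gt0|].
by lia.
Qed.

Lemma band_inj k j j' z : band k j z -> band k j' z -> j = j'.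
Proof.
have s0 := sig_gt0 k.
have half (u v : nat) : u%:R * sig k <= n2 z -> n2 z <= v%:R * sig k + sig k / 2 -> (u <= v)%N.
  move=> h1 h2; rewrite -ltnS -(@ltr_nat R) -(ltr_pM2r s0) -natr1; nra.
by move=> [h1 h2] [h3 h4]; apply/eqP; rewrite eqn_leq !half.
Qed.

Lemma jx_inj i a b i' a' b' : jx i a b = jx i' a' b' -> [/\ i = i', a = a' & b = b'].
Proof. by rewrite /jx; case: a; case: b; case: a'; case: b' => /= h; split => //; lia. Qed.

(** A point remembers the free bit of each level, because the bands fill only half of the spacing
    and are disjoint; this is what makes the points of V in X uncountably many. *)
Lemma lev_inj k a a' z : lev k a z -> lev k a' z -> a = a'.
Proof.
move=> [i [b [h _]]] [i' [b' [h' _]]].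
by have /jx_inj[] := band_inj h h'.
Qed.

(** If [t] is within 1/4 of an integer, then [t - 1/2] is at least 1/4 away from all of them. *)
Lemma wall_choice (t : R) : exists b : bool, forall m : int, 1 / 4 <= `|t - (b : nat)%:R / 2 - m%:~R|.
Proof.
have /andP[f1 f2] := floor_itv t; set fl := Num.floor t in f1 f2.
rewrite intrD in f2.
have cs (m c : int) : (m%:~R <= c%:~R :> R) \/ (c%:~R + 1 <= m%:~R :> R).
  have [h|h] := leP m c; first by left; rewrite ler_int.
  by right; rewrite -[1]/(1%:~R) -intrD ler_int; move: h; lia.
have [h|h] := boolP ((fl%:~R + 1 / 4 <= t) && (t <= fl%:~R + 3 / 4)).
  exists false => m; move/andP: h => [h1 h2].
  have [c|c] := cs m fl.
    by rewrite ger0_norm /=; lra.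
  by rewrite ler0_norm /=; lra.
exists true => m; move: h; rewrite negb_and -!ltNge => /orP[h|h].
  have [c|c] := cs m (fl - 1); move: c; rewrite intrB => c.
    by rewrite ger0_norm /=; lra.
  by rewrite ler0_norm /=; lra.
have [c|c] := cs m fl.
  by rewrite ger0_norm /=; lra.
by rewrite ler0_norm /=; lra.
Qed.

End Levels.

(** * Perfect compact spaces with a separating sequence of clopen sets *)

Section CantorCells.
Variables (T : topologicalType) (t0 : T) (U : nat -> set T).
Hypotheses (cT : compact [set: T]) (hT : hausdorff_space T).
Hypothesis clU : forall n, clopen (U n).
Hypothesis sepU : forall x y : T, x <> y -> exists n, U n x <> U n y.
Hypothesis perfU : forall n (x : T), exists2 y, y <> x & forall i, (i < n)%N -> U i x = U i y.

(** The third clause replaces openness: membership in [V] depends on finitely many [U i], so [perfU]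
    finds a second point of [V] near any given one. *)
Let inv (V : set T) := [/\ closed V, V !=set0 &
  exists n, forall x y, (forall i, (i < n)%N -> U i x = U i y) -> V x -> V y].

Let splits (V W : set T) := (W `&` V) !=set0 /\ (~` W `&` V) !=set0.

Lemma inv_splits V : exists n, inv V -> splits V (U n).
Proof.
have [iV|] := pselect (inv V); last by exists 0%N.
have [_ [x Vx] [n hn]] := iV; have [y yx xy] := perfU n x.
have Vy := hn x y xy Vx; have [k Uxy] := sepU yx; exists k => _.
have [Uy|Uy] := pselect (U k y).
  split; first by exists y.
  by exists x; split => // Ux; apply: Uxy; rewrite propeqE.
split; last by exists y.
exists x; split => //; apply: contrapT => Ux.
by apply: Uxy; rewrite propeqE.
Qed.

Let sidx V := projT1 (cid (inv_splits V)).
(** At level [n] the set [U n] is used whenever it splits [V], so that all separations take place in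
    the end; otherwise some other splitting set keeps both halves nonempty. *)
Let idx n V := if `[< splits V (U n) >] then n else sidx V.
Let half n (V : set T) (b : bool) := (if b then U (idx n V) else ~` U (idx n V)) `&` V.

Lemma cantor_cells : exists f : cantor_space -> T,
  [/\ continuous f, (forall x, exists t, f t = x) & injective f].
Proof.
pose T' : ptopologicalType := HB.pack T (isPointed.Build T t0).
have idxP n V : inv V -> splits V (U (idx n V)).
  have := projT2 (cid (inv_splits V)); rewrite -/(sidx V) => h iV.
  by rewrite /idx; case: asboolP => // _; exact: h.
have [||||||f [cf sf jf]] := @tree_map_props (fun=> bool) T' half inv cT hT.
- move=> n V; apply/seteqP; split=> [x Vx|x [b _ []//]].
  by have [Ux|Ux] := pselect (U (idx n V) x); [exists true|exists false].
- move=> n V b iV; have [[x [Ux Vx]] [y [Uy Vy]]] := idxP n V iV.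
  have [cV _ [k hk]] := iV; have [oU cU] := clU (idx n V); split.
  + apply: closedI => //; case: b => //; exact: open_closedC.
  + by case: b; [exists x|exists y].
  + exists (maxn k (idx n V).+1) => u v uv [Uu Vu].
    have E : U (idx n V) u = U (idx n V) v by apply: uv; rewrite leq_max ltnSn orbT.
    split; last by apply: hk Vu => i ik; apply: uv; rewrite leq_max ik.
    by case: b Uu; rewrite /= E.
- by move=> V [].
- by split; [exact: closedT|exists t0|exists 0%N].
- by move=> V [].
- move=> x y /eqP /sepU [n Uxy]; exists n => V b [hx Vx] [hy Vy].
  have sV : splits V (U n).
    have [Ux|Ux] := pselect (U n x); have [Uy|Uy] := pselect (U n y).
    + by case: Uxy; rewrite propeqE.
    + by split; [exists x|exists y].
    + by split; [exists y|exists x].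
    + by case: Uxy; rewrite propeqE.
  have E : idx n V = n by rewrite /idx asboolT.
  move: hx hy; rewrite E; case: b => /= hx hy; apply: Uxy; rewrite propeqE; tauto.
exists f; split => //.
  by move=> x; have [t _ <-] := sf x I; exists t.
have triv n V : trivIset [set: bool] (half n V).
  by move=> [] [] // _ _ [z [[h1 _] [h2 _]]]; [case: (h2 h1)|case: (h1 h2)].
by move=> x y fxy; exact: (jf triv x y (mem_set I) (mem_set I) fxy).
Qed.

End CantorCells.

(** * The perfect kernel is a Cantor set *)

Section PerfectKernel.
Variables (T : topologicalType) (X : set T) (U : nat -> set T).
Hypotheses (cX : compact X) (hT : hausdorff_space T).
Hypotheses (cU : forall n, closed (X `&` U n)) (cUC : forall n, closed (X `&` ~` U n)).
Hypothesis sepU : forall x y, X x -> X y -> x <> y -> exists n, U n x <> U n y.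

Let cell (w : seq bool) := [set x | X x /\ forall i, (i < size w)%N -> U i x = nth false w i :> Prop].

(** A Cantor-Bendixson kernel in one step: all countable cells are discarded at once. As there are
    only countably many words [w], only countably many points are lost. *)
Let K := [set x | X x /\ forall w, cell w x -> ~ countable (cell w)].

Let code x n := mkseq (fun i => `[< U i x >]) n.

Let cell_code x y n : X y -> (forall i, (i < n)%N -> U i x = U i y) -> cell (code x n) y.
Proof.
move=> Xy h; split => // i; rewrite size_mkseq => ni; rewrite nth_mkseq// -h//.
by rewrite propeqE; split => /asboolP.
Qed.

Let codeP x y n i : cell (code x n) y -> (i < n)%N -> U i x = U i y.
Proof.
move=> [_ h] ni; rewrite h ?size_mkseq// nth_mkseq// propeqE; split => /asboolP; exact.
Qed.

Let countable_rest : countable (X `\` K).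
Proof.
apply: (@sub_countable _ _ _ (\bigcup_(w in [set w | countable (cell w)]) cell w)).
  apply: subset_card_le => x [Xx nK]; apply: contrapT => h; apply: nK; split => // w wx cw.
  by apply: h; exists w.
by apply: bigcup_countable.
Qed.

Lemma meets_kernel A : A `<=` X -> ~ countable A -> A `&` K !=set0.
Proof.
move=> AX nA; apply: contrapT => h; apply: nA.
apply: sub_countable countable_rest; apply: subset_card_le => x Ax; split; first exact: AX.
by move=> Kx; apply: h; exists x.
Qed.

Let closed_kernel : closed K.
Proof.
(* The complement of a cell in [X] is a finite union of the closed sets [X] meets [U i] or its
   complement; [K] is [X] intersected with these for all countable cells. *)
have -> : K = X `&` \bigcap_(w in [set w | countable (cell w)])
    (\bigcup_(i in [set i | (i < size w)%N]) (X `&` (if nth false w i then ~` U i else U i))).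
  apply/seteqP; split=> x.
    move=> [Xx h]; split => // w cw; apply: contrapT => nb; apply: (h w) => //; split => // i iw.
    have : ~ (X `&` (if nth false w i then ~` U i else U i)) x by move=> ?; apply: nb; exists i.
    case: (nth false w i) => nn; rewrite propeqE; split => // u; first by apply: contrapT => nu; exact: nn.
    by case: nn.
  move=> [Xx h]; split => // w [_ xw] cw; have [i iw [_]] := h w cw.
  by have := xw i iw; case: (nth false w i) => /= E nU; [apply: nU; rewrite E|move: nU; rewrite E].
apply: closedI; first exact: compact_closed.
apply: closed_bigI => w _; apply: closed_bigcup; first exact: finite_II.
by move=> i _; case: (nth false w i).
Qed.

Lemma cantor_kernel : ~ countable X -> exists (f : cantor_space -> T) (g : T -> cantor_space),
    [/\ continuous f, range f = K, (forall t, g (f t) = t) & {within K, continuous g}].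
Proof.
move=> nX; have [||x0 [_ Kx0]] := @meets_kernel X; [by []|by []|].
pose S : topologicalType := set_type K.
have sv (s : S) : K (set_val s) by exact: set_valP.
have cval : continuous (set_val : S -> T) by exact: initial_continuous.
have clS (A : set T) : closed A -> closed ((set_val : S -> T) @^-1` A).
  by move=> cA; apply: closed_comp => // s _; exact: cval.
have hS : hausdorff_space S.
  move=> s t st; apply: val_inj; apply: hT => A B As Bt.
  have [u [Au Bu]] := st _ _ (cval s A As) (cval t B Bt).
  by exists (set_val u).
have KX : K `<=` X by move=> x [].
have cK : compact K by exact: (subclosed_compact closed_kernel cX KX).
have cS : compact [set: S].
  move=> F FF _.
  have FK : F [set s | K (set_val s)] by apply: filterE => s; exact: sv.
  have [|x [Kx clx]] := cK ((set_val : S -> T) @ F) _; first exact: FK.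
  exists (SigSub (mem_set Kx)); split => // A B FA [_ [[W oW <-] /= Wx WB]].
  have [_ [[u Au <-] Wu]] : ((set_val : S -> T) @` A `&` W) !=set0.
    apply: clx; last exact: open_nbhs_nbhs.
    suff : F ((set_val : S -> T) @^-1` (set_val @` A)) by [].
    by apply: filterS FA => u Au; exists u.
  by exists u; split => //; exact: WB.
have [|||f [cf sf jf]] := @cantor_cells S (SigSub (mem_set Kx0)) (fun n => (set_val : S -> T) @^-1` U n) cS hS.
- move=> n; split.
    rewrite -[X in open X]setCK; apply: closed_openC.
    rewrite (_ : ~` _ = (set_val : S -> T) @^-1` (X `&` ~` U n)); first exact: clS.
    by apply/seteqP; split => s /=; [move=> h; split => //; exact/KX/sv|case].
  rewrite (_ : _ @^-1` _ = (set_val : S -> T) @^-1` (X `&` U n)); first exact: clS.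
  by apply/seteqP; split => s /=; [move=> h; split => //; exact/KX/sv|case].
- move=> s t st; apply: (sepU (KX _ (sv s)) (KX _ (sv t))) => e; apply: st; exact: val_inj.
- move=> n s; have [Xs Ks] := sv s.
  have := Ks (code (set_val s) n) (cell_code Xs (fun _ _ => erefl)) => nc.
  (* A cell of a kernel point stays uncountable without that point, hence contains another kernel
     point: [K] is perfect. *)
  have [||y [[cy ys] Ky]] := @meets_kernel (cell (code (set_val s) n) `\ set_val s).
  + by move=> y [[]].
  + move=> h; apply: nc.
    apply: (@sub_countable _ _ _ (\bigcup_(e in [set: bool])
        (if e then cell (code (set_val s) n) `\ set_val s else [set set_val s]))).
      apply: subset_card_le => y cy.
      by have [->|ne] := pselect (y = set_val s); [exists false|exists true].
    by apply: bigcup_countable => // -[] _.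
  exists (SigSub (mem_set Ky)).
    by move=> e; apply: ys; rewrite -e.
  by move=> i ni /=; exact: (codeP cy ni).
have [g0 g0P] := choice sf.
have g0f t : g0 (f t) = t by apply: jf; rewrite g0P.
have cg0 : continuous g0.
  apply/continuous_closedP => A cA.
  rewrite (_ : g0 @^-1` A = f @` A).
    apply: compact_closed => //; apply: continuous_compact; first exact: continuous_subspaceT.
    by apply: (subclosed_compact cA cantor_space_compact).
  by apply/seteqP; split=> [s As|_ [t At <-]] /=; [exists (g0 s)|rewrite g0f].
exists (fun t => set_val (f t)), (valL g0); split.
- by move=> t; apply: continuous_comp; [exact: cf|exact: cval].
- apply/seteqP; split=> [_ [t _ <-]|x Kx]; first exact: sv.
  by have [t ft] := sf (SigSub (mem_set Kx)); exists t => //; rewrite ft.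
- move=> t; have /(congr1 (fun h => h (f t))) E := @valLK _ _ point K g0.
  by rewrite -[RHS]g0f; exact: E.
- exact/subspace_valL_continuousP.
Qed.

Lemma perfect_kernel : ~ countable X -> exists K' : set T,
  [/\ K' `<=` X, (forall A, A `<=` X -> ~ countable A -> A `&` K' !=set0) &
   exists (f : cantor_space -> T) (g : T -> cantor_space),
    [/\ continuous f, range f = K', (forall t, g (f t) = t) & {within K', continuous g}]].
Proof.
move=> nX; exists K; split; [by move=> x []|exact: meets_kernel|exact: cantor_kernel].
Qed.

End PerfectKernel.

(** * The infinite walk and the compact set it ends in *)

Section Walk.
Variables (R : realType) (N : nat) (cc : nat -> 'I_N).
Variables (p F : nat -> CN R N -> CC R) (a : nat -> nat).
Implicit Types (z w y : CN R N).
Hypothesis holp : forall n, holomorphic_on setT (p n).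
Hypothesis holF : forall n, holomorphic_on setT (F n).
Hypothesis p_le1 : forall n z, n2 z <= 1 -> cabs (p n z) <= 1.
Hypothesis a_gt0 : forall n, (0 < a n)%N.
Hypothesis p0_ge : forall n, expR (- ((a n)%:R * 2^-1 ^+ n.+1)) <= cabs (p n 0).
Hypothesis F0 : forall n, F n 0 = 0.

Definition p_floor n : R := expR (- ((a n)%:R * 2)).

Hypothesis F_desc : forall n z, cabs (F n.+1 z) <= 1 / 2 -> p_floor n.+1 <= cabs (p n.+1 z) ->
  cabs (F n z) <= 1 / 2.

Section Chain.
Variables (V : set (CN R N)) (m n : nat) (alpha : nat -> bool).
Hypotheses (pV : pure_codim_subvariety m V) (mN : (m + 2 <= N)%N) (V0 : V 0).

Let T : R := (wT a n)%:R.

(** Running totals. Step [k] raises [n2] by at most [4 * sig k], less than [5 * (sig k - sig k.+1)],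
    and the exponent by at most [mesh k / 2 = mesh k - mesh k.+1], starting from 1. *)
Definition chain_inv k y := [/\ V y, F n y = 0, n2 y <= 5 * sig R 0 - 5 * sig R k &
  expR (- (T * (2 - mesh R k))) <= cabs (wprod p a n y)].

Definition chain_rel k y y' := exists i b, let j := jx i (alpha k) b in
  [/\ (0 < j)%N, n2 y' = j%:R * sig R k, n2 y <= n2 y' /\ n2 y' <= n2 y + 4 * sig R k,
     (* The walls are avoided at the starting point [y], not at [y']: the bit [b] must be known
        before the shell, whose index contains it, is entered. *)
     (forall z : int, 1 / 4 <= `|shf cc k b y - z%:~R|) & n2 (y' - y) <= (mesh R k / 32) ^+ 2].

Lemma chain_step k y : chain_inv k y -> exists y', chain_inv k.+1 y' /\ chain_rel k y y'.
Proof.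
move=> [Vy Fy y5 yw].
have m0 := mesh_gt0 R k; have m1 := mesh_le1 R k; have mS := meshS R k.
have s0 := sig_gt0 R k; have sS := sigS R k.
have [b hb] := wall_choice (qc cc k y / mesh R k).
have x0 : 0 <= n2 y / sig R k by rewrite divr_ge0 ?n2_ge0// ltW.
have /andP[J1 J2] := truncn_itv x0; set J := Num.trunc _ in J1 J2.
have [i [j1 j2]] := residue_choice J (alpha k) b; rewrite -/(jx i (alpha k) b) in j1 j2.
set j := jx i (alpha k) b in j1 j2.
have r1 : n2 y <= j%:R * sig R k.
  by rewrite -ler_pdivrMr//; apply: le_trans (ltW J2) _; rewrite ler_nat.
have r2 : j%:R * sig R k <= n2 y + 4 * sig R k.
  rewrite -lerBlDr -mulrBl -ler_pdivlMr//; apply: le_trans J1.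
  by rewrite lerBlDr -natrD ler_nat.
have s00 := sig_le R 0.
have r3 : j%:R * sig R k <= 1 by lra.
(* Chosen so that [L * (mesh k / 32) ^+ 2 = 32] exceeds [8 * c + 2 * L * (rho - n2 y)] with [c < 2],
   while [L * sig k = mesh k ^+ 2 / 2] keeps the loss below [mesh k / 2]. *)
pose L := (32 * (32 * 2 ^ k) ^ 2)%N.
have L0 : (0 < L)%N by rewrite muln_gt0 expn_gt0 muln_gt0 expn_gt0.
have LE : (L%:R : R) * mesh R k ^+ 2 = 32 * 32 ^+ 2.
  rewrite /L natrM natrX natrM natrX -mulrA -exprMn -mulrA /mesh -exprMn.
  by rewrite mulfV ?pnatr_eq0// expr1n mulr1.
have [y' [Vy' Fy' y'r y'w y'd]] := walk_step holp p_le1 a_gt0 pV mN (holF n) Vy Fy r1 r3 L0 yw.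
have LR : 0 < (L%:R : R) by rewrite ltr0n.
have Ls : (L%:R : R) * sig R k = mesh R k ^+ 2 / 2.
  rewrite /sig (_ : _ * _ = L%:R * mesh R k ^+ 2 * mesh R k ^+ 2 / 16 ^+ 4); last by field.
  by rewrite LE; field.
have m2 : mesh R k ^+ 2 <= mesh R k by rewrite expr2 ler_piMr// ltW.
have Ld : L%:R * (j%:R * sig R k - n2 y) <= 2 * mesh R k ^+ 2.
  apply: (@le_trans _ _ (L%:R * (4 * sig R k))); first by rewrite ler_pM2l//; lra.
  by rewrite mulrCA Ls; lra.
have T0 : 0 <= T by [].
exists y'; split.
  split => //; first by rewrite y'r sS; lra.
  apply: le_trans y'w; rewrite ler_expR lerN2 ler_wpM2l// mS; move: Ld m2 m1 m0; lra.
exists i, b; split => //.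
- exact: leq_ltn_trans (leq0n _) j1.
- by rewrite y'r; split.
rewrite -(ler_pM2l LR) (_ : L%:R * (mesh R k / 32) ^+ 2 = L%:R * mesh R k ^+ 2 / 32 ^+ 2); last by field.
by rewrite LE; move: y'd Ld m2 m1 m0; lra.
Qed.

Lemma chain_step_total (ky : nat * CN R N) : exists y', chain_inv ky.1 ky.2 ->
  chain_inv ky.1.+1 y' /\ chain_rel ky.1 ky.2 y'.
Proof.
case: ky => k y /=; have [h|h] := pselect (chain_inv k y); last by exists 0.
by have [y' hy'] := chain_step h; exists y'.
Qed.

Lemma chain_exists : exists ys : nat -> CN R N,
  forall k, chain_inv k (ys k) /\ chain_rel k (ys k) (ys k.+1).
Proof.
have [nxt hn] := choice chain_step_total.
pose fix ys k : CN R N := if k is k'.+1 then nxt (k', ys k') else 0.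
have inv k : chain_inv k (ys k).
  elim: k => [|k ih]; last by case: (hn (k, ys k) ih).
  split => //; first by rewrite n2_0 subrr.
  rewrite /mesh expr0 (_ : 2 - 1 = 1); last by ring.
  by rewrite mulr1; exact: wprod0_ge.
by exists ys => k; split => //; case: (hn (k, ys k) (inv k)).
Qed.

Lemma qc_step k l y y' : n2 (y' - y) <= (mesh R k / 32) ^+ 2 -> `|qc cc l y' - qc cc l y| <= mesh R k / 32.
Proof.
move=> h; apply: le_trans (qc_lip _ _ _ _) _.
have m0 := mesh_gt0 R k.
rewrite -(@ler_pXn2r _ 2) ?nnegrE ?cabs_ge0//; last by rewrite divr_ge0// ltW.
exact: le_trans (cabs_n2 _ _) h.
Qed.

Lemma chain_point K : exists y, [/\ V y, F n y = 0, sig R 0 <= n2 y /\ n2 y <= 1,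
  expR (- (T * 2)) <= cabs (wprod p a n y) & forall k, (k <= K)%N -> lev cc k (alpha k) y].
Proof.
have [ys hys] := chain_exists.
have mono k d : n2 (ys k) <= n2 (ys (k + d)%N) /\ n2 (ys (k + d)%N) <= n2 (ys k) + 5 * sig R k - 5 * sig R (k + d).
  elim: d => [|d [h1 h2]]; first by rewrite addn0; split => //; lra.
  rewrite addnS; have [_ [i [b [_ _ [r1 r2] _ _]]]] := hys (k + d)%N.
  have s0 := sig_gt0 R (k + d); have sS := sigS R (k + d).
  by split; [exact: le_trans h1 r1|rewrite sS; lra].
have near l k d : `|qc cc l (ys (k + d)%N) - qc cc l (ys k)| <= (mesh R k - mesh R (k + d)) / 16.
  elim: d => [|d ih]; first by rewrite addn0 !subrr normr0 mul0r.
  rewrite addnS; have [_ [i [b [_ _ _ _ /(qc_step l) r]]]] := hys (k + d)%N.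
  apply: le_trans (ler_distD (qc cc l (ys (k + d)%N)) _ _) _.
  by rewrite meshS; move: r ih; lra.
have [[Vy Fy y5 yw] _] := hys K.+1.
exists (ys K.+1); split => //.
- have [_ [i [b [j0 y1 _ _ _]]]] := hys 0%N; have [h _] := mono 1%N K.
  have s0 := sig_gt0 R 0; have sl := sig_le R 0; have sK := sig_gt0 R K.+1.
  split; last by lra.
  by apply: le_trans h; rewrite y1 ler_peMl ?ler1n// ltW.
- apply: le_trans yw; rewrite ler_expR lerN2 ler_wpM2l//.
  by have := mesh_gt0 R K.+1; lra.
move=> k kK; have [_ [i [b [_ y1 _ hw _]]]] := hys k.
have m0 := mesh_gt0 R k.
(* After step [k] the squared radius grows by at most [5 * sig k.+1], less than the allowance
   [sig k / 2]. The coordinate moves by at most [mesh k / 16] in all, so a distance of 1/4 from the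
   walls stays above 1/8. *)
exists i, b; split.
  have [h1 h2] := mono k.+1 (K - k)%N; have E : (k.+1 + (K - k) = K.+1)%N by lia.
  rewrite E in h1 h2; have s0 := sig_gt0 R k; have sK := sig_gt0 R K.+1; have sS := sigS R k.
  by rewrite /band -y1; split => //; lra.
move=> z; have := near k k (K.+1 - k)%N; rewrite (_ : k + (K.+1 - k) = K.+1)%N; last by lia.
have mK := mesh_gt0 R K.+1.
set u := qc _ _ _; set v := qc _ _ _ => uv; have := hw z; rewrite /shf -/u -/v => wv.
have {}uv : `|u / mesh R k - v / mesh R k| <= 1 / 16.
  have mi : 0 <= (mesh R k)^-1 by rewrite invr_ge0 ltW.
  rewrite -mulrBl normrM [X in _ * X]ger0_norm// ler_pdivrMr//.
  by move: uv; lra.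
have : `|v / mesh R k - (b : nat)%:R / 2 - z%:~R| <=
    `|u / mesh R k - (b : nat)%:R / 2 - z%:~R| + `|u / mesh R k - v / mesh R k|.
  rewrite (_ : v / mesh R k - _ - _ = (u / mesh R k - (b : nat)%:R / 2 - z%:~R) - (u / mesh R k - v / mesh R k)).
    exact: ler_normB.
  by ring.
by move: uv wv; lra.
Qed.

End Chain.

Definition core := [set z | [/\ sig R 0 <= n2 z, n2 z <= 1, (forall n, p_floor n <= cabs (p n z)),
  (forall n, cabs (F n z) <= 1 / 2) & forall k, exists b, lev cc k b z]].

Lemma vcts_p n z : vcts (fun w => cabs (p n w)) z.
Proof. by apply: vcts_cabs; exact: (hol_cont _ (holp n)). Qed.

Lemma vcts_F n z : vcts (fun w => cabs (F n w)) z.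
Proof. by apply: vcts_cabs; exact: (hol_cont _ (holF n)). Qed.

(** Each finite walk satisfies only one equation and finitely many levels; a cluster point of the
    walks, with both numbers growing, satisfies all closed conditions and still follows [alpha]. *)
Lemma core_meets V m alpha : pure_codim_subvariety m V -> (m + 2 <= N)%N -> V 0 ->
  exists x, [/\ V x, core x & forall k, lev cc k (alpha k) x].
Proof.
move=> pV mN V0; have [[cV _] _] := pV.
have [f hf] := choice (fun s => chain_point s alpha pV mN V0 s).
have [|x [Vx x1] lim] := cluster_limit (f := f) (compact_n20 (rho := 1) cV).
  by move=> s; have [? _ [_ ?]] := hf s; split.
have p_ge s n : (n <= s)%N -> p_floor n <= cabs (p n (f s)).
  move=> ns; have [_ _ [_ f1] fw _] := hf s.
  exact: (wprod_ge p_le1 a_gt0 (Ordinal (ns : (n < s.+1)%N)) f1 fw).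
(* Descent from [F s (f s) = 0] through [F_desc], using the lower bounds [p_ge] already obtained. *)
have F_le s d : (d <= s)%N -> cabs (F (s - d)%N (f s)) <= 1 / 2.
  elim: d => [|d ih] ds; first by rewrite subn0; have [_ -> _ _ _] := hf s; rewrite cabs0.
  have E : ((s - d.+1).+1 = s - d)%N by lia.
  by apply: F_desc; rewrite E; [apply: ih; lia|apply: p_ge; lia].
have xlev k : lev cc k (alpha k) x.
  have [_ //] : [set z | n2 z <= 1 /\ lev cc k (alpha k) z] x.
  apply: (lim _ k); first exact: closed_lev.
  by move=> s ks; have [_ _ [_ f1] _ fl] := hf s; split => //; exact: fl.
exists x; split => //; split => //.
- apply: (lim [set z | sig R 0 <= n2 z] 0%N).
    by apply: closed_vcts_ge => z; exact: vcts_n2'.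
  by move=> s _; have [_ _ []] := hf s.
- move=> n; apply: (lim [set z | p_floor n <= cabs (p n z)] n).
    by apply: closed_vcts_ge => z; exact: vcts_p.
  by move=> s ns; exact: p_ge.
- move=> n; apply: (lim [set z | cabs (F n z) <= 1 / 2] n).
    by apply: closed_vcts_le => z; exact: vcts_F.
  by move=> s ns; have := @F_le s (s - n)%N; rewrite subKn//; apply; lia.
- by move=> k; exists (alpha k).
Qed.

(** By [lev_inj] the point determines the sequence [alpha], so binary sequences inject into the
    intersection. *)
Lemma core_uncountable V m : pure_codim_subvariety m V -> (m + 2 <= N)%N -> V 0 ->
  ~ countable (V `&` core).
Proof.
move=> pV mN V0 /countable_injP[g gi].
have [x hx] := choice (fun alpha => core_meets alpha pV mN V0).
apply: (@no_inj_bool_seq (g \o x)) => al be /= gab.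
have xab : x al = x be.
  by apply: gi gab; apply: mem_set; [have [] := hx al|have [] := hx be].
apply/funext => k; have [_ _ ha] := hx al; have [_ _ hb] := hx be.
by apply: (lev_inj (ha k)); rewrite xab.
Qed.

Lemma closed_core : closed core.
Proof.
have -> : core = [set z | sig R 0 <= n2 z] `&` (\bigcap_n [set z | p_floor n <= cabs (p n z)]
   `&` (\bigcap_n [set z | cabs (F n z) <= 1 / 2]
   `&` (\bigcap_k ([set z | n2 z <= 1 /\ lev cc k true z] `|` [set z | n2 z <= 1 /\ lev cc k false z])))).
  apply/seteqP; split=> z.
    move=> [z0 z1 zp zF zl]; split => //.
    split; first by move=> n _; exact: zp.
    split; first by move=> n _; exact: zF.
    move=> k _; have [b hb] := zl k.
    by case: b hb => hb; [left|right].
  move=> [z0 [zp [zF zl]]]; split => //.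
  - by have [[]|[]] := zl 0%N I.
  - by move=> n; exact: zp.
  - by move=> n; exact: zF.
  - by move=> k; have [[_ h]|[_ h]] := zl k I; [exists true|exists false].
apply: closedI; first by apply: closed_vcts_ge => z; exact: vcts_n2'.
apply: closedI; first by apply: closed_bigI => n _; apply: closed_vcts_ge => z; exact: vcts_p.
apply: closedI; first by apply: closed_bigI => n _; apply: closed_vcts_le => z; exact: vcts_F.
by apply: closed_bigI => k _; apply: closedU; exact: closed_lev.
Qed.

Lemma compact_core : compact core.
Proof.
apply: (subclosed_compact closed_core (compact_n20 (rho := 1) closedT)).
by move=> z [].
Qed.

Definition cellU (c : nat * nat * (bool * bool) * int) : set (CN R N) := let: (k, i, (e, b), u) := c in
  [set z | band k (jx i e b) z /\ u%:~R + 1 / 8 <= shf cc k b z <= u%:~R + 7 / 8].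

Definition cell_seq n : set (CN R N) := if unpickle n is Some c then cellU c else classical_sets.set0.

Lemma closed_cell c : closed (cellU c).
Proof.
case: c => [[[k i] [e b]] u] /=.
rewrite (_ : [set z | _] = [set z | band k (jx i e b) z] `&`
   ([set z | u%:~R + 1 / 8 <= shf cc k b z] `&` [set z | shf cc k b z <= u%:~R + 7 / 8])).
  apply: closedI; first exact: closed_band.
  apply: closedI; first by apply: closed_vcts_ge => z; exact: vcts_shf.
  by apply: closed_vcts_le => z; exact: vcts_shf.
by apply/seteqP; split=> z; [move=> [h1 /andP[h2 h3]]|move=> [h1 [h2 h3]]; split => //; apply/andP].
Qed.

(** On [core] the bands and walls leave gaps, so the strict inequalities describing the complement
    of a cell can be replaced by weak ones; this makes the complement closed. *)
Lemma core_cellC k i e b u : core `&` ~` cellU (k, i, (e, b), u) =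
  core `&` (([set z | (jx i e b)%:R * sig R k + sig R k <= n2 z] `|` [set z | n2 z <= (jx i e b)%:R * sig R k - sig R k / 2])
    `|` ([set z | shf cc k b z <= u%:~R - 1 / 8] `|` [set z | u%:~R + 9 / 8 <= shf cc k b z])).
Proof.
have s0 := sig_gt0 R k.
apply/seteqP; split=> z [Xz].
  move=> nU; split => //.
  have [_ _ _ _ /(_ k) [e' [i' [b' [[B1 B2] W]]]]] := Xz.
  have [lt|gt|E] := ltngtP (jx i e b) (jx i' e' b').
  - left; left => /=; apply: le_trans B1; rewrite -{2}[sig R k]mul1r -mulrDl ler_pM2r// natr1 ler_nat //.
  - left; right => /=; apply: (le_trans B2).
    have : (jx i' e' b')%:R + 1 <= (jx i e b)%:R :> R by rewrite natr1 ler_nat.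
    nra.
  have [_ _ Eb] := jx_inj E; subst b'; right.
  have w1 := W u; have w2 := W (u + 1); rewrite intrD in w2.
  move: w1 w2; set s := shf cc k b z => w1 w2.
  have [h1|h1] := leP s u%:~R; first by left => /=; rewrite -/s; move: w1; rewrite ler0_norm; lra.
  have {}w1 : u%:~R + 1 / 8 <= s by move: w1; rewrite ger0_norm; lra.
  have [h2|h2] := leP s (u%:~R + 1); last by right => /=; rewrite -/s; move: w2; rewrite ger0_norm; lra.
  have {}w2 : s <= u%:~R + 7 / 8 by move: w2; rewrite ler0_norm; lra.
  by case: nU; split; [rewrite E|rewrite w1 w2].
move=> h; split => // -[[B1 B2] /andP[S1 S2]].
by move: h => /= [[h|h]|[h|h]]; lra.
Qed.

Lemma closed_core_cells n : closed (core `&` cell_seq n) /\ closed (core `&` ~` cell_seq n).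
Proof.
rewrite /cell_seq; case: unpickle => [c|]; last first.
  by rewrite setI0 setC0 setIT; split; [exact: closed0|exact: closed_core].
split; first by apply: closedI; [exact: closed_core|exact: closed_cell].
case: c => [[[k i] [e b]] u]; rewrite core_cellC; apply: closedI; first exact: closed_core.
apply: closedU; apply: closedU.
- by apply: closed_vcts_ge => z; exact: vcts_n2'.
- by apply: closed_vcts_le => z; exact: vcts_n2'.
- by apply: closed_vcts_le => z; exact: vcts_shf.
- by apply: closed_vcts_ge => z; exact: vcts_shf.
Qed.

Lemma mesh_small (e : R) : 0 < e -> exists K, forall k, (K <= k)%N -> mesh R k < e.
Proof.
move=> e0; have e1 : 0 <= e^-1 by rewrite invr_ge0 ltW.
have /andP[_ K1] := truncn_itv e1.
set K := (Num.trunc _).+1 in K1; exists K => k Kk.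
rewrite /mesh exprVn invf_plt ?posrE ?exprn_gt0//; apply: (lt_trans K1).
rewrite -natrX ltr_nat; apply: leq_ltn_trans Kk _; exact: ltn_expl.
Qed.

Hypothesis ccP : forall i b K, exists k, [/\ (K <= k)%N, cc k = i & odd k = b].

(** Two distinct points differ in some real coordinate, which recurs in [cc] at a mesh below their
    difference; points in one cell differ there by at most 3/4 of the mesh. *)
Lemma core_sep x y : core x -> core y -> x <> y -> exists n, cell_seq n x <> cell_seq n y.
Proof.
move=> Xx Xy xy.
have [i [b ib]] : exists i b, 0 < `|(if b then cim (x ord0 i) else cre (x ord0 i)) -
    (if b then cim (y ord0 i) else cre (y ord0 i))|.
  apply: contrapT => h; apply: xy; apply/rowP => i.
  have E b : (if b then cim (x ord0 i) else cre (x ord0 i)) = (if b then cim (y ord0 i) else cre (y ord0 i)).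
    apply/eqP; rewrite -subr_eq0 -normr_le0 leNgt; apply/negP => h'; apply: h; by exists i, b.
  by move: (E true) (E false) => /=; case: (x ord0 i) => u v; case: (y ord0 i) => u' v' /= -> ->.
have [K hK] := mesh_small ib; have [k [Kk ki kb]] := ccP i b K.
have q_far : mesh R k < `|qc cc k x - qc cc k y| by rewrite /qc kb ki; exact: hK.
have m0 := mesh_gt0 R k.
have [_ _ _ _ /(_ k) [e [i' [b' [B W]]]]] := Xx.
have /andP[f1 f2] := floor_itv (shf cc k b' x); set u := Num.floor _ in f1 f2.
pose c : nat * nat * (bool * bool) * int := (k, i', (e, b'), u).
exists (pickle c); rewrite /cell_seq pickleK /c.
have cx : cellU (k, i', (e, b'), u) x.
  split => //; have w1 := W u; have w2 := W (u + 1); rewrite intrD in w2 f2.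
  by move: w1 w2; rewrite ger0_norm ?ler0_norm; [move=> w1 w2; apply/andP; split; lra|lra|lra].
move=> cxy; have [_ /andP[y1 y2]] : cellU (k, i', (e, b'), u) y by rewrite -cxy.
have [_ /andP[x1 x2]] := cx.
have : `|qc cc k x - qc cc k y| / mesh R k <= 3 / 4.
  have mi : 0 <= (mesh R k)^-1 by rewrite invr_ge0 ltW.
  rewrite -[(mesh R k)^-1]ger0_norm// -normrM mulrBl.
  by move: x1 x2 y1 y2; rewrite /shf ler_norml => x1 x2 y1 y2; apply/andP; split; lra.
by rewrite ler_pdivrMr//; move: q_far m0; lra.
Qed.

End Walk.

Import (canonicals) mpoly.

(** * Dense sequences of polynomials and inverses in P(X) *)

Section Polynomials.
Variables (R : realType) (N : nat).
Implicit Types (z : CN R N) (P : mpoly.mpoly N (CC R)).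

Lemma poly_evalD P Q z : poly_eval (P + Q) z = poly_eval P z + poly_eval Q z.
Proof. exact: mpoly.mevalD. Qed.
Lemma poly_evalB P Q z : poly_eval (P - Q) z = poly_eval P z - poly_eval Q z.
Proof. exact: mpoly.mevalB. Qed.
Lemma poly_evalM P Q z : poly_eval (P * Q) z = poly_eval P z * poly_eval Q z.
Proof. exact: mpoly.mevalM. Qed.
Lemma poly_evalZ (c : CC R) P z : poly_eval (c *: P) z = c * poly_eval P z.
Proof. exact: mpoly.mevalZ. Qed.
Lemma poly_eval1 z : poly_eval 1 z = 1.
Proof. exact: mpoly.meval1. Qed.
Lemma poly_eval0 z : poly_eval 0 z = 0.
Proof. exact: mpoly.meval0. Qed.
Lemma poly_evalX (m : mpoly.multinom N) z :
  poly_eval (mpoly.mpolyX (CC R) m) z = \prod_i z ord0 i ^+ mpoly.fun_of_multinom m i.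
Proof. exact: mpoly.mevalX. Qed.

Lemma hol_poly P : holomorphic_on setT (poly_eval P).
Proof.
elim/mpoly.mpolyind : P => [|c m P _ _ ih].
  rewrite (_ : poly_eval 0 = fun=> 0); first exact: hol_cst.
  by apply/funext => z; exact: poly_eval0.
rewrite (_ : poly_eval _ = fun z => c * (\prod_i z ord0 i ^+ mpoly.fun_of_multinom m i) + poly_eval P z).
  apply: holD => //; apply: holM; first exact: hol_cst.
  by apply: hol_prod => i; apply: holX; exact: hol_coord.
by apply/funext => z; rewrite poly_evalD poly_evalZ poly_evalX.
Qed.

Lemma mono_le1 (m : mpoly.multinom N) z : n2 z <= 1 ->
  cabs (poly_eval (mpoly.mpolyX (CC R) m) z) <= 1.
Proof.
move=> z1; rewrite poly_evalX cabs_prod; apply: prod_le1 => i.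
rewrite cabsX exprn_ge0 ?cabs_ge0//= exprn_ile1 ?cabs_ge0//.
rewrite -(@ler_pXn2r _ 2) ?nnegrE ?cabs_ge0// expr1n.
exact: le_trans (cabs_n2 _ _) z1.
Qed.

Definition ratC (x : rat * rat) : CC R := (ratr x.1 +i* ratr x.2)%C.

Definition qpoly (t : seq (mpoly.multinom N * (rat * rat))) : mpoly.mpoly N (CC R) :=
  \sum_(x <- t) ratC x.2 *: mpoly.mpolyX (CC R) x.1.

Lemma ratC_dense (c : CC R) (e : R) : 0 < e -> exists x, cabs (c - ratC x) < e.
Proof.
move=> e0.
have [a] := @rat_in_itvoo R (cre c) (cre c + e / 2) (ltac:(lra)).
have [b] := @rat_in_itvoo R (cim c) (cim c + e / 2) (ltac:(lra)).
rewrite !in_itv /= => /andP[b1 b2] /andP[a1 a2]; exists (a, b).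
apply: le_lt_trans (cabs_le _) _.
rewrite creD creN cimD cimN /= !ltr0_norm; lra.
Qed.

Lemma qpoly_dense P (e : R) : 0 < e -> exists t, forall z, n2 z <= 1 ->
  cabs (poly_eval P z - poly_eval (qpoly t) z) < e.
Proof.
elim/mpoly.mpolyind : P e => [|c m P _ _ ih] e e0.
  by exists [::] => z _; rewrite /qpoly big_nil subrr cabs0.
have e2 : 0 < e / 2 by lra.
have [t ht] := ih _ e2; have [x hx] := ratC_dense c e2.
exists ((m, x) :: t) => z z1; rewrite /qpoly big_cons -/(qpoly t) /=.
rewrite !poly_evalD !poly_evalZ.
have h1 := ht z z1; have h2 := mono_le1 m z1; set X := poly_eval (mpoly.mpolyX _ _) _ in h2 *.
rewrite (_ : _ - _ = (c - ratC x) * X + (poly_eval P z - poly_eval (qpoly t) z)); last by ring.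
apply: le_lt_trans (cabsD _ _) _; rewrite cabsM.
have : cabs (c - ratC x) * cabs X <= cabs (c - ratC x) by rewrite ler_piMr ?cabs_ge0.
by move: hx h1; lra.
Qed.

(** A small rational constant is added if needed: the walk starts at 0, where none of the
    polynomials may vanish. *)
Lemma qpoly_dense0 P (e : R) : 0 < e -> exists2 t, poly_eval (qpoly t) 0 != 0 &
  forall z, n2 z <= 1 -> cabs (poly_eval P z - poly_eval (qpoly t) z) < e.
Proof.
move=> e0; have e2 : 0 < e / 2 by lra.
have [t ht] := qpoly_dense P e2.
have [t0|t0] := eqVneq (poly_eval (qpoly t) 0) 0; last first.
  by exists t => // z z1; apply: lt_trans (ht z z1) _; lra.
have [a] := rat_in_itvoo e2; rewrite in_itv /= => /andP[a1 a2].
have X1 z : poly_eval (mpoly.mpolyX (CC R) (@mpoly.mnm0 N)) z = 1.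
  by rewrite poly_evalX big1// => i _; rewrite mpoly.mnm0E expr0.
have qE : ratC (a, 0) = (ratr a)%:C%C by rewrite /ratC /= rmorph0.
have E z : poly_eval (qpoly ((@mpoly.mnm0 N, (a, 0)) :: t)) z = (ratr a)%:C%C + poly_eval (qpoly t) z.
  by rewrite /qpoly big_cons -/(qpoly t) poly_evalD poly_evalZ X1 mulr1 qE.
exists ((@mpoly.mnm0 N, (a, 0)) :: t).
  by rewrite E t0 addr0 -cabs_gt0 cabsR normr_gt0 lt0r_neq0.
move=> z z1; rewrite E opprD addrCA; apply: le_lt_trans (cabsD _ _) _.
by rewrite cabsN cabsR gtr0_norm//; have := ht z z1; lra.
Qed.

(** Enumerates polynomials with rational complex coefficients; codes that give no polynomial, or one
    vanishing at 0, yield the harmless value 1. *)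
Definition dpoly n : mpoly.mpoly N (CC R) := if unpickle n is Some t then
  (if poly_eval (qpoly t) 0 == 0 then 1 else qpoly t) else 1.

Lemma dpoly0 n : poly_eval (dpoly n) 0 != 0.
Proof.
rewrite /dpoly; case: unpickle => [t|]; last by rewrite poly_eval1 oner_neq0.
by have [_|] := eqVneq (poly_eval (qpoly t) 0) 0; first by rewrite poly_eval1 oner_neq0.
Qed.

Lemma dpoly_dense P (e : R) : 0 < e -> exists n, forall z, n2 z <= 1 ->
  cabs (poly_eval P z - poly_eval (dpoly n) z) < e.
Proof.
move=> e0; have [t t0 ht] := qpoly_dense0 P e0.
by exists (pickle t); rewrite /dpoly pickleK (negbTE t0).
Qed.

Lemma poly_bounded P : exists M : R, 0 < M /\ forall z, n2 z <= 1 -> cabs (poly_eval P z) <= M.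
Proof.
have [||q _ qm] := vmax (compact_n20 (N := N) (rho := (1 : R)) closedT) (u := fun z => cabs (poly_eval P z)).
- by exists 0; split => //; rewrite n2_0.
- by move=> z _; apply: vcts_cabs; exact: (hol_cont _ (hol_poly P)).
exists (cabs (poly_eval P q) + 1); split; first by rewrite ltr_wpDl ?cabs_ge0.
by move=> z z1; apply: (le_trans (qm z (conj I z1))); rewrite lerDl.
Qed.

Fixpoint neumann (P H : mpoly.mpoly N (CC R)) K : mpoly.mpoly N (CC R) :=
  if K is K'.+1 then H + (1 - P * H) * neumann P H K' else 0.

Lemma neumannE P H K z :
  1 - poly_eval P z * poly_eval (neumann P H K) z = (1 - poly_eval P z * poly_eval H z) ^+ K.
Proof.
elim: K => [|K ih] /=; first by rewrite poly_eval0 mulr0 subr0 expr0.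
rewrite exprS -ih poly_evalD poly_evalM poly_evalB poly_eval1 poly_evalM.
by set u := poly_eval P z; set v := poly_eval H z; set w := poly_eval _ z; ring.
Qed.

(** By [neumannE] the error after [K] terms is the [K]-th power of [1 - P H] divided by [P], hence
    at most [mesh R K / d]. *)
Lemma inv_in_PX (X : set (CN R N)) P H (d : R) : 0 < d ->
  (forall z, X z -> d <= cabs (poly_eval P z)) ->
  (forall z, X z -> cabs (poly_eval P z * poly_eval H z - 1) <= 1 / 2) ->
  in_PX X (fun z => (poly_eval P z)^-1).
Proof.
move=> d0 hP hH e e0; have [K hK] := mesh_small (mulr_gt0 d0 e0).
exists (neumann P H K) => z Xz; rewrite lt_normE.
have Pz := hP z Xz; have P0 : 0 < cabs (poly_eval P z) := lt_le_trans d0 Pz.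
have nz : poly_eval P z != 0 by rewrite -cabs_gt0.
have E : (poly_eval P z)^-1 - poly_eval (neumann P H K) z =
    (poly_eval P z)^-1 * (1 - poly_eval P z * poly_eval (neumann P H K) z).
  by rewrite mulrBr mulr1 mulrA mulVf// mul1r.
rewrite E neumannE cabsM cabsV cabsX mulrC ltr_pdivrMr//.
apply: (@le_lt_trans _ _ (mesh R K)).
  rewrite /mesh lerXn2r ?nnegrE ?cabs_ge0 ?invr_ge0//.
  by rewrite cabsB; have := hH z Xz; lra.
apply: lt_le_trans (hK K (leqnn _)) _.
by rewrite mulrC ler_pM2l.
Qed.

End Polynomials.

(** * Normalised polynomials and the nested auxiliary polynomials *)

Section Construction.
Variables (R : realType) (N : nat) (M : nat -> R) (a : nat -> nat).
Hypothesis M_gt0 : forall n, 0 < M n.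

Definition npoly n : mpoly.mpoly N (CC R) := ((M n)^-1)%:C%C *: dpoly R N n.

(* Since hpoly n.+1 contains a large multiple of npoly n * hpoly n - 1, smallness of
   fpoly n.+1 forces smallness of fpoly n: one equation on V controls all the
   earlier polynomials. *)
Fixpoint hpoly n : mpoly.mpoly N (CC R) := (poly_eval (npoly n) 0)^-1 *: 1 +
  (if n is n'.+1 then (5 / p_floor R a n)%:C%C *: (npoly n' * hpoly n' - 1) else 0).

Definition fpoly n : mpoly.mpoly N (CC R) := npoly n * hpoly n - 1.

Lemma npoly0 n : poly_eval (npoly n) 0 != 0.
Proof.
rewrite poly_evalZ mulf_neq0 ?dpoly0// -cabs_gt0 cabsR normr_gt0 invr_eq0.
exact: lt0r_neq0.
Qed.

Lemma fpoly_eval n z : poly_eval (fpoly n) z = poly_eval (npoly n) z * poly_eval (hpoly n) z - 1.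
Proof. by rewrite [LHS]poly_evalB poly_eval1; congr (_ - _); exact: poly_evalM. Qed.

Lemma hpoly_eval0 z : poly_eval (hpoly 0) z = (poly_eval (npoly 0) 0)^-1.
Proof. by rewrite [LHS]poly_evalD poly_eval0 addr0 [LHS]poly_evalZ poly_eval1 mulr1. Qed.

Lemma hpoly_evalS n z : poly_eval (hpoly n.+1) z =
  (poly_eval (npoly n.+1) 0)^-1 + (5 / p_floor R a n.+1)%:C%C * poly_eval (fpoly n) z.
Proof.
rewrite [LHS]poly_evalD; congr (_ + _); last exact: poly_evalZ.
by rewrite [LHS]poly_evalZ poly_eval1 mulr1.
Qed.

Lemma fpoly0 n : poly_eval (fpoly n) 0 = 0.
Proof.
elim: n => [|n ih]; rewrite fpoly_eval ?hpoly_eval0 ?hpoly_evalS ?ih ?mulr0 ?addr0.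
  by rewrite mulfV ?npoly0// subrr.
by rewrite mulfV ?npoly0// subrr.
Qed.

(** Origin of the 5: writing [e] for [p_floor], the hypotheses give modulus at most [3 / (2 * e)] to
    [hpoly n.+1] and at most [1 / e] to its constant term, so [5 / e] times the modulus of [fpoly n]
    is at most [5 / (2 * e)]. *)
Lemma fpoly_desc n z : p_floor R a n.+1 <= cabs (poly_eval (npoly n.+1) 0) ->
  cabs (poly_eval (fpoly n.+1) z) <= 1 / 2 ->
  p_floor R a n.+1 <= cabs (poly_eval (npoly n.+1) z) -> cabs (poly_eval (fpoly n) z) <= 1 / 2.
Proof.
have e0 : 0 < p_floor R a n.+1 by exact: expR_gt0.
rewrite fpoly_eval hpoly_evalS.
move: (p_floor R a n.+1) e0 => e e0.
set p0 := poly_eval (npoly n.+1) 0; set p := poly_eval (npoly n.+1) z; set f := poly_eval (fpoly n) z.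
move=> hp0 hf hp.
set h := p0^-1 + (5 / e)%:C%C * f in hf.
have ph : cabs (p * h) <= 3 / 2.
  rewrite (_ : p * h = (p * h - 1) + 1); last by ring.
  by apply: le_trans (cabsD _ _) _; rewrite cabs1; lra.
have hh : e * cabs h <= 3 / 2.
  by apply: le_trans ph; rewrite cabsM ler_wpM2r ?cabs_ge0.
have p0i : e * cabs p0^-1 <= 1.
  by rewrite cabsV -ler_pdivlMr ?invr_gt0 ?(lt_le_trans e0)// invrK mul1r.
have E : (5 / e)%:C%C * f = h - p0^-1 by rewrite /h; ring.
have E2 : 5 / e * cabs f = cabs (h - p0^-1).
  by rewrite -E cabsM cabsR gtr0_norm// divr_gt0.
have : 5 / e * cabs f <= cabs h + cabs p0^-1.
  by rewrite E2; apply: le_trans (cabsD _ _) _; rewrite cabsN.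
rewrite mulrAC ler_pdivrMr// => h5.
by move: h5 hh p0i; lra.
Qed.

End Construction.

(** Lets [core_uncountable] be applied to the whole space, which shows that the core itself is
    uncountable. Equations cutting out the whole space vanish near the point, so their differentials
    cannot be independent unless there are none. *)
Lemma pure_setT (R : realType) (N : nat) : pure_codim_subvariety 0 [set: CN R N].
Proof.
split; first split; first exact: closedT.
  move=> q; exists setT, 0%N, (fun _ _ => 0); split => //; first exact: openT.
    by case.
  by apply/seteqP; split => z //= _; split => // -[].
move=> q [|m]// [_ [U [g [oU Uq hg E ind]]]].
have g0 z i : U z -> g i z = 0.
  move=> Uz; have : ([set: CN R N] `&` U) z by [].
  by rewrite E => -[_]; apply.
have := ind q I Uq (fun=> 1) _ ord0.
have d0 (v : CN R N) : \sum_(i < m.+1) 1 * ('d (g i) q) v = 0.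
  rewrite big1// => i _; rewrite mul1r -deriveE; last exact: (hg i q Uq).
  rewrite (@near_eq_derive _ _ _ (g i) (cst 0) q v); first exact: derive_cst.
  by apply: filterS (open_nbhs_nbhs (conj oU Uq)) => z Uz; rewrite (g0 z i Uz).
by move=> /(_ d0) /eqP; rewrite oner_eq0.
Qed.

Theorem theorem7p1 (R : realType) (N : nat) :
  (3 <= N)%N ->
  exists X : set (CN R N),
    [/\ cantor_set X,
        rational_hull (N - 2) X `\` X !=set0 &
        PX_dense_invertibles X].
Proof.
move=> N3; have N0 : (0 < N)%N by exact: leq_trans N3.
have [M hM] := choice (fun n => poly_bounded (dpoly R N n)).
have M0 n : 0 < M n by case: (hM n).
pose p n := poly_eval (npoly N M n).
have p00 n : 0 < cabs (p n 0) by rewrite cabs_gt0 npoly0.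
(* Any integer above [2 ^+ n.+1] times the absolute logarithm of [cabs (p n 0)] will do. *)
have exa n : exists a : nat, (0 < a)%N /\ expR (- (a%:R * 2^-1 ^+ n.+1)) <= cabs (p n 0).
  have h0 : 0 < (2^-1 : R) ^+ n.+1 by rewrite exprn_gt0.
  have x0 : 0 <= `|ln (cabs (p n 0))| / 2^-1 ^+ n.+1 by rewrite divr_ge0// ltW.
  have /andP[_ b2] := truncn_itv x0; set b := (Num.trunc _).+1 in b2.
  exists b; split => //; rewrite -[leRHS]lnK ?posrE// ler_expR lerNl.
  rewrite ltr_pdivrMr// in b2; apply: le_trans (ltW b2).
  by rewrite -normrN ler_norm.
have [a ha] := choice exa.
have a0 n : (0 < a n)%N by case: (ha n).
have p0 n : expR (- ((a n)%:R * 2^-1 ^+ n.+1)) <= cabs (p n 0) by case: (ha n).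
pose F n := poly_eval (fpoly N M a n).
have hp n : holomorphic_on setT (p n) by exact: hol_poly.
have hF n : holomorphic_on setT (F n) by exact: hol_poly.
have p1 n z : n2 z <= 1 -> cabs (p n z) <= 1.
  move=> z1; rewrite /p poly_evalZ cabsM cabsR gtr0_norm ?invr_gt0// mulrC ler_pdivrMr// mul1r.
  by case: (hM n) => _; apply.
have F0 n : F n 0 = 0 by exact: fpoly0.
have eta0 n : p_floor R a n <= cabs (p n 0).
  apply: le_trans (p0 n); rewrite ler_expR lerN2 ler_wpM2l//.
  have : (2^-1 : R) ^+ n.+1 <= 1 by rewrite exprn_ile1// invf_le1// ler1n.
  by lra.
have Fd n z : cabs (F n.+1 z) <= 1 / 2 -> p_floor R a n.+1 <= cabs (p n.+1 z) -> cabs (F n z) <= 1 / 2.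
  by apply: fpoly_desc; exact: eta0.
(* Consecutive pairs of levels treat the real and the imaginary part of one coordinate, and the
   coordinates recur cyclically. *)
pose cc k := Ordinal (ltn_pmod k./2 N0).
have ccP i b K : exists k, [/\ (K <= k)%N, cc k = i & odd k = b].
  exists (b + (K * N + i).*2)%N; split.
  - by apply: leq_trans (leq_addl _ _); rewrite -addnn -addnA; apply: leq_trans (leq_addr _ _); rewrite leq_pmulr.
  - by apply: val_inj; rewrite /= half_bit_double modnMDl modn_small.
  - by rewrite oddD odd_double addbF oddb.
pose X := core cc p F a.
have meets V m := @core_uncountable R N cc p F a hp hF p1 a0 p0 F0 Fd V m.
have cX : compact X by exact: compact_core.
have clX n : closed (X `&` cell_seq cc n) /\ closed (X `&` ~` cell_seq cc n) by exact: closed_core_cells.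
have sepX x y : X x -> X y -> x <> y -> exists n, cell_seq cc n x <> cell_seq cc n y.
  by move=> Xx Xy; exact: (core_sep ccP Xx Xy).
have hd : hausdorff_space (CN R N) by exact: norm_hausdorff.
have nX : ~ countable X.
  by have := meets setT 0%N (@pure_setT R N) (ltnW N3) I; rewrite setTI.
have [K [KX Kmeets canK]] :=
  perfect_kernel cX hd (fun n => (clX n).1) (fun n => (clX n).2) sepX nX.
exists K; split => //.
- exists 0; split; last first.
    move=> /KX [h _ _ _ _]; move: h; rewrite n2_0 leNgt sig_gt0 //.
  move=> m V mN pV V0; have mN2 : (m + 2 <= N)%N by lia.
  have [||x [[Vx _] Kx]] := Kmeets (V `&` X).
  + by move=> x [].
  + exact: (meets V m pV mN2 V0).
  by exists x.
move=> f fP e e0; have e2 : 0 < e / 2 by lra.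
(* The approximating polynomial [dpoly R N n] is itself the invertible element sought. *)
have [P hP] := fP _ e2; have [n hn] := dpoly_dense P e2.
have K1 z : K z -> n2 z <= 1 by move=> /KX [].
exists (poly_eval (dpoly R N n)); split; last first.
  move=> z Kz; rewrite lt_normE; apply: le_lt_trans (cabs_triangle _ _ (poly_eval P z)) _.
  by have := hP z Kz; have := hn z (K1 z Kz); rewrite lt_normE; lra.
have dE z : poly_eval (dpoly R N n) z = (M n)%:C%C * p n z.
  rewrite /p poly_evalZ mulrA -[_ * _%:C%C](rmorphM (real_complex R)) mulfV ?lt0r_neq0//.
  by rewrite mul1r.
have Ke z : K z -> M n * p_floor R a n <= cabs (poly_eval (dpoly R N n) z).
  move=> /KX [_ _ pz _ _]; rewrite dE cabsM cabsR gtr0_norm// ler_pM2l//.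
have e_gt0 : 0 < M n * p_floor R a n by rewrite mulr_gt0// expR_gt0.
split.
  by move=> d d0; exists (dpoly R N n) => z _; rewrite lt_normE subrr cabs0.
exists (fun z => (poly_eval (dpoly R N n) z)^-1); split; last first.
  by move=> z Kz; rewrite mulfV// -cabs_gt0; exact: lt_le_trans (Ke z Kz).
(* The normalising factor moves from [npoly] to [hpoly], so the product is the one bounded in
   [core]. *)
apply: (@inv_in_PX R N K (dpoly R N n) (((M n)^-1)%:C%C *: hpoly N M a n) _ e_gt0 Ke) => z /KX [_ _ _ Fz _].
have := Fz n; rewrite /F /fpoly poly_evalB poly_evalM poly_eval1 !poly_evalZ.
by rewrite mulrCA mulrA.
Qed.
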